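(* Let $\alpha\ge0$ and $\mathfrak p\in C([0,\infty))\cap C^1(0,\infty)$ with $\mathfrak p'>0$ on $(0,\infty)$, and let $(\rho,n)$ be a weak solution of the scaled damped Euler system with initial data $(\rho_0,n_0)\in L^1_{\mathrm{loc}}(\mathbb R)^2$ satisfying the following local entropy condition: $\rho,\frac n\rho\in L^\infty_{\mathrm{loc}}([0,\infty);L^\infty(\mathbb R))$, $h(\rho)\in L^1_{\mathrm{loc}}([0,\infty)\times\mathbb R)$, and for all $0\le\chi\in C_c^\infty([0,\infty)\times\mathbb R)$ $$\int_0^\infty\!\!\int_{\mathbb R}-\chi_\tau\eta(\tau;\rho,n)+\chi_y\big(\tfrac y2\eta(\tau;\rho,n)-q(\tau;\rho,n)\big)+\chi\big(\tfrac12\eta(\tau;\rho,n)+\alpha\tfrac{n^2}\rho\big)dy\,d\tau\le\int_{\mathbb R}\chi(0,y)\eta(0;\rho_0,n_0)\,dy.$$ Let either $(\bar\rho,\bar n)\in C^1((0,\infty)\times\mathbb R)^2\cap C([0,\infty)\times\mathbb R)^2$ be bounded with $\inf\bar\rho>0$, or let $(\bar\rho,\bar n)\equiv(0,0)$ and assume that there is $c>0$ with $\mathfrak p'(z)\le c\,\mathfrak p(z)/z$ for $z>0$ and that $\int_0^1\mathfrak p(z)z^{-2}dz<\infty$. Assume $$\mathcal E(0;\rho_0,n_0\,|\,\bar\rho(0),\bar n(0))<\infty,\qquad \xi\in L^1_{\mathrm{loc}}([0,\infty);L^1(\mathbb R)).$$ Then for all $\varphi\in C_c^1([0,\infty))$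 with $\varphi\ge0$, $$\int_0^\infty-\varphi'\,\mathcal E(\tau;\rho,n|\bar\rho,\bar n)+\varphi\Big(\tfrac12\mathcal E(\tau;\rho,n|\bar\rho,\bar n)+\alpha\int_{\mathbb R}\rho\Big|\frac n\rho-\frac{\bar n}{\bar\rho}\Big|^2dy\Big)d\tau\le\varphi(0)\,\mathcal E(0;\rho_0,n_0|\bar\rho(0),\bar n(0))+\int_0^\infty\varphi\int_{\mathbb R}\xi\,dy\,d\tau.$$
   Context: Potential: $h\in C([0,\infty))\cap C^2(0,\infty)$ with $\mathfrak p(z)=zh'(z)-h(z)$, hence $h''(z)=\mathfrak p'(z)/z$, for $z>0$. $h(\rho|\bar\rho)=h(\rho)-h(\bar\rho)-h'(\bar\rho)(\rho-\bar\rho)$, $\mathfrak p(\rho|\bar\rho)=\mathfrak p(\rho)-\mathfrak p(\bar\rho)-\mathfrak p'(\bar\rho)(\rho-\bar\rho)$. Convention: $\frac00:=0$. Scaled damped Euler system on $(0,\infty)\times\mathbb R$: $$\rho_\tau=\tfrac y2\rho_y-n_y,\qquad n_\tau=\tfrac y2 n_y+\tfrac12 n-\Big(\frac{n^2}\rho\Big)_y-e^\tau\big(\mathfrak p(\rho)_y+\alpha n\big).$$ Weak solution with initial data $(\rho_0,n_0)\in L^1_{\mathrm{loc}}(\mathbb R)^2$, $\rho_0\ge0$ a.e.: a pair $(\rho,n)\in L^1_{\mathrm{loc}}([0,\infty)\times\mathbb R)^2$ with $\frac{n^2}\rho,\mathfrak p(\rho)\in L^1_{\mathrm{loc}}([0,\infty)\times\mathbb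 R)$, $\rho\ge0$ a.e., such that for all $\phi,\psi\in C_c^\infty([0,\infty)\times\mathbb R)$ $$-\int_0^\infty\!\!\int_{\mathbb R}\phi_\tau\rho+\phi_y\big(-\tfrac y2\rho+n\big)-\tfrac12\phi\rho\,dy\,d\tau=\int_{\mathbb R}\phi(0,y)\rho_0\,dy,$$ $$-\int_0^\infty\!\!\int_{\mathbb R}\psi_\tau n+\psi_y\Big(-\tfrac y2 n+\frac{n^2}\rho+e^\tau \mathfrak p(\rho)\Big)-\psi e^\tau\alpha n\,dy\,d\tau=\int_{\mathbb R}\psi(0,y)n_0\,dy.$$ Entropy, flux, relative entropy: $$\eta(\tau;\rho,n)=e^{-\tau}\frac{n^2}{2\rho}+h(\rho),\quad q(\tau;\rho,n)=e^{-\tau}\frac{n^3}{2\rho^2}+nh'(\rho),\quad \eta(\tau;\rho,n|\bar\rho,\bar n)=\tfrac12e^{-\tau}\rho\Big|\frac n\rho-\frac{\bar n}{\bar\rho}\Big|^2+h(\rho|\bar\rho),$$ $$\mathcal E(\tau;\rho,n|\bar\rho,\bar n)=\int_{\mathbb R}\eta(\tau;\rho(y),n(y)|\bar\rho(y),\bar n(y))\,dy.$$ Residuals and error term: $$\bar R_1=\bar\rho_\tau-\tfrac y2\bar\rho_y+\bar n_y,\qquad\bar R_2=\bar n_\tau-\tfrac y2\bar n_y-\tfrac12\bar n+\Big(\frac{\bar n^2}{\bar\rho}\Big)_y+e^\tau\big(\mathfrak p(\bar\rho)_y+\alpha\bar n\big),\qquad\bar R=\frac{\bar n}{\bar\rho}\bar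 R_1-\bar R_2,$$ $\xi=\xi_1+\xi_2+\xi_3$ with $$\xi_1=-\Big(\frac{\bar n}{\bar\rho}\Big)_y\Big(e^{-\tau}\rho\Big|\frac n\rho-\frac{\bar n}{\bar\rho}\Big|^2+\mathfrak p(\rho|\bar\rho)\Big),\quad\xi_2=e^{-\tau}\bar R\,\frac\rho{\bar\rho}\Big(\frac n\rho-\frac{\bar n}{\bar\rho}\Big),\quad\xi_3=-(\rho-\bar\rho)h''(\bar\rho)\bar R_1,$$ and $\xi\equiv0$ if $(\bar\rho,\bar n)\equiv(0,0)$. *)

(* Defs.v *)
From HB Require Import structures.
From mathcomp Require Import all_boot all_order all_algebra.
From mathcomp Require Import all_classical all_reals all_analysis.

Set Implicit Arguments.
Unset Strict Implicit.
Unset Printing Implicit Defensive.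

Import Order.TTheory GRing.Theory Num.Theory.
Import numFieldNormedType.Exports.

Local Open Scope ring_scope.
Local Open Scope classical_set_scope.

(* Throughout, a point of [0, oo) x R is a pair x = (tau, y), and scalar fields
   are total functions R * R -> R whose values at tau < 0 are irrelevant.
   Functions of the density (pressure, potential) are total functions R -> R
   whose values on negative numbers are irrelevant.
   Since x / 0 = 0 in a field, the convention 0/0 := 0 holds automatically;
   what this does not give is n / 0 with n != 0, see [momentum_free_vacuum]. *)

Definition half_plane (R : realType) : set (R * R) := [set x | 0 <= x.1].

Definition open_half_plane (R : realType) : set (R * R) := [set x | 0 < x.1].

Definition leb (R : realType) : {measure set (measurableTypeR R) -> \bar R} :=
  lebesgue_measure.

Definition leb2 (R : realType) :
    {measure set (measurableTypeR R * measurableTypeR R) -> \bar R} :=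
  (@lebesgue_measure R \x @lebesgue_measure R)%E.

Definition d_tau (R : realType) (f : R * R -> R) : R * R -> R :=
  fun x => 'D_(1, 0) f x.

Definition d_y (R : realType) (f : R * R -> R) : R * R -> R :=
  fun x => 'D_(0, 1) f x.

(** Regularity *)

Definition C1_pos (R : realType) (f : R -> R) : Prop :=
  forall z : R, 0 < z -> derivable f z 1 /\ {for z, continuous (derive1 f)}.

Definition C2_pos (R : realType) (f : R -> R) : Prop :=
  C1_pos f /\ C1_pos (derive1 f).

Definition C1_open_half_plane (R : realType) (f : R * R -> R) : Prop :=
  forall x, open_half_plane x ->
    [/\ derivable f x (1, 0), derivable f x (0, 1),
        {for x, continuous (d_tau f)} & {for x, continuous (d_y f)}].

(* f' on [0, oo): the right derivative at 0. *)
Definition deriv_ge0 (R : realType) (f : R -> R) (z : R) : R :=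
  if 0 < z then derive1 f z else lim ((f e - f 0) / e @[e --> 0^'+]).

Definition compact_support (R : realType) (T : topologicalType)
    (f : T -> R) : Prop :=
  compact (closure [set x | f x != 0]).

(* All iterated directional derivatives exist and are differentiable. *)
Definition smooth2 (R : realType) (f : R * R -> R) : Prop :=
  forall (s : seq (R * R)) (x : R * R),
    differentiable (foldr (fun v g => 'D_v g) f s) x.

(* The spaces C_c^oo([0, oo) x R) and C_c^1([0, oo)) consist of the restrictions
   of C_c^oo(R x R) and C_c^1(R) functions; their elements are represented by
   such an extension, and sign conditions only concern the restriction. *)
Definition test_fun (R : realType) (f : R * R -> R) : Prop :=
  smooth2 f /\ compact_support f.

Definition C1_test_fun (R : realType) (f : R -> R) : Prop :=
  [/\ forall t, derivable f t 1, continuous (derive1 f) & compact_support f].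

(** Function spaces *)

(* L^1_loc([0, oo) x R) *)
Definition L1loc_half_plane (R : realType) (f : R * R -> R) : Prop :=
  measurable_fun (@half_plane R : set (measurableTypeR R * measurableTypeR R)) f
  /\ forall K : set (R * R), K `<=` @half_plane R -> compact K ->
       (\int[leb2 R]_(x in K) `|f x|%:E < +oo)%E.

(* L^oo_loc([0, oo); L^oo(R)) *)
Definition Linf_loc_Linf (R : realType) (f : R * R -> R) : Prop :=
  measurable_fun (@half_plane R : set (measurableTypeR R * measurableTypeR R)) f
  /\ forall T : R, exists M : R,
       {ae leb2 R, forall x, 0 <= x.1 <= T -> `|f x| <= M}.

(* L^1_loc([0, oo); L^1(R)); the null line tau = 0 is left out because [xi]
   contains derivatives which are only defined for tau > 0. *)
Definition L1_loc_L1 (R : realType) (f : R * R -> R) : Prop :=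
  forall T : R, (leb2 R).-integrable [set x | 0 < x.1 <= T] (EFin \o f).

(** Weak solutions *)

(* The quotients n / rho and n^2 / rho, with 0/0 := 0, only make sense (are
   finite) where n vanishes on {rho = 0}.  Since division by 0 yields 0 here,
   the finiteness of n^2 / rho almost everywhere has to be recorded. *)
Definition momentum_free_vacuum (R : realType) (d : measure_display)
    (T : measurableType d) (mu : {measure set T -> \bar R}) (D : set T)
    (rho n : T -> R) : Prop :=
  {ae mu, forall x, D x -> rho x = 0 -> n x = 0}.

Definition initial_data (R : realType) (rho0 n0 : R -> R) : Prop :=
  [/\ locally_integrable setT rho0,
      locally_integrable setT n0,
      {ae leb R, forall y, 0 <= rho0 y} &
      momentum_free_vacuum (leb R) setT rho0 n0].

Definition weak_mass_eq (R : realType) (rho n : R * R -> R) (rho0 : R -> R) :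
    Prop :=
  forall phi : R * R -> R, test_fun phi ->
    (- (\int[leb2 R]_(x in @open_half_plane R)
       (d_tau phi x * rho x + d_y phi x * (- (x.2 / 2) * rho x + n x)
        - 2^-1 * phi x * rho x)%:E)
     = \int[leb R]_y (phi (0, y) * rho0 y)%:E)%E.

Definition weak_momentum_eq (R : realType) (alpha : R) (p : R -> R)
    (rho n : R * R -> R) (n0 : R -> R) : Prop :=
  forall psi : R * R -> R, test_fun psi ->
    (- (\int[leb2 R]_(x in @open_half_plane R)
       (d_tau psi x * n x
        + d_y psi x * (- (x.2 / 2) * n x + n x ^+ 2 / rho x
                       + expR x.1 * p (rho x))
        - psi x * expR x.1 * alpha * n x)%:E)
     = \int[leb R]_y (psi (0, y) * n0 y)%:E)%E.

Definition weak_solution (R : realType) (alpha : R) (p : R -> R)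
    (rho n : R * R -> R) (rho0 n0 : R -> R) : Prop :=
  [/\ [/\ L1loc_half_plane rho,
          L1loc_half_plane n,
          L1loc_half_plane (fun x => n x ^+ 2 / rho x),
          momentum_free_vacuum (leb2 R) (@half_plane R) rho n &
          L1loc_half_plane (fun x => p (rho x))],
      {ae leb2 R, forall x, half_plane x -> 0 <= rho x},
      weak_mass_eq rho n rho0 &
      weak_momentum_eq alpha p rho n n0].

(** Entropy and relative entropy *)

Definition entropy (R : realType) (h : R -> R) (tau rho n : R) : R :=
  expR (- tau) * (n ^+ 2 / (2 * rho)) + h rho.

Definition entropy_flux (R : realType) (h : R -> R) (tau rho n : R) : R :=
  expR (- tau) * (n ^+ 3 / (2 * rho ^+ 2)) + n * deriv_ge0 h rho.

(* f(z | zbar) *)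
Definition relative (R : realType) (f : R -> R) (z zbar : R) : R :=
  f z - f zbar - deriv_ge0 f zbar * (z - zbar).

(* rho |n/rho - nbar/rhobar|^2 *)
Definition rel_kinetic (R : realType) (rho n rhobar nbar : R) : R :=
  rho * `|n / rho - nbar / rhobar| ^+ 2.

Definition rel_entropy (R : realType) (h : R -> R)
    (tau rho n rhobar nbar : R) : R :=
  2^-1 * expR (- tau) * rel_kinetic rho n rhobar nbar + relative h rho rhobar.

(* The functional E(tau; rho, n | rhobar, nbar), with values in [0, +oo]. *)
Definition total_rel_entropy (R : realType) (h : R -> R) (tau : R)
    (rho n rhobar nbar : R -> R) : \bar R :=
  (\int[leb R]_y (rel_entropy h tau (rho y) (n y) (rhobar y) (nbar y))%:E)%E.

Definition local_entropy_condition (R : realType) (alpha : R) (h : R -> R)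
    (rho n : R * R -> R) (rho0 n0 : R -> R) : Prop :=
  [/\ Linf_loc_Linf rho,
      Linf_loc_Linf (fun x => n x / rho x),
      L1loc_half_plane (fun x => h (rho x)) &
      forall chi : R * R -> R, test_fun chi ->
        (forall x, half_plane x -> 0 <= chi x) ->
        (\int[leb2 R]_(x in @open_half_plane R)
           (- d_tau chi x * entropy h x.1 (rho x) (n x)
            + d_y chi x * (x.2 / 2 * entropy h x.1 (rho x) (n x)
                           - entropy_flux h x.1 (rho x) (n x))
            + chi x * (2^-1 * entropy h x.1 (rho x) (n x)
                       + alpha * (n x ^+ 2 / rho x)))%:E
         <= \int[leb R]_y (chi (0, y) * entropy h 0%R (rho0 y) (n0 y))%:E)%E].

(** Residuals and error term *)

Definition res1 (R : realType) (rhobar nbar : R * R -> R) (x : R * R) : R :=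
  d_tau rhobar x - x.2 / 2 * d_y rhobar x + d_y nbar x.

Definition res2 (R : realType) (alpha : R) (p : R -> R)
    (rhobar nbar : R * R -> R) (x : R * R) : R :=
  d_tau nbar x - x.2 / 2 * d_y nbar x - 2^-1 * nbar x
  + d_y (fun z => nbar z ^+ 2 / rhobar z) x
  + expR x.1 * (d_y (fun z => p (rhobar z)) x + alpha * nbar x).

Definition res (R : realType) (alpha : R) (p : R -> R)
    (rhobar nbar : R * R -> R) (x : R * R) : R :=
  nbar x / rhobar x * res1 rhobar nbar x - res2 alpha p rhobar nbar x.

Definition xi1 (R : realType) (p : R -> R) (rho n rhobar nbar : R * R -> R)
    (x : R * R) : R :=
  - d_y (fun z => nbar z / rhobar z) x *
  (expR (- x.1) * rel_kinetic (rho x) (n x) (rhobar x) (nbar x)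
   + relative p (rho x) (rhobar x)).

Definition xi2 (R : realType) (alpha : R) (p : R -> R)
    (rho n rhobar nbar : R * R -> R) (x : R * R) : R :=
  expR (- x.1) * res alpha p rhobar nbar x * (rho x / rhobar x) *
  (n x / rho x - nbar x / rhobar x).

Definition xi3 (R : realType) (h : R -> R) (rho rhobar nbar : R * R -> R)
    (x : R * R) : R :=
  - (rho x - rhobar x) * derive1n 2 h (rhobar x) * res1 rhobar nbar x.

Definition zero_state (R : realType) (rhobar nbar : R * R -> R) : Prop :=
  forall x, half_plane x -> rhobar x = 0 /\ nbar x = 0.

Definition xi (R : realType) (alpha : R) (p h : R -> R)
    (rho n rhobar nbar : R * R -> R) (x : R * R) : R :=
  if `[< zero_state rhobar nbar >] then 0
  else xi1 p rho n rhobar nbar x + xi2 alpha p rho n rhobar nbar x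
       + xi3 h rho rhobar nbar x.

(** The two admissible classes of reference states *)

Definition regular_positive_state (R : realType)
    (rhobar nbar : R * R -> R) : Prop :=
  [/\ C1_open_half_plane rhobar /\ C1_open_half_plane nbar,
      {within @half_plane R, continuous rhobar} /\
      {within @half_plane R, continuous nbar},
      [bounded rhobar x | x in @half_plane R] /\
      [bounded nbar x | x in @half_plane R] &
      0 < inf [set rhobar x | x in @half_plane R]].

Definition vacuum_pressure_condition (R : realType) (p : R -> R) : Prop :=
  (exists2 c : R, 0 < c & forall z : R, 0 < z -> derive1 p z <= c * (p z / z)) /\
  (\int[leb R]_(z in `]0%R, 1%R]) (p z / z ^+ 2)%:E < +oo)%E.

(* Main.v *)
(* Subtracting from the entropy inequality the balances of mass and momentum, tested
   with the derivatives of the entropy at the reference state, gives a local inequality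
   for the relative entropy eta with source term xi.  In the regular case the multipliers
   are only C^1 for t > 0 and continuous up to t = 0.  The weak formulations are therefore
   first extended from smooth to C^1 test functions, which are approximated in C^1 by
   Bernstein polynomials cut off with smooth bumps; then the multipliers are switched off
   near t = 0, and the balances show that the boundary terms created in this way converge
   to the initial values.
   On bounded time intervals the relative entropy flux is at most C eta: in the regular
   case by strict convexity of h, in the vacuum case because p <= c h(.|0).  Hence a space
   cut-off whose level sets move inwards fast enough contributes with a favourable sign,
   and letting it exhaust the line gives first the integrability of eta and then the
   integrated inequality; Fubini's theorem turns it into the statement. *)
Require Import Defs.
From HB Require Import structures.
From mathcomp Require Import all_boot all_order all_algebra.
From mathcomp Require Import all_classical all_reals all_analysis.
From mathcomp Require Import measurable_realfun ring lra.

Import Order.TTheory GRing.Theory Num.Theory.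
Import numFieldNormedType.Exports.

Set Implicit Arguments.
Unset Strict Implicit.
Unset Printing Implicit Defensive.

Local Open Scope ring_scope.
Local Open Scope classical_set_scope.

(** * Directional derivatives and smooth functions *)

(** The multipliers are derivatives of the entropy at the reference state, and the derivatives of
    that state may be unbounded as t tends to 0. The terms produced by the product rule are
    therefore not known to be integrable one by one near t = 0. Only their sum is: up to sign and
    locally bounded terms it equals xi, which is integrable by assumption. Hence all balances are
    added while the cut-off in time is still present, and the cut-off is removed from the sum only.
    Multipliers enter equalities alone, where their sign is irrelevant; the entropy inequality is
    tested with nonnegative functions that do not involve the reference state. The Legendre
    transform of the entropy at the reference state is p(rhobar). It enters through the trivial
    balance laws of the constant 1 and turns the entropy minus its linear part into eta. The rate of
    the travelling cut-off is 1 + C: the 1 pays for the drift y/2 of the scaled variables, and C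
    bounds the ratio of flux to relative entropy. *)

Section DirectionalDerivatives.
Context {R : realType} {V : normedModType R}.
Implicit Types (f g : V -> R) (x v : V).

Lemma is_derive_mul f g x v df dg : is_derive x v f df -> is_derive x v g dg ->
  is_derive x v (fun z => f z * g z) (df * g x + f x * dg).
Proof.
move=> hf hg; have := is_deriveM hf hg.
by rewrite /GRing.scale/= addrC (mulrC (g x)).
Qed.

Lemma is_derive_add f g x v df dg : is_derive x v f df -> is_derive x v g dg ->
  is_derive x v (fun z => f z + g z) (df + dg).
Proof. exact: is_deriveD. Qed.

(** Restricting to the line through [x] brings in the one-variable chain rule, so that a directional
    derivative of [f] is enough and total differentiability is never asked for. *)
Lemma is_derive_line f x v d :
  is_derive x v f d <-> is_derive (0 : R) 1 (fun t : R => f (t *: v + x)) d.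
Proof.
have E : 'D_1 (fun t : R => f (t *: v + x)) 0 = 'D_v f x.
  rewrite /derive; set g1 := fun h => h^-1 *: _; set g2 := fun h => h^-1 *: _.
  suff -> : g1 = g2 by [].
  by rewrite funeqE /g1 /g2 => t /=; rewrite addr0 scale0r add0r [_%:A]mulr1.
split=> -[df <-]; split; rewrite ?E//.
  exact: (derivable1P f x v).1.
exact: (derivable1P f x v).2.
Qed.

Lemma is_derive_chain (g : R -> R) f x v (dg df : R) :
  is_derive (f x) 1 g dg -> is_derive x v f df ->
  is_derive x v (fun z => g (f z)) (dg * df).
Proof.
move=> hg /is_derive_line hf; apply/is_derive_line.
apply: (@is_derive1_comp _ g (fun t : R => f (t *: v + x))).
by rewrite scale0r add0r.
Qed.

Lemma near_eq_is_derive f g x v d :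
  (\forall z \near x, f z = g z) -> is_derive x v f d -> is_derive x v g d.
Proof.
by move=> fg [df <-]; split; [exact: near_eq_derivable df|exact/esym/near_eq_derive].
Qed.

End DirectionalDerivatives.

Section PlaneDerivatives.
Context {R : realType}.
Implicit Types (f : R * R -> R).

Lemma is_derive_section1 f (t y d : R) :
  is_derive (t, y) (1, 0) f d <-> is_derive t 1 (fun s => f (s, y)) d.
Proof.
have E : (fun s : R => f (s *: (1, 0) + (t, y))) =
         (fun s : R => (fun s => f (s, y)) (s *: 1 + t)).
  apply/funext => s /=; congr f.
  by apply: injective_projections => //=; rewrite [_ *: _]mulr0 add0r.
by split=> /is_derive_line H; apply/is_derive_line; move: H; rewrite E.
Qed.

Lemma is_derive_section2 f (t y d : R) :
  is_derive (t, y) (0, 1) f d <-> is_derive y 1 (fun z => f (t, z)) d.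
Proof.
have E : (fun s : R => f (s *: (0, 1) + (t, y))) =
         (fun s : R => (fun z => f (t, z)) (s *: 1 + y)).
  apply/funext => s /=; congr f.
  by apply: injective_projections => //=; rewrite [_ *: _]mulr0 add0r.
by split=> /is_derive_line H; apply/is_derive_line; move: H; rewrite E.
Qed.

Lemma is_derive_fst (x v : R * R) : is_derive x v fst v.1.
Proof.
have H : is_diff x (fst : R * R -> R) fst.
  have c : continuous (fst : R * R -> R) by move=> z; exact: cvg_fst.
  apply: DiffDef; first exact: (@linear_differentiable _ _ _ fst).
  exact: (@diff_lin _ _ _ fst).
split; first exact: diff_derivable.
by rewrite deriveE// diff_val.
Qed.

Lemma is_derive_snd (x v : R * R) : is_derive x v snd v.2.
Proof.
have H : is_diff x (snd : R * R -> R) snd.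
  have c : continuous (snd : R * R -> R) by move=> z; exact: cvg_snd.
  apply: DiffDef; first exact: (@linear_differentiable _ _ _ snd).
  exact: (@diff_lin _ _ _ snd).
split; first exact: diff_derivable.
by rewrite deriveE// diff_val.
Qed.

End PlaneDerivatives.

(** * Flat functions built from exp(-1/x) *)

Section FlatFunctions.
Context {R : realType}.

(* The derivatives of exp(-1/x) on x > 0 are combinations of these. *)
Definition flat (k : nat) (x : R) : R :=
  if 0 < x then x^-1 ^+ k * expR (- x^-1) else 0.

Lemma flat_ge0 k x : 0 <= flat k x.
Proof.
rewrite /flat; case: ifPn => // x0.
by rewrite mulr_ge0 ?expR_ge0// exprn_ge0// invr_ge0 ltW.
Qed.

Lemma flat_gt0 k x : 0 < x -> 0 < flat k x.
Proof. by move=> x0; rewrite /flat x0 mulr_gt0 ?expR_gt0// exprn_gt0// invr_gt0. Qed.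

Lemma flat_eq0 k x : x <= 0 -> flat k x = 0.
Proof. by move=> x0; rewrite /flat ltNge x0. Qed.

(** The exponential of 1/x is at least its Taylor term of order k + 2. The spare factor x^2 makes
    every [flat k] differentiable at 0. *)
Lemma flat_le_sqr k x : flat k x <= k.+2`!%:R * x ^+ 2.
Proof.
rewrite /flat; case: ifPn => [x0|_]; last by rewrite mulr_ge0// sqr_ge0.
have xV : 0 < x^-1 by rewrite invr_gt0.
rewrite expRN ler_pdivrMr ?expR_gt0//.
have H : x^-1 ^+ k.+2 / k.+2`!%:R <= expR x^-1.
  by apply: le_trans (expR_ge1Dxn k.+1 (ltW xV)); rewrite lerDr.
apply: (@le_trans _ _ (k.+2`!%:R * x ^+ 2 * (x^-1 ^+ k.+2 / k.+2`!%:R))).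
  rewrite le_eqVlt; apply/orP; left; apply/eqP.
  rewrite !exprS; field.
  by rewrite (gt_eqF x0) pnatr_eq0 -lt0n fact_gt0.
by rewrite ler_wpM2l// mulr_ge0// sqr_ge0.
Qed.

(** The difference quotient at 0 is at most c |h|. This criterion settles the only critical point of
    [flat] and of [ramp2]. *)
Lemma is_derive0_le_sqr (f : R -> R) (c : R) :
  (forall x, `|f x| <= c * x ^+ 2) -> is_derive (0 : R) 1 f 0.
Proof.
move=> fc; have f0 : f 0 = 0.
  by apply/eqP; rewrite -normr_eq0 eq_le normr_ge0 (le_trans (fc 0))// expr0n/= mulr0.
have c0 : 0 <= c by have := fc 1; rewrite expr1n mulr1; apply: le_trans.
have L : h^-1 *: ((f \o shift 0) (h *: (1 : R)) - f 0) @[h --> 0^'] --> (0 : R).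
  apply/cvgrPdist_le => e e0; near=> h.
  rewrite sub0r normrN /= f0 subr0 addr0 [h *: _]mulr1 /GRing.scale/=.
  have h0 : h != 0 by near: h; exact: nbhs_dnbhs_neq.
  rewrite normrM normfV ler_pdivrMl ?normr_gt0//.
  rewrite (le_trans (fc h))// -[h ^+ 2]real_normK ?num_real// expr2 mulrA mulrC.
  rewrite ler_wpM2l//.
  (* Adding 1 to [c] covers the case c = 0 as well. *)
  have : `|h| <= e / (c + 1).
    near: h; apply: dnbhs0_le; rewrite divr_gt0// ltr_wpDl//.
  rewrite ler_pdivlMr ?ltr_wpDl// => H.
  by apply: le_trans H; rewrite mulrC ler_wpM2l// lerDl.
split; first by apply/cvg_ex; exists 0.
by apply/cvg_lim.
Unshelve. all: by end_near. Qed.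

(** Differentiation stays within the span of the family, across x = 0 as well; this is why the index
    [k] is carried along. *)
Lemma is_derive_flat k (x : R) :
  is_derive x 1 (flat k) (flat k.+2 x - k%:R * flat k.+1 x).
Proof.
have [x0|x0|->] := ltgtP x 0.
- rewrite !flat_eq0 ?ltW// mulr0 subr0.
  apply: (@near_eq_is_derive _ _ (cst 0)).
  near=> z; rewrite flat_eq0//; apply/ltW; near: z; exact: lt_nbhsl.
- have D : is_derive x 1 (fun z : R => z^-1) (- x ^- 2).
    by have := @is_deriveV _ id x 1 1 (lt0r_neq0 x0) _; rewrite [_ *: _]mulr1; apply.
  have D1 : is_derive x 1 (fun z : R => z^-1 ^+ k) ((k%:R * x^-1 ^+ k.-1) * (- x ^- 2)).
    have -> : (fun z : R => z^-1 ^+ k) = (fun z : R => z^-1) ^+ k.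
      by apply/funext => z; rewrite exprfctE.
    exact: is_deriveX.
  have D2 : is_derive x 1 (fun z : R => expR (- z^-1)) (expR (- x^-1) * (x ^- 2)).
    have DN : is_derive x 1 (fun z : R => - z^-1) (x ^- 2).
      by rewrite -[x ^- 2]opprK; exact: (is_deriveN D).
    exact: (@is_derive_chain _ _ _ (fun z : R => - z^-1) _ _ _ _ (is_derive_expR _) DN).
  have D3 := is_derive_mul D1 D2.
  have E : \forall z \near x, z^-1 ^+ k * expR (- z^-1) = flat k z.
    by near=> z; rewrite /flat ifT//; near: z; exact: lt_nbhsr.
  apply: is_derive_eq (near_eq_is_derive E D3) _.
  rewrite /flat x0 -!exprVn; case: (k) => [|m] /=; first by ring.
  by rewrite !exprS; ring.
- rewrite !flat_eq0// mulr0 subr0.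
  apply: (@is_derive0_le_sqr _ k.+2`!%:R) => x'.
  by rewrite ger0_norm ?flat_ge0// flat_le_sqr.
Unshelve. all: by end_near. Qed.

End FlatFunctions.

(** * An algebra of smooth functions closed under differentiation *)

Section SmoothAlgebra.
Context {R : realType}.

(** Every directional derivative of such a function is built by the same rules, so an induction
    yields all iterated derivatives without computing them. All indices [k] occur, since
    differentiating [flat k] raises the index. *)
Inductive smooth_alg : (R * R -> R) -> Prop :=
| smooth_cst c : smooth_alg (cst c)
| smooth_fst : smooth_alg fst
| smooth_snd : smooth_alg snd
| smooth_add f g : smooth_alg f -> smooth_alg g -> smooth_alg (f + g)
| smooth_mul f g : smooth_alg f -> smooth_alg g -> smooth_alg (f * g)
| smooth_flat k f : smooth_alg f -> smooth_alg (flat k \o f).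

Lemma smooth_alg_diff f : smooth_alg f ->
  (forall x, differentiable f x) /\ (forall v, smooth_alg ('D_v f)).
Proof.
elim=> {f} [c|||f g _ [df Df] _ [dg Dg]|f g sf [df Df] sg [dg Dg]|k f sf [df Df]].
- split=> [x|v]; first exact: differentiable_cst.
  rewrite (_ : 'D_v _ = cst 0); first exact: smooth_cst.
  by apply/funext => x; rewrite derive_cst.
- split=> [x|v].
    apply: (@linear_differentiable _ _ _ fst); move=> z; exact: cvg_fst.
  rewrite (_ : 'D_v _ = cst v.1); first exact: smooth_cst.
  by apply/funext => x; rewrite (@derive_val _ _ _ _ _ _ _ (is_derive_fst x v)).
- split=> [x|v].
    apply: (@linear_differentiable _ _ _ snd); move=> z; exact: cvg_snd.
  rewrite (_ : 'D_v _ = cst v.2); first exact: smooth_cst.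
  by apply/funext => x; rewrite (@derive_val _ _ _ _ _ _ _ (is_derive_snd x v)).
- split=> [x|v]; first exact: differentiableD.
  rewrite (_ : 'D_v _ = 'D_v f + 'D_v g); first exact: smooth_add.
  by apply/funext => x; rewrite deriveD//; exact: diff_derivable.
- split=> [x|v]; first exact: differentiableM.
  rewrite (_ : 'D_v _ = f * 'D_v g + g * 'D_v f).
    by apply: smooth_add; apply: smooth_mul.
  by apply/funext => x; rewrite deriveM//; exact: diff_derivable.
- split=> [x|v].
    apply: differentiable_comp => //; apply/derivable1_diffP.
    exact: (@ex_derive _ _ _ _ _ _ _ (is_derive_flat k (f x))).
  rewrite (_ : 'D_v _ =
    ((flat k.+2 \o f) + cst (- k%:R) * (flat k.+1 \o f)) * 'D_v f).
    apply: smooth_mul => //; apply: smooth_add; first exact: smooth_flat.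
    by apply: smooth_mul; [exact: smooth_cst|exact: smooth_flat].
  apply/funext => x.
  have := @is_derive_chain _ _ (flat k) f x v _ _ (is_derive_flat k (f x))
    (derivableP (@diff_derivable _ _ _ _ _ v (df x))).
  move=> H; rewrite (@derive_val _ _ _ _ _ _ _ H).
  by rewrite [RHS]/GRing.mul/= /GRing.add/= /GRing.mul/= mulNr.
Qed.

Lemma smooth_alg_smooth2 f : smooth_alg f -> smooth2 f.
Proof.
move=> sf s x; apply: (smooth_alg_diff _).1.
elim: s => [//|v s IH] /=; exact: (smooth_alg_diff IH).2.
Qed.

End SmoothAlgebra.

(** * Bernstein polynomials *)

Section Bernstein.
Context {R : realType}.
Implicit Types (g : nat -> R) (x : R).

(* The Bernstein polynomial sum_j binom(N, j) x^j (1 - x)^(N - j) g(j), by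
   conditioning on the first of N Bernoulli trials. *)
Fixpoint bern (N : nat) g x : R :=
  if N is N'.+1 then (1 - x) * bern N' g x + x * bern N' (fun j => g j.+1) x
  else g 0%N.

Lemma bernD N g g' x : bern N (fun j => g j + g' j) x = bern N g x + bern N g' x.
Proof. by elim: N g g' => //= N IH g g'; rewrite !IH; ring. Qed.

Lemma bernZ N c g x : bern N (fun j => c * g j) x = c * bern N g x.
Proof. by elim: N g => //= N IH g; rewrite !IH; ring. Qed.

Lemma bern_cst N c x : bern N (fun=> c) x = c.
Proof. by elim: N => //= N ->; ring. Qed.

Lemma bernN N g x : bern N (fun j => - g j) x = - bern N g x.
Proof.
rewrite -[RHS]mulN1r -bernZ; congr bern; apply/funext => j; by rewrite mulN1r.
Qed.

Lemma bernB N g g' x : bern N (fun j => g j - g' j) x = bern N g x - bern N g' x.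
Proof. by rewrite bernD bernN. Qed.

Lemma bern_le N g g' x : 0 <= x <= 1 ->
  (forall j, (j <= N)%N -> g j <= g' j) -> bern N g x <= bern N g' x.
Proof.
move=> /andP[x0 x1]; elim: N g g' => [|N IH] g g' gg' /=; first exact: gg'.
apply: lerD; apply: ler_wpM2l; rewrite ?subr_ge0//; apply: IH => j jN; apply: gg' => //.
exact: leqW.
Qed.

(** [bern] is linear, monotone and fixes constants. The bound [b] may vary with the node, which the
    Chebyshev argument in [bern2_cvg] exploits. *)
Lemma bern_abs_le N g c (b : nat -> R) x : 0 <= x <= 1 ->
  (forall j, (j <= N)%N -> `|g j - c| <= b j) -> `|bern N g x - c| <= bern N b x.
Proof.
move=> x01 gb; rewrite -{1}(bern_cst N c x) -bernB ler_norml -bernN.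
by apply/andP; split; apply: bern_le => // j /gb; rewrite ler_norml => /andP[].
Qed.

(** Second moment of a binomial variable about an arbitrary point [a]: variance plus squared bias.
    The point is left free because conditioning on a success shifts it by 1. *)
Lemma bern_sqr N a x :
  bern N (fun j => (j%:R - a) ^+ 2) x = N%:R * (x * (1 - x)) + (N%:R * x - a) ^+ 2.
Proof.
elim: N a => [|N IH] a /=; first by ring.
rewrite IH (_ : (fun j => _) = fun j : nat => (j%:R - (a - 1)) ^+ 2); last first.
  by apply/funext => j; congr (_ ^+ 2); rewrite -[j.+1]addn1 natrD; ring.
by rewrite IH -[N.+1]addn1 natrD; ring.
Qed.

Lemma bern_var N x : (0 < N)%N -> 0 <= x <= 1 ->
  bern N (fun j => (j%:R / N%:R - x) ^+ 2) x <= N%:R^-1.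
Proof.
move=> N0 /andP[x0 x1]; have N0' : N%:R != 0 :> R by rewrite pnatr_eq0 -lt0n.
rewrite (_ : (fun j => _) = fun j : nat => (N%:R^-1) ^+ 2 * (j%:R - N%:R * x) ^+ 2).
  rewrite bernZ bern_sqr subrr expr0n/= addr0.
  rewrite (_ : _ * _ = N%:R^-1 * (x * (1 - x))); last by field.
  rewrite -[leRHS]mulr1 ler_wpM2l ?invr_ge0//.
  by rewrite mulr_ile1// ?subr_ge0// gerBl.
by apply/funext => j; field.
Qed.

(** The derivative is again a Bernstein polynomial, one degree lower, of the forward differences.
    Hence its convergence can be proved like that of the polynomial itself. *)
Lemma is_derive_bern N g x :
  is_derive x 1 (bern N.+1 g) (N.+1%:R * bern N (fun j => g j.+1 - g j) x).
Proof.
elim: N g => [|N IH] g.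
  have -> : bern 1 g = (fun z => g 0%N + (g 1%N - g 0%N) * z).
    by apply/funext => z /=; ring.
  apply: is_derive_eq (is_derive_add (is_derive_cst _ _ _)
    (is_derive_mul (is_derive_cst _ _ _) (is_derive_id _ _))) _.
  by rewrite mul0r !add0r mulr1 mul1r.
have -> : bern N.+2 g = (fun z => (1 - z) * bern N.+1 g z +
    z * bern N.+1 (fun j => g j.+1) z) by [].
have D1 : is_derive x 1 (fun z : R => 1 - z) (- 1).
  exact: (is_derive_eq (@is_derive_add _ R (cst 1) -%R x 1 _ _
    (is_derive_cst _ _ _) (is_deriveNid _ _)) (add0r _)).
have D := is_derive_add (is_derive_mul D1 (IH g))
  (is_derive_mul (is_derive_id x 1) (IH (fun j => g j.+1))).
apply: is_derive_eq D _.
rewrite [in RHS]/= !bernB -[N.+2]addn1 -[N.+1]addn1 !natrD addn1.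
by rewrite [bern N.+1 _ _]/= [bern N.+1 (fun j => g j.+1) _]/= /=; ring.
Qed.

Lemma is_derive_bern_coef (V : normedModType R) N (G : nat -> V -> R) dG x (z v : V) :
  (forall j, is_derive z v (G j) (dG j)) ->
  is_derive z v (fun z => bern N (G ^~ z) x) (bern N dG x).
Proof.
elim: N G dG => [|N IH] G dG HG /=; first exact: HG.
apply: is_derive_eq (is_derive_add
  (is_derive_mul (is_derive_cst _ _ _) (IH _ _ HG))
  (is_derive_mul (is_derive_cst _ _ _) (IH _ _ (fun j => HG j.+1)))) _.
by rewrite !mul0r !add0r.
Qed.

Lemma smooth_alg_bern N (G : nat -> R * R -> R) (X : R * R -> R) :
  smooth_alg X -> (forall j, smooth_alg (G j)) ->
  smooth_alg (fun z => bern N (G ^~ z) (X z)).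
Proof.
move=> sX; elim: N G => [|N IH] G sG /=; first exact: sG.
apply: smooth_add; apply: smooth_mul => //; try exact: IH.
rewrite (_ : (fun _ => _) = cst 1 + cst (- 1) * X).
  by apply: smooth_add; [exact: smooth_cst|apply: smooth_mul => //; exact: smooth_cst].
by apply/funext => z; rewrite [RHS]/GRing.add/= /GRing.mul/= mulN1r.
Qed.

(** Chebyshev's argument in two variables. The array [w] may depend on [N] and the degrees are free,
    so that one lemma serves the approximated function and also the difference quotients that
    approximate its derivatives, where one degree is smaller by 1. *)
Lemma bern2_cvg (w : nat -> nat -> nat -> R) (m1 m2 : nat -> nat) M c s r :
  0 <= s <= 1 -> 0 <= r <= 1 ->
  (forall N, (N <= m1 N)%N) -> (forall N, (N <= m2 N)%N) ->
  (forall N j k, (j <= m1 N)%N -> (k <= m2 N)%N -> `|w N j k - c| <= M) ->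
  (forall e : R, 0 < e -> exists2 d : R, 0 < d & \forall N \near \oo,
     forall j k, (j <= m1 N)%N -> (k <= m2 N)%N ->
     `|j%:R / (m1 N)%:R - s| < d -> `|k%:R / (m2 N)%:R - r| < d ->
     `|w N j k - c| <= e) ->
  bern (m1 N) (fun j => bern (m2 N) (w N j) r) s @[N --> \oo] --> c.
Proof.
move=> s01 r01 m1N m2N wM we; apply/cvgrPdist_le => e e0.
have e20 : 0 < e / 2 by rewrite divr_gt0.
have [d d0 near_we] := we _ e20.
have M0 : 0 <= M by apply: le_trans (wM 0%N 0%N 0%N _ _).
(* With this [A], the error at a node at distance at least [d] is paid for by [A] times the squared
   distance. *)
pose A := M / d ^+ 2.
have A0 : 0 <= A by rewrite divr_ge0// sqr_ge0.
near=> N.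
have N0 : (0 < N)%N by near: N; exact: nbhs_infty_gt.
have wA j k : (j <= m1 N)%N -> (k <= m2 N)%N -> `|w N j k - c| <=
    e / 2 + A * (j%:R / (m1 N)%:R - s) ^+ 2 + A * (k%:R / (m2 N)%:R - r) ^+ 2.
  move=> jN kN.
  have far (z : R) : d <= `|z| -> M <= A * z ^+ 2.
    move=> dz; rewrite /A -mulrA -[leLHS]mulr1 ler_wpM2l// mulrC ler_pdivlMr ?exprn_gt0//.
    by rewrite mul1r -(real_normK (num_real z)) lerXn2r ?nnegrE// ltW.
  have [jd|/far jd] := ltP `|j%:R / (m1 N)%:R - s| d; last first.
    apply: le_trans (wM _ _ _ jN kN) _; apply: le_trans jd _.
    by rewrite -addrA addrCA lerDl addr_ge0 ?(ltW e20)// mulr_ge0// sqr_ge0.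
  have [kd|/far kd] := ltP `|k%:R / (m2 N)%:R - r| d; last first.
    apply: le_trans (wM _ _ _ jN kN) _; apply: le_trans kd _.
    by rewrite lerDr addr_ge0 ?(ltW e20)// mulr_ge0// sqr_ge0.
  apply: le_trans (_ : e / 2 <= _); last first.
    by rewrite -addrA lerDl addr_ge0// mulr_ge0// sqr_ge0.
  by move: j k jN kN jd kd; near: N.
rewrite distrC.
apply: le_trans (bern_abs_le s01 (fun j jN => bern_abs_le r01 (fun k => wA j k jN))) _.
have -> : (fun j : nat => bern (m2 N) (fun k : nat => e / 2 +
     A * (j%:R / (m1 N)%:R - s) ^+ 2 + A * (k%:R / (m2 N)%:R - r) ^+ 2) r) =
   (fun j : nat => (e / 2 + A * bern (m2 N) (fun k => (k%:R / (m2 N)%:R - r) ^+ 2) r) +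
     A * (j%:R / (m1 N)%:R - s) ^+ 2).
  by apply/funext => j; rewrite bernD bern_cst bernZ; ring.
rewrite bernD bern_cst bernZ.
have B i : (N <= i)%N -> (i%:R)^-1 <= (N%:R)^-1 :> R.
  by move=> Ni; rewrite lef_pV2 ?ler_nat// posrE ltr0n//; exact: leq_trans N0 Ni.
have B1 := le_trans (bern_var (leq_trans N0 (m1N N)) s01) (B _ (m1N N)).
have B2 := le_trans (bern_var (leq_trans N0 (m2N N)) r01) (B _ (m2N N)).
(* Each of the two variances then costs at most e / 4, besides the e / 2 from the near nodes. *)
have B3 : A * N%:R^-1 <= e / 4.
  rewrite ler_pdivrMr ?ltr0n// -ler_pdivrMl ?divr_gt0//.
  by near: N; exact: nbhs_infty_ger.
have := ler_wpM2l A0 B1; have := ler_wpM2l A0 B2; lra.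
Unshelve. all: by end_near. Qed.

End Bernstein.

(** * Functions of class C^1 on the plane *)

Section C1At.
Context {R : realType}.
Implicit Types (f g : R * R -> R) (x : R * R).

(** The partial derivatives are arguments, so that formulas for them can be composed and compared.
    Continuity of [f] is listed because partial derivatives at the single point [x] do not give
    it. *)
Definition C1_at f f1 f2 x : Prop :=
  [/\ is_derive x (1, 0) f (f1 x), is_derive x (0, 1) f (f2 x),
      {for x, continuous f}, {for x, continuous f1} & {for x, continuous f2}].

Lemma C1_at_cst c x : C1_at (fun=> c) (fun=> 0) (fun=> 0) x.
Proof.
split; try exact: is_derive_cst; by apply: cvg_cst.
Qed.

Lemma C1_at_fst x : C1_at fst (fun=> 1) (fun=> 0) x.
Proof.
split; [exact: is_derive_fst|exact: is_derive_fst| |exact: cvg_cst|exact: cvg_cst].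
exact: cvg_fst.
Qed.

Lemma C1_at_snd x : C1_at snd (fun=> 0) (fun=> 1) x.
Proof.
split; [exact: is_derive_snd|exact: is_derive_snd| |exact: cvg_cst|exact: cvg_cst].
exact: cvg_snd.
Qed.

Lemma C1_at_add f f1 f2 g g1 g2 x : C1_at f f1 f2 x -> C1_at g g1 g2 x ->
  C1_at (fun z => f z + g z) (fun z => f1 z + g1 z) (fun z => f2 z + g2 z) x.
Proof.
move=> [F1 F2 F F3 F4] [G1 G2 G G3 G4]; split.
- exact: is_derive_add.
- exact: is_derive_add.
- exact: cvgD.
- exact: cvgD.
- exact: cvgD.
Qed.

Lemma C1_at_mul f f1 f2 g g1 g2 x : C1_at f f1 f2 x -> C1_at g g1 g2 x ->
  C1_at (fun z => f z * g z) (fun z => f1 z * g z + f z * g1 z)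
    (fun z => f2 z * g z + f z * g2 z) x.
Proof.
move=> [F1 F2 F F3 F4] [G1 G2 G G3 G4]; split.
- exact: is_derive_mul.
- exact: is_derive_mul.
- exact: cvgM.
- by apply: cvgD; exact: cvgM.
- by apply: cvgD; exact: cvgM.
Qed.

Lemma C1_at_comp (k dk : R -> R) f f1 f2 x : C1_at f f1 f2 x ->
  is_derive (f x) 1 k (dk (f x)) -> {for f x, continuous dk} ->
  C1_at (fun z => k (f z)) (fun z => dk (f z) * f1 z) (fun z => dk (f z) * f2 z) x.
Proof.
move=> [F1 F2 F F3 F4] K K'; split.
- exact: is_derive_chain.
- exact: is_derive_chain.
- apply: (@continuous_comp _ _ _ f k) => //.
  by apply: differentiable_continuous; apply/derivable1_diffP; case: K.
- apply: cvgM => //; exact: (@continuous_comp _ _ _ f dk).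
- apply: cvgM => //; exact: (@continuous_comp _ _ _ f dk).
Qed.

(** Function and derivatives may be exchanged together near [x]. This handles the edges of supports,
    where no single formula applies. *)
Lemma near_eq_C1_at f f1 f2 g g1 g2 x :
  (\forall z \near x, [/\ f z = g z, f1 z = g1 z & f2 z = g2 z]) ->
  C1_at f f1 f2 x -> C1_at g g1 g2 x.
Proof.
move=> E [F1 F2 F F3 F4].
have E0 : \forall z \near x, f z = g z by apply: filterS E => z [].
have E1 : \forall z \near x, f1 z = g1 z by apply: filterS E => z [].
have E2 : \forall z \near x, f2 z = g2 z by apply: filterS E => z [].
have C (k l : R * R -> R) : (\forall z \near x, k z = l z) ->
    {for x, continuous k} -> {for x, continuous l}.
  move=> kl; rewrite /prop_for /continuous_at (nbhs_singleton kl).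
  exact: (cvg_trans (near_eq_cvg kl)).
split; last 3 first.
- exact: C E0 F.
- exact: C E1 F3.
- exact: C E2 F4.
- by rewrite -(nbhs_singleton E1); exact: near_eq_is_derive F1.
- by rewrite -(nbhs_singleton E2); exact: near_eq_is_derive F2.
Qed.

Lemma continuous_at_compact_bounded (K : set (R * R)) f : compact K ->
  (forall x, K x -> {for x, continuous f}) ->
  exists2 M : R, 0 <= M & forall x, K x -> `|f x| <= M.
Proof.
move=> cK fK; have [M [_ HM]] : bounded_set (f @` K).
  apply: compact_bounded; apply: continuous_compact => //.
  by apply: continuous_in_subspaceT => x; rewrite inE; exact: fK.
exists (Num.max 0 (M + 1)); first by rewrite le_max lexx.
move=> x Kx; apply: (HM (Num.max 0 (M + 1))); last by exists x.
by rewrite lt_max ltrDl ltr01 orbT.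
Qed.

Lemma mean_value (f df : R -> R) (a b : R) : a < b ->
  (forall x : R, a <= x <= b -> is_derive x 1 f (df x)) ->
  exists2 c : R, a < c < b & f b - f a = df c * (b - a).
Proof.
move=> ab D; have [||c cab E] := @MVT _ f df a b ab.
- by move=> x; rewrite in_itv/= => /andP[/ltW ax /ltW xb]; apply: D; rewrite ax xb.
- apply: derivable_within_continuous => x; rewrite in_itv/= => /D H.
  exact: ex_derive.
- by exists c => //; move: cab; rewrite in_itv.
Qed.

Lemma continuous_section2 (f : R * R -> R) (t y : R) :
  {for (t, y), continuous f} -> {for y, continuous (fun z => f (t, z))}.
Proof.
move=> cf; apply: (@continuous_comp _ _ _ (fun y : R => (t, y)) f) => //.
have := @cvg_pair R R R (nbhs y) (nbhs t) (nbhs y) _ _ _ (cst t) id (cvg_cst t) cvg_id.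
exact.
Qed.
Lemma continuous_section1 (f : R * R -> R) (t y : R) :
  {for (t, y), continuous f} -> {for t, continuous (fun z => f (z, y))}.
Proof.
move=> cf; apply: (@continuous_comp _ _ _ (fun t : R => (t, y)) f) => //.
have := @cvg_pair R R R (nbhs t) (nbhs t) (nbhs y) _ _ _ id (cst y) cvg_id (cvg_cst y).
exact.
Qed.

End C1At.

(** * Bernstein approximation in C^1 on a box *)

Section BernsteinApproximation.
Context {R : realType}.
Variables (T Y : R) (g g1 g2 : R * R -> R).
Hypotheses (T0 : 0 < T) (Y0 : 0 < Y).

Definition box : set (R * R) := `[0, T]%classic `*` `[- Y, Y]%classic.

Lemma boxP x : box x <-> 0 <= x.1 <= T /\ - Y <= x.2 <= Y.
Proof. by rewrite /box /setX /= !in_itv. Qed.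

Lemma box_compact : compact box.
Proof. by apply: compact_setX; exact: segment_compact. Qed.

Hypothesis gC1 : forall x, box x -> C1_at g g1 g2 x.

Definition node1 N j : R := T * (j%:R / N.+1%:R).
Definition node2 N k : R := - Y + 2 * Y * (k%:R / N.+1%:R).

(** The degree is N + 1 in both variables, so that a derivative has degree N in one of them, for
    every N. *)
Definition bernstein N (x : R * R) : R :=
  bern N.+1 (fun j => bern N.+1 (fun k => g (node1 N j, node2 N k))
    ((x.2 + Y) / (2 * Y))) (x.1 / T).

Definition bernstein1 N (x : R * R) : R :=
  bern N (fun j => bern N.+1 (fun k =>
    N.+1%:R / T * (g (node1 N j.+1, node2 N k) - g (node1 N j, node2 N k)))
    ((x.2 + Y) / (2 * Y))) (x.1 / T).

Definition bernstein2 N (x : R * R) : R :=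
  bern N.+1 (fun j => bern N (fun k =>
    N.+1%:R / (2 * Y) * (g (node1 N j, node2 N k.+1) - g (node1 N j, node2 N k)))
    ((x.2 + Y) / (2 * Y))) (x.1 / T).

Lemma is_derive_bernstein1 N (x : R * R) : is_derive x (1, 0) (bernstein N) (bernstein1 N x).
Proof.
case: x => t y; apply/is_derive_section1.
have D : is_derive t 1 (fun s : R => s / T) T^-1.
  by apply: is_derive_eq (is_derive_mul (is_derive_id t 1) (is_derive_cst T^-1 t 1)) _;
    rewrite mulr0 mul1r addr0.
pose G j := bern N.+1 (fun k => g (node1 N j, node2 N k)) ((y + Y) / (2 * Y)).
have H := @is_derive_chain _ _ _ (fun s : R => s / T) _ _ _ _
  (is_derive_bern N G (t / T)) D.
apply: is_derive_eq H _.
rewrite /bernstein1 /= mulrAC -bernZ; congr bern; apply/funext => j.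
by rewrite -bernB -bernZ.
Qed.

Lemma is_derive_bernstein2 N (x : R * R) : is_derive x (0, 1) (bernstein N) (bernstein2 N x).
Proof.
case: x => t y; apply/is_derive_section2.
have D : is_derive y 1 (fun z : R => (z + Y) / (2 * Y)) (2 * Y)^-1.
  apply: is_derive_eq (is_derive_mul (is_derive_add (is_derive_id y 1)
    (is_derive_cst Y y 1)) (is_derive_cst (2 * Y)^-1 y 1)) _.
  by rewrite mulr0 !addr0 mul1r.
apply: (@is_derive_bern_coef _ R N.+1 (fun j z => bern N.+1
  (fun k => g (node1 N j, node2 N k)) ((z + Y) / (2 * Y))) _ (t / T) y 1) => j.
have H := @is_derive_chain _ _ _ (fun z : R => (z + Y) / (2 * Y)) _ _ _ _
  (is_derive_bern N (fun k => g (node1 N j, node2 N k)) ((y + Y) / (2 * Y))) D.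
apply: is_derive_eq H _.
by rewrite /= mulrAC -bernZ.
Qed.

Lemma smooth_alg_bernstein N : smooth_alg (bernstein N).
Proof.
have S2 : smooth_alg (fun x : R * R => (x.2 + Y) / (2 * Y)).
  apply: (@smooth_mul _ (snd + cst Y) (cst (2 * Y)^-1)); last exact: smooth_cst.
  by apply: smooth_add; [exact: smooth_snd|exact: smooth_cst].
apply: (@smooth_alg_bern _ N.+1 (fun j x => bern N.+1 (fun k => g (node1 N j, node2 N k))
    ((x.2 + Y) / (2 * Y))) (fun x => x.1 / T)).
  by apply: (@smooth_mul _ fst (cst T^-1)); [exact: smooth_fst|exact: smooth_cst].
move=> j.
apply: (@smooth_alg_bern _ N.+1 (fun k _ => g (node1 N j, node2 N k)) _) => // k.
exact: smooth_cst.
Qed.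

Let frac_le1 (j N : nat) : (j <= N)%N -> 0 <= (j%:R / N%:R : R) <= 1.
Proof.
move=> jN; rewrite divr_ge0//=; case: N jN => [|N] jN; first by rewrite invr0 mulr0.
by rewrite ler_pdivrMr ?ltr0n// mul1r ler_nat.
Qed.

Lemma node1_itv N j : (j <= N.+1)%N -> 0 <= node1 N j <= T.
Proof.
move=> /frac_le1 /andP[a b]; rewrite /node1 mulr_ge0 ?(ltW T0)//=.
by rewrite -[leRHS]mulr1 ler_wpM2l ?(ltW T0).
Qed.

Lemma node2_itv N k : (k <= N.+1)%N -> - Y <= node2 N k <= Y.
Proof.
move=> /frac_le1 /andP[a b]; rewrite /node2 lerDl mulr_ge0 ?mulr_ge0 ?(ltW Y0)//=.
have : 2 * Y * (k%:R / N.+1%:R) <= 2 * Y * 1 by rewrite ler_wpM2l// mulr_ge0// ltW.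
by rewrite mulr1; set z := 2 * Y * _ => H; lra.
Qed.

Lemma node_box N j k : (j <= N.+1)%N -> (k <= N.+1)%N -> box (node1 N j, node2 N k).
Proof. by move=> jN kN; apply/boxP; rewrite node1_itv// node2_itv. Qed.

Lemma box_ratio x : box x -> 0 <= x.1 / T <= 1 /\ 0 <= (x.2 + Y) / (2 * Y) <= 1.
Proof.
move=> /boxP[/andP[a b] /andP[c d]].
rewrite !ler_pdivlMr ?ler_pdivrMr ?mulr_gt0// !mul0r !mul1r a b.
by split=> //; apply/andP; split; lra.
Qed.

Lemma bernstein_ge0 N x : (forall z, box z -> 0 <= g z) -> box x -> 0 <= bernstein N x.
Proof.
move=> g0 /box_ratio[s01 r01]; rewrite -{1}(bern_cst N.+1 0 (x.1 / T)).
apply: bern_le => // j jN; rewrite -{1}(bern_cst N.+1 0 ((x.2 + Y) / (2 * Y))).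
by apply: bern_le => // k kN; apply: g0; exact: node_box.
Qed.

(* Points whose scaled coordinates are within d of x are within e of x. *)
Let near_box (x : R * R) (P : set (R * R)) : nbhs x P ->
  exists2 d : R, 0 < d & forall z : R * R,
    `|z.1 / T - x.1 / T| < d -> `|(z.2 + Y) / (2 * Y) - (x.2 + Y) / (2 * Y)| < d -> P z.
Proof.
move=> /nbhs_ballP[e /= e0 eP].
exists (Num.min (e / T) (e / (2 * Y))).
  by rewrite lt_min !divr_gt0// mulr_gt0.
move=> z; rewrite -!mulrBl opprD addrACA subrr addr0 !normrM !lt_min.
rewrite [`|T^-1|]gtr0_norm ?invr_gt0// [`|(2 * Y)^-1|]gtr0_norm ?invr_gt0 ?mulr_gt0//.
rewrite !ltr_pM2r ?invr_gt0 ?mulr_gt0// => /andP[a _] /andP[_ b].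
by apply: eP; split; rewrite /ball/= distrC.
Qed.

(* A difference quotient over a step of the grid is a value of the derivative at an
   intermediate point. *)
Let step1 N j k : (j <= N)%N -> (k <= N.+1)%N -> exists s : R,
  [/\ node1 N j < s < node1 N j.+1, box (s, node2 N k) &
  N.+1%:R / T * (g (node1 N j.+1, node2 N k) - g (node1 N j, node2 N k)) =
    g1 (s, node2 N k)].
Proof.
move=> jN kN.
have /andP[a _] := @node1_itv N j (leqW jN); have /andP[_ b] := @node1_itv N j.+1 jN.
have E : node1 N j.+1 - node1 N j = T / N.+1%:R.
  by rewrite /node1 -(natr1 j) mulrDl mul1r mulrDr addrAC subrr add0r.
have L : node1 N j < node1 N j.+1 by rewrite -subr_gt0 E divr_gt0.
have bx s : node1 N j <= s <= node1 N j.+1 -> box (s, node2 N k).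
  move=> /andP[p q]; apply/boxP; split; last exact: node2_itv.
  by rewrite (le_trans a p) (le_trans q b).
have [s sI Es] := @mean_value _ (fun s => g (s, node2 N k)) (fun s => g1 (s, node2 N k))
  _ _ L (fun s sI => (is_derive_section1 _ _ _ _).1
    (let: And5 H _ _ _ _ := gC1 (bx s sI) in H)).
exists s; split=> //; first by apply: bx; case/andP: sI => /ltW -> /ltW ->.
by rewrite Es E; field; rewrite nat1r pnatr_eq0 ?(gt_eqF T0) ?(gt_eqF Y0).
Qed.

Let step2 N j k : (j <= N.+1)%N -> (k <= N)%N -> exists s : R,
  [/\ node2 N k < s < node2 N k.+1, box (node1 N j, s) &
  N.+1%:R / (2 * Y) * (g (node1 N j, node2 N k.+1) - g (node1 N j, node2 N k)) =
    g2 (node1 N j, s)].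
Proof.
move=> jN kN.
have /andP[a _] := @node2_itv N k (leqW kN); have /andP[_ b] := @node2_itv N k.+1 kN.
have E : node2 N k.+1 - node2 N k = 2 * Y / N.+1%:R.
  by rewrite /node2 -(natr1 k) mulrDl mul1r; ring.
have L : node2 N k < node2 N k.+1 by rewrite -subr_gt0 E divr_gt0// mulr_gt0.
have bx s : node2 N k <= s <= node2 N k.+1 -> box (node1 N j, s).
  move=> /andP[p q]; apply/boxP; split; first exact: node1_itv.
  by rewrite (le_trans a p) (le_trans q b).
have [s sI Es] := @mean_value _ (fun s => g (node1 N j, s)) (fun s => g2 (node1 N j, s))
  _ _ L (fun s sI => (is_derive_section2 _ _ _ _).1
    (let: And5 _ H _ _ _ := gC1 (bx s sI) in H)).
exists s; split=> //; first by apply: bx; case/andP: sI => /ltW -> /ltW ->.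
by rewrite Es E; field; rewrite nat1r pnatr_eq0 ?(gt_eqF T0) ?(gt_eqF Y0).
Qed.

(** The intermediate point provided by [step1] or [step2] lies between two nodes of the grid with N
    + 1 steps, whereas the derivative, being of degree N, associates the coefficient with j / N. The
    latter lies between the same two nodes. *)
Let frac_step (N j : nat) (z : R) : (j <= N)%N -> (0 < N)%N ->
  j%:R / N.+1%:R <= z <= j.+1%:R / N.+1%:R -> `|z - j%:R / N%:R| <= N.+1%:R^-1.
Proof.
move=> jN N0 /andP[a b].
have p : 0 < N%:R :> R by rewrite ltr0n.
have p1 : 0 < N.+1%:R :> R by rewrite ltr0n.
have jN' : (j%:R : R) <= N%:R by rewrite ler_nat.
have c : j%:R / N.+1%:R <= j%:R / N%:R :> R.
  by rewrite ler_wpM2l// lef_pV2 ?posrE// ler_nat.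
have d : j%:R / N%:R <= j.+1%:R / N.+1%:R :> R.
  rewrite ler_pdivrMr// mulrAC ler_pdivlMr// -!natrM ler_nat mulnS mulSn leq_add2r.
  exact: jN.
have e : j.+1%:R / N.+1%:R = j%:R / N.+1%:R + N.+1%:R^-1 :> R.
  by rewrite -natr1 mulrDl mul1r.
rewrite e in b d; move: a b c d {e}.
move: (j%:R / N.+1%:R : R) (j%:R / N%:R : R) (N.+1%:R^-1 : R) => u v w a b c d.
by rewrite ler_norml; apply/andP; split; lra.
Qed.

Let scaled1 N j : node1 N j / T = j%:R / N.+1%:R.
Proof. by rewrite /node1; field; rewrite nat1r pnatr_eq0 ?(gt_eqF T0) ?(gt_eqF Y0). Qed.

Let scaled2 N k : (node2 N k + Y) / (2 * Y) = k%:R / N.+1%:R.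
Proof. by rewrite /node2; field; rewrite nat1r pnatr_eq0 ?(gt_eqF T0) ?(gt_eqF Y0). Qed.

(** The coefficients are values of [g] or, by [step1] and [step2], values of [g1] and [g2]. Averages
    obey the same bounds, uniformly in [N]. *)
Lemma bernstein_bounds : exists2 M : R, 0 <= M & forall N x, box x ->
  [/\ `|bernstein N x| <= M, `|bernstein1 N x| <= M & `|bernstein2 N x| <= M].
Proof.
have [M0 M00 B0] := continuous_at_compact_bounded box_compact
  (fun x bx => let: And5 _ _ H _ _ := gC1 bx in H).
have [M1 M10 B1] := continuous_at_compact_bounded box_compact
  (fun x bx => let: And5 _ _ _ H _ := gC1 bx in H).
have [M2 M20 B2] := continuous_at_compact_bounded box_compact
  (fun x bx => let: And5 _ _ _ _ H := gC1 bx in H).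
exists (M0 + M1 + M2); first by rewrite !addr_ge0.
have H n1 n2 w M s r : 0 <= s <= 1 -> 0 <= r <= 1 ->
    (forall j k, (j <= n1)%N -> (k <= n2)%N -> `|w j k| <= M) ->
    `|bern n1 (fun j => bern n2 (w j) r) s| <= M.
  move=> s01 r01 wM; rewrite -[X in `|X|]subr0 -[leRHS](bern_cst n1 M s).
  apply: bern_abs_le => // j jn; rewrite -[leRHS](bern_cst n2 M r).
  by apply: bern_abs_le => // k kn; rewrite subr0; exact: wM.
move=> N x /box_ratio[s01 r01]; split.
- apply: le_trans (_ : M0 <= _); last by rewrite -addrA lerDl addr_ge0.
  by apply: H => // j k jN kN; apply: B0; exact: node_box.
- apply: le_trans (_ : M1 <= _); last by rewrite addrAC lerDr addr_ge0.
  by apply: H => // j k jN kN; have [s [_ bs ->]] := step1 jN kN; exact: B1.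
- apply: le_trans (_ : M2 <= _); last by rewrite lerDr addr_ge0.
  by apply: H => // j k jN kN; have [s [_ bs ->]] := step2 jN kN; exact: B2.
Qed.

Lemma bernstein_cvg x : box x -> bernstein N x @[N --> \oo] --> g x.
Proof.
move=> bx; have [s01 r01] := box_ratio bx.
have [M M0 B] := continuous_at_compact_bounded box_compact
  (fun x bx => let: And5 _ _ H _ _ := gC1 bx in H).
apply: (@bern2_cvg _ (fun N j k => g (node1 N j, node2 N k)) S S (2 * M)) => //.
  move=> N j k jN kN; apply: le_trans (ler_normB _ _) _;
  have A1 := B _ (node_box jN kN); have A2 := B _ bx; lra.
move=> e e0; have [_ _ gc _ _] := gC1 bx.
have /near_box[d d0 dP] : \forall z \near x, `|g x - g z| <= e.
  by move/cvgrPdist_le : gc; apply.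
exists d => //; near=> N => j k jN kN jd kd.
by rewrite distrC; apply: dP => /=; rewrite ?scaled1 ?scaled2.
Unshelve. all: by end_near. Qed.

Lemma bernstein1_cvg x : box x -> bernstein1 N x @[N --> \oo] --> g1 x.
Proof.
move=> bx; have [s01 r01] := box_ratio bx.
have [M M0 B] := continuous_at_compact_bounded box_compact
  (fun x bx => let: And5 _ _ _ H _ := gC1 bx in H).
apply: (@bern2_cvg _ (fun N j k => N.+1%:R / T *
    (g (node1 N j.+1, node2 N k) - g (node1 N j, node2 N k))) id S (2 * M)) => //.
  move=> N j k jN kN; apply: le_trans (ler_normB _ _) _;
  have [s [_ bs ->]] := step1 jN kN; have A1 := B _ bs; have A2 := B _ bx; lra.
move=> e e0; have [_ _ _ gc _] := gC1 bx.
have /near_box[d d0 dP] : \forall z \near x, `|g1 x - g1 z| <= e.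
  by move/cvgrPdist_le : gc; apply.
(* Half of [d] is reserved for the distance between j / N and the intermediate point. *)
exists (d / 2); first by rewrite divr_gt0.
near=> N => j k jN kN jd kd.
have N0 : (0 < N)%N by near: N; exact: nbhs_infty_gt.
have Nd : N.+1%:R^-1 < d / 2.
  rewrite invf_plt ?posrE ?divr_gt0 ?ltr0n//; apply: lt_trans (_ : N%:R < _); last first.
    by rewrite ltr_nat.
  by near: N; exact: nbhs_infty_gtr.
have [s [sI bs ->]] := step1 jN kN.
rewrite distrC; apply: dP => /=; last first.
  by rewrite scaled2; apply: lt_le_trans kd _; lra.
have F : `|s / T - j%:R / N%:R| <= N.+1%:R^-1.
  apply: frac_step => //; rewrite -!scaled1 !ler_pM2r ?invr_gt0//.
  by case/andP: sI => /ltW -> /ltW ->.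
rewrite -(subrK (j%:R / N%:R) (s / T)) -addrA; apply: le_lt_trans (ler_normD _ _) _.
by rewrite [ltRHS]splitr ltrD// (le_lt_trans F Nd).
Unshelve. all: by end_near. Qed.

Lemma bernstein2_cvg x : box x -> bernstein2 N x @[N --> \oo] --> g2 x.
Proof.
move=> bx; have [s01 r01] := box_ratio bx.
have [M M0 B] := continuous_at_compact_bounded box_compact
  (fun x bx => let: And5 _ _ _ _ H := gC1 bx in H).
apply: (@bern2_cvg _ (fun N j k => N.+1%:R / (2 * Y) *
    (g (node1 N j, node2 N k.+1) - g (node1 N j, node2 N k))) S id (2 * M)) => //.
  move=> N j k jN kN; apply: le_trans (ler_normB _ _) _;
  have [s [_ bs ->]] := step2 jN kN; have A1 := B _ bs; have A2 := B _ bx; lra.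
move=> e e0; have [_ _ _ _ gc] := gC1 bx.
have /near_box[d d0 dP] : \forall z \near x, `|g2 x - g2 z| <= e.
  by move/cvgrPdist_le : gc; apply.
exists (d / 2); first by rewrite divr_gt0.
near=> N => j k jN kN jd kd.
have N0 : (0 < N)%N by near: N; exact: nbhs_infty_gt.
have Nd : N.+1%:R^-1 < d / 2.
  rewrite invf_plt ?posrE ?divr_gt0 ?ltr0n//; apply: lt_trans (_ : N%:R < _); last first.
    by rewrite ltr_nat.
  by near: N; exact: nbhs_infty_gtr.
have [s [sI bs ->]] := step2 jN kN.
rewrite distrC; apply: dP => /=.
  by rewrite scaled1; apply: lt_le_trans jd _; lra.
have F : `|(s + Y) / (2 * Y) - k%:R / N%:R| <= N.+1%:R^-1.
  apply: frac_step => //; rewrite -!scaled2 !ler_pM2r ?invr_gt0 ?mulr_gt0// !lerD2r.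
  by case/andP: sI => /ltW -> /ltW ->.
rewrite -(subrK (k%:R / N%:R) ((s + Y) / _)) -addrA; apply: le_lt_trans (ler_normD _ _) _.
by rewrite [ltRHS]splitr ltrD// (le_lt_trans F Nd).
Unshelve. all: by end_near. Qed.

End BernsteinApproximation.

(** * Integrals without measurability *)

Section NullSets.
Context {d : measure_display} {T : measurableType d} {R : realType}.
Variable mu : {measure set T -> \bar R}.
Import HBNNSimple.

(* No measurability is required of f and g: a simple function below f becomes one
   below g when it is cut off on N. *)
Lemma eq_integral_off_null (D N : set T) (f g : T -> \bar R) :
  measurable N -> mu N = 0 -> (forall x, D x -> ~ N x -> f x = g x) ->
  (\int[mu]_(x in D) f x = \int[mu]_(x in D) g x)%E.
Proof.
move=> mN N0 fg.
have main (k l : T -> \bar R) : (forall x, 0 <= l x)%E ->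
    (forall x, ~ N x -> k x = l x) ->
    (ereal_sup [set sintegral mu h | h in
       [set h : {nnsfun T >-> R} | forall x, ((h x)%:E <= k x)%E]] <=
     ereal_sup [set sintegral mu h | h in
       [set h : {nnsfun T >-> R} | forall x, ((h x)%:E <= l x)%E]])%E.
  move=> l0 kl; apply: ub_ereal_sup => _ [h hk <-].
  have mNC : measurable (~` N) by exact: measurableC.
  apply: ereal_sup_ubound; exists (proj_nnsfun h mNC).
    move=> x; rewrite -(mrestrict h mNC) patchE; case: ifPn => [xN|_]; last exact: l0.
    by rewrite -kl//; move: xN; rewrite inE.
  rewrite -(mrestrict h mNC) -(integral_nnsfun mu mNC) -integralT_nnsfun.
  rewrite [RHS](@ge0_negligible_integral _ _ _ mu setT N)//.
  - by rewrite setTD.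
  - exact/measurable_EFinP.
  - by move=> x _; rewrite lee_fin.
have FG x : ~ N x -> (f \_ D) x = (g \_ D) x.
  move=> Nx; rewrite !patchE; case: ifPn => //; rewrite inE => Dx; exact: fg.
by rewrite /integral; congr (_ - _)%E; apply/eqP; rewrite eq_le;
  apply/andP; split; apply: main => x *;
  rewrite ?funepos_ge0 ?funeneg_ge0 ?funeposE ?funenegE ?FG.
Qed.

Lemma integral_support (D E : set T) (f : T -> \bar R) : D `<=` E ->
  (forall x, E x -> ~ D x -> f x = 0)%E ->
  (\int[mu]_(x in E) f x = \int[mu]_(x in D) f x)%E.
Proof.
move=> DE f0; rewrite integral_mkcond [RHS]integral_mkcond.
apply: eq_integral => x _; rewrite !patchE.
have [Dx|Dx] := boolP (x \in D); first by rewrite mem_set//; apply: DE; move: Dx; rewrite inE.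
case: ifPn => //; rewrite inE => Ex; apply: f0 => //.
by move: Dx; rewrite notin_setE.
Qed.

End NullSets.

(** * Borel sets and measurable functions on the plane *)

Section PlaneMeasurability.
Context {R : realType}.
Local Notation R2 := (measurableTypeR R * measurableTypeR R)%type.

(** Measurability refers to the product of two Borel structures, openness to the product topology.
    The countably many squares with rational centres and radii 1 / (k + 1) form a base that links
    the two. *)
Lemma open_measurable2 (U : set (R * R)) : open U -> measurable (U : set R2).
Proof.
move=> oU.
pose B (i : rat * rat * nat) : set R2 :=
  ball (ratr i.1.1 : R) (i.2.+1%:R^-1) `*` ball (ratr i.1.2 : R) (i.2.+1%:R^-1).
have mB i : measurable (B i).
  apply: measurableX; apply: open_measurable; exact: ball_open.
suff -> : U = \bigcup_(i in [set i | B i `<=` U]) B i.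
  rewrite bigcup_mkcond; apply: countable_bigcupT_measurable => // i.
  by case: ifP.
apply/seteqP; split=> [[x y] Uxy|x [i iU Bx]]; last exact: iU.
have /nbhs_ballP[e /= e0 eU] : nbhs (x, y) U by exact: open_nbhs_nbhs.
(* A square of radius 1 / (k + 1) that contains the point lies within twice that radius of it. *)
have [k ke] : exists k : nat, 2 * k.+1%:R^-1 < e.
  near \oo => k; exists k; rewrite mulrC -ltr_pdivlMr//.
  near: k; exact: (near_infty_natSinv_lt (PosNum (divr_gt0 e0 (ltr0n R 2)))).
have k0 : 0 < k.+1%:R^-1 :> R by rewrite invr_gt0.
have Q (r z : R) : 0 < r -> exists q : rat, ball (ratr q : R) r z.
  move=> r0; have zr : z - r < z + r by lra.
  have [q] := rat_in_itvoo zr; rewrite in_itv/= => /andP[a b].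
  by exists q; rewrite /ball/= ltr_distlC; apply/andP; split; lra.
have [q1 Q1] := Q _ x k0; have [q2 Q2] := Q _ y k0.
exists (q1, q2, k); last by split.
move=> [x' y'] [/= B1 B2]; apply: eU; split => /=.
- apply: (@le_ball _ _ _ (k.+1%:R^-1 + k.+1%:R^-1)); first by move: ke; rewrite mulr_natl mulr2n => /ltW.
  by apply: ball_triangle B1; exact: ball_sym.
- apply: (@le_ball _ _ _ (k.+1%:R^-1 + k.+1%:R^-1)); first by move: ke; rewrite mulr_natl mulr2n => /ltW.
  by apply: ball_triangle B2; exact: ball_sym.
Unshelve. all: by end_near. Qed.

Lemma continuous_at_measurable (D : set (R * R)) (f : R * R -> R) : open D ->
  (forall x, D x -> {for x, continuous f}) -> measurable_fun (D : set R2) f.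
Proof.
move=> oD cf; apply: (measurability _ (RGenOpens.measurableE R)).
move=> _ [_ [a [b ->] <-]]; apply: open_measurable2.
rewrite openE => x [Dx fx]; rewrite /interior.
apply: filterI; first exact: open_nbhs_nbhs.
apply: (cf _ Dx); apply: open_nbhs_nbhs; split => //; exact: interval_open.
Qed.

End PlaneMeasurability.

(** * Approximation of C^1 test functions *)

Section TestFunctions.
Context {R : realType}.

(** The support is bounded towards late times and large |y| only, since negative times do not enter
    the weak formulations. [T] and [Y] are kept as data because they fix the box of integration. *)
Definition C1_test (f f1 f2 : R * R -> R) (T Y : R) : Prop :=
  (forall x, C1_at f f1 f2 x) /\
  (forall x : R * R, T <= x.1 \/ Y <= `|x.2| -> [/\ f x = 0, f1 x = 0 & f2 x = 0]).

Lemma smooth_alg_C1_at (f : R * R -> R) x : smooth_alg f -> C1_at f (d_tau f) (d_y f) x.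
Proof.
move=> sf; have [df Df] := smooth_alg_diff sf.
have [df1 _] := smooth_alg_diff (Df (1, 0)).
have [df2 _] := smooth_alg_diff (Df (0, 1)).
split.
- exact/derivableP/diff_derivable.
- exact/derivableP/diff_derivable.
- exact/differentiable_continuous/df.
- exact/differentiable_continuous/df1.
- exact/differentiable_continuous/df2.
Qed.

(** * Smooth bumps on a box *)

Section Bump.
Variables (T Y : R).

Definition bump_root : R * R -> R :=
  ((flat 0 \o (cst T + cst (- 1) * fst)) * (flat 0 \o (fst + cst 1))) *
  ((flat 0 \o (cst Y + cst (- 1) * snd)) * (flat 0 \o (snd + cst Y))).

(** Squaring makes the first derivatives vanish wherever [bump_root] does, boundary included. *)
Definition bump : R * R -> R := bump_root * bump_root.

Lemma smooth_alg_bump_root : smooth_alg bump_root.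
Proof.
have c k : smooth_alg (cst k : R * R -> R) by exact: smooth_cst.
have a : smooth_alg (fst : R * R -> R) by exact: smooth_fst.
have b : smooth_alg (snd : R * R -> R) by exact: smooth_snd.
by do 2! apply: smooth_mul; apply: smooth_flat; apply: smooth_add => //;
  apply: smooth_mul.
Qed.

Lemma smooth_alg_bump : smooth_alg bump.
Proof. by apply: smooth_mul; exact: smooth_alg_bump_root. Qed.

Lemma bump_ge0 x : 0 <= bump x.
Proof. by rewrite /bump /GRing.mul/= -expr2 sqr_ge0. Qed.

Lemma bump_rootE x : bump_root x =
  flat 0 (T - x.1) * flat 0 (x.1 + 1) * (flat 0 (Y - x.2) * flat 0 (x.2 + Y)).
Proof. by rewrite -(mulN1r x.1) -(mulN1r x.2). Qed.

Lemma bump_root_eq0 x : [|| T <= x.1, x.1 <= - 1 | Y <= `|x.2|] -> bump_root x = 0.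
Proof.
rewrite bump_rootE => /or3P[H|H|].
- by rewrite flat_eq0 ?mul0r//; lra.
- by rewrite (@flat_eq0 _ _ (x.1 + 1)) ?mulr0 ?mul0r//; lra.
rewrite ler_normr => /orP[H|H].
- by rewrite (@flat_eq0 _ _ (Y - x.2)) ?mul0r ?mulr0//; lra.
- by rewrite (@flat_eq0 _ _ (x.2 + Y)) ?mulr0//; lra.
Qed.

Lemma bump_gt0 x : - 1 < x.1 < T -> `|x.2| < Y -> 0 < bump x.
Proof.
move=> /andP[a b]; rewrite ltr_norml => /andP[c d].
suff H : 0 < bump_root x by rewrite /bump /GRing.mul/= mulr_gt0.
by rewrite bump_rootE !mulr_gt0// flat_gt0//; lra.
Qed.

Lemma bump_eq0 x : bump_root x = 0 -> [/\ bump x = 0, d_tau bump x = 0 & d_y bump x = 0].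
Proof.
move=> r0; have [H1 H2 _ _ _] := smooth_alg_C1_at x smooth_alg_bump_root.
split; first by rewrite /bump /GRing.mul/= r0 mul0r.
- have -> : d_tau bump x = _ := @derive_val _ _ _ _ _ _ _ (is_derive_mul H1 H1).
  by rewrite r0 mulr0 mul0r addr0.
- have -> : d_y bump x = _ := @derive_val _ _ _ _ _ _ _ (is_derive_mul H2 H2).
  by rewrite r0 mulr0 mul0r addr0.
Qed.

End Bump.

Section Approximation.
Variables (f f1 f2 : R * R -> R) (T Y : R).
Hypotheses (T0 : 0 < T) (Y0 : 0 < Y) (tf : C1_test f f1 f2 T Y).

Let T' := T + 1.
Let Y' := Y + 1.
Let T'0 : 0 < T'. Proof. exact: addr_gt0. Qed.
Let Y'0 : 0 < Y'. Proof. exact: addr_gt0. Qed.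

Variable b : R * R -> R.
Hypotheses (sb : smooth_alg b) (b_ge0 : forall x, 0 <= b x)
  (b_gt0 : forall x : R * R, - 1 < x.1 < T' -> `|x.2| < Y' -> 0 < b x)
  (b_eq0 : forall x : R * R, [|| T' <= x.1, x.1 <= - 1 | Y' <= `|x.2|] ->
     [/\ b x = 0, d_tau b x = 0 & d_y b x = 0]).

(** Dividing by the bump before the approximation and multiplying by it afterwards turns polynomials
    into smooth functions of compact support. The bump lives on a box larger by 1, so within tau >=
    0 [f] vanishes near its zeros, and there the quotient is 0. *)
Let g x := f x * (b x)^-1.
Let g1 x := f1 x * (b x)^-1 + f x * (- (b x) ^- 2 * d_tau b x).
Let g2 x := f2 x * (b x)^-1 + f x * (- (b x) ^- 2 * d_y b x).

Let far_near0 x : T' <= x.1 \/ Y' <= `|x.2| ->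
  \forall z \near x, [/\ f z = 0, f1 z = 0 & f2 z = 0].
Proof.
case: tf => _ H [Tx|Yx].
- have c : {for x, continuous (fst : R * R -> R)} by exact: cvg_fst.
  near=> z; apply: H; left; apply: ltW.
  near: z; apply: (c [set t | T < t] _).
  by apply: lt_nbhsr; apply: lt_le_trans Tx; rewrite ltrDl.
- have c : {for x, continuous (fun z : R * R => `|z.2|)}.
    by apply: cvg_norm; exact: cvg_snd.
  near=> z; apply: H; right; apply: ltW.
  near: z; apply: (c [set t | Y < t] _).
  by apply: lt_nbhsr; apply: lt_le_trans Yx; rewrite ltrDl.
Unshelve. all: by end_near. Qed.

Let inside x : box T' Y' x -> ~ (T' <= x.1 \/ Y' <= `|x.2|) -> 0 < b x.
Proof.
move=> /boxP[/andP[a _] _] /not_orP[/negP +/negP]; rewrite -!ltNge => c d.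
by apply: b_gt0 => //; rewrite c andbT (lt_le_trans _ a)// ltrN10.
Qed.

Let gC1 x : box T' Y' x -> C1_at g g1 g2 x.
Proof.
move=> bx; have [far|/(inside bx) b0] := pselect (T' <= x.1 \/ Y' <= `|x.2|).
  apply: near_eq_C1_at (C1_at_cst 0 x).
  apply: filterS (far_near0 far) => z [z0 z1 z2].
  by rewrite /g /g1 /g2 z0 z1 z2 !mul0r addr0.
apply: C1_at_mul; first by case: tf.
apply: (@C1_at_comp _ (fun z => z^-1) (fun z => - z ^- 2)).
- exact: smooth_alg_C1_at sb.
- by have := @is_deriveV _ id (b x) 1 1 (lt0r_neq0 b0) _; rewrite [_ *: _]mulr1; apply.
- apply: cvgN; apply: cvgV; first by rewrite expf_neq0// gt_eqF.
  exact: exprn_continuous.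
Qed.

Let F N := b * bernstein T' Y' g N.
Let F1 N x := d_tau b x * bernstein T' Y' g N x + b x * bernstein1 T' Y' g N x.
Let F2 N x := d_y b x * bernstein T' Y' g N x + b x * bernstein2 T' Y' g N x.

Let FE N x : F N x = b x * bernstein T' Y' g N x. Proof. by []. Qed.

Let smF N : smooth_alg (F N).
Proof. by apply: smooth_mul; [exact: sb|exact: smooth_alg_bernstein]. Qed.

Let d_tauF N x : d_tau (F N) x = F1 N x.
Proof.
have [H1 _ _ _ _] := smooth_alg_C1_at x sb.
exact: (@derive_val _ _ _ _ _ _ _ (is_derive_mul H1 (is_derive_bernstein1 _ _ _ _ x))).
Qed.

Let d_yF N x : d_y (F N) x = F2 N x.
Proof.
have [_ H1 _ _ _] := smooth_alg_C1_at x sb.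
exact: (@derive_val _ _ _ _ _ _ _ (is_derive_mul H1 (is_derive_bernstein2 _ _ _ _ x))).
Qed.

Let outside (x : R * R) : 0 <= x.1 -> ~ box T' Y' x ->
  [/\ b x = 0, d_tau b x = 0 & d_y b x = 0].
Proof.
move=> x0 nbx; apply: b_eq0.
apply/or3P; have [Tx|xT] := leP T' x.1; first exact: Or31.
have [Yx|xY] := leP Y' `|x.2|; first exact: Or33.
exfalso; apply: nbx; apply/boxP; rewrite x0 (ltW xT); split=> //.
by rewrite -ler_norml ltW.
Qed.

(** The bounds independent of [N], the common support and the pointwise limits prepare dominated
    convergence. Signs survive because Bernstein polynomials of nonnegative functions are
    nonnegative. Everything is asserted for tau >= 0, where the polynomials approximate. *)
Lemma C1_test_approximation_bump : exists F : nat -> R * R -> R, exists M : R,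
  [/\ forall N, smooth_alg (F N) /\ test_fun (F N),
      (forall x : R * R, 0 <= x.1 -> 0 <= f x) -> forall N x, 0 <= x.1 -> 0 <= F N x,
      forall N x, 0 <= x.1 ->
        [/\ `|F N x| <= M, `|d_tau (F N) x| <= M & `|d_y (F N) x| <= M],
      forall N x, 0 <= x.1 -> T + 1 < x.1 \/ Y + 1 < `|x.2| ->
        [/\ F N x = 0, d_tau (F N) x = 0 & d_y (F N) x = 0] &
      forall x, 0 <= x.1 -> [/\ F N x @[N --> \oo] --> f x,
        d_tau (F N) x @[N --> \oo] --> f1 x & d_y (F N) x @[N --> \oo] --> f2 x]].
Proof.
have zero N x : 0 <= x.1 -> ~ box T' Y' x -> [/\ F N x = 0, F1 N x = 0 & F2 N x = 0].
  move=> x0 /(outside x0)[e0 e1 e2].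
  by rewrite FE /F1 /F2 e0 e1 e2 !mul0r addr0.
have [M [M0 Mb]] : exists M, 0 <= M /\ forall N x, box T' Y' x ->
    [/\ `|F N x| <= M, `|F1 N x| <= M & `|F2 N x| <= M].
  have [B B0 HB] := bernstein_bounds T'0 Y'0 gC1.
  have cb (x : R * R) : C1_at b (d_tau b) (d_y b) x := smooth_alg_C1_at x sb.
  have [C0 C00 HC0] := continuous_at_compact_bounded (@box_compact R T' Y')
    (fun x (_ : box T' Y' x) => let: And5 _ _ H _ _ := cb x in H).
  have [C1 C10 HC1] := continuous_at_compact_bounded (@box_compact R T' Y')
    (fun x (_ : box T' Y' x) => let: And5 _ _ _ H _ := cb x in H).
  have [C2 C20 HC2] := continuous_at_compact_bounded (@box_compact R T' Y')
    (fun x (_ : box T' Y' x) => let: And5 _ _ _ _ H := cb x in H).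
  exists ((C0 + C1 + C2) * B); split; first by rewrite mulr_ge0// !addr_ge0.
  move=> N x bx; have [b0 b1 b2] := HB N x bx.
  have c0 := HC0 x bx; have c1 := HC1 x bx; have c2 := HC2 x bx.
  have P (u v k : R) : `|u| <= k -> `|v| <= B -> `|u * v| <= k * B.
    by move=> uk vB; rewrite normrM ler_pM.
  have C1B : 0 <= C1 * B by rewrite mulr_ge0.
  have C2B : 0 <= C2 * B by rewrite mulr_ge0.
  have C0B : 0 <= C0 * B by rewrite mulr_ge0.
  rewrite !mulrDl; split.
  - by have := P _ _ _ c0 b0; rewrite FE; lra.
  - by apply: le_trans (ler_normD _ _) _; have := P _ _ _ c1 b0; have := P _ _ _ c0 b1; lra.
  - by apply: le_trans (ler_normD _ _) _; have := P _ _ _ c2 b0; have := P _ _ _ c0 b2; lra.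
exists F, M; split.
- move=> N; split; first exact: smF.
  split; first exact: smooth_alg_smooth2.
  (* Compactness of the support concerns the whole plane; below, the bump confines it to tau >= -
     1. *)
  pose K : set (R * R) := `[- 1, T']%classic `*` `[- Y', Y']%classic.
  have cK : compact K by apply: compact_setX; exact: segment_compact.
  have clK : closed K.
    apply: compact_closed => //; exact: norm_hausdorff.
  apply: (subclosed_compact _ cK); first exact: closed_closure.
  rewrite closureE; apply: smallest_sub => // x.
  apply: contraPP => nK; apply/negP; rewrite negbK; apply/eqP.
  rewrite FE; suff -> : b x = 0 by rewrite mul0r.
  suff H : [|| T' <= x.1, x.1 <= - 1 | Y' <= `|x.2|] by have [] := b_eq0 H.
  apply/or3P; have [Tx|xT] := leP T' x.1; first exact: Or31.
  have [x1|x1] := leP x.1 (- 1); first exact: Or32.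
  have [Yx|xY] := leP Y' `|x.2|; first exact: Or33.
  exfalso; apply: nK; rewrite /K /setX/= !in_itv/= (ltW x1) (ltW xT); split=> //.
  by rewrite -ler_norml ltW.
- move=> f0 N x x0; have [bx|nbx] := pselect (box T' Y' x); last first.
    by have [-> _ _] := zero N x x0 nbx.
  rewrite FE mulr_ge0 ?b_ge0//; apply: bernstein_ge0 => //.
  move=> z /boxP[/andP[z0 _] _]; rewrite /g mulr_ge0 ?f0//.
  by rewrite invr_ge0 b_ge0.
- move=> N x x0; rewrite d_tauF d_yF.
  have [bx|nbx] := pselect (box T' Y' x); first exact: Mb.
  by have [-> -> ->] := zero N x x0 nbx; rewrite normr0.
- move=> N x x0 H; rewrite d_tauF d_yF; apply: zero => //.
  move=> /boxP[/andP[_ a]]; rewrite -ler_norml => c.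
  by case: H => H; [move: a|move: c]; rewrite leNgt H.
- move=> x x0.
  rewrite (_ : (fun N => d_tau (F N) x) = F1 ^~ x); last by apply/funext => N.
  rewrite (_ : (fun N => d_y (F N) x) = F2 ^~ x); last by apply/funext => N.
  have [bx|nbx] := pselect (box T' Y' x); last first.
    have H : T <= x.1 \/ Y <= `|x.2|.
      apply: contrapT => /not_orP[/negP +/negP]; rewrite -!ltNge => c d.
      apply: nbx; apply/boxP; rewrite x0 -ler_norml /T' /Y'; split; lra.
    have [_ /(_ _ H)[-> -> ->]] := tf.
    rewrite (_ : (F ^~ x) = cst 0); last by apply/funext => N; have [] := zero N x x0 nbx.
    rewrite (_ : (F1 ^~ x) = cst 0); last by apply/funext => N; have [] := zero N x x0 nbx.
    rewrite (_ : (F2 ^~ x) = cst 0); last by apply/funext => N; have [] := zero N x x0 nbx.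
    by split; exact: cvg_cst.
  (* Multiplying back recovers [f] and its derivatives: where [b] vanishes, they vanish too. *)
  have E : [/\ b x * g x = f x, d_tau b x * g x + b x * g1 x = f1 x
             & d_y b x * g x + b x * g2 x = f2 x].
    have [far|/(inside bx) b0] := pselect (T' <= x.1 \/ Y' <= `|x.2|).
      have [z0 z1 z2] := nbhs_singleton (far_near0 far).
      by rewrite /g /g1 /g2 z0 z1 z2 !mul0r !addr0 !mulr0 addr0.
    by rewrite /g /g1 /g2; split; field; rewrite gt_eqF.
  have [<- <- <-] := E.
  have L0 := bernstein_cvg T'0 Y'0 gC1 bx.
  have L1 := bernstein1_cvg T'0 Y'0 gC1 bx.
  have L2 := bernstein2_cvg T'0 Y'0 gC1 bx.
  split.
  - by apply: cvgM => //; exact: cvg_cst.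
  - exact: (cvgD (cvgM (cvg_cst _) L0) (cvgM (cvg_cst _) L1)).
  - exact: (cvgD (cvgM (cvg_cst _) L0) (cvgM (cvg_cst _) L2)).
Qed.

End Approximation.

Lemma C1_test_approximation (f f1 f2 : R * R -> R) (T Y : R) :
  0 < T -> 0 < Y -> C1_test f f1 f2 T Y -> exists F : nat -> R * R -> R, exists M : R,
  [/\ forall N, smooth_alg (F N) /\ test_fun (F N),
      (forall x : R * R, 0 <= x.1 -> 0 <= f x) -> forall N x, 0 <= x.1 -> 0 <= F N x,
      forall N x, 0 <= x.1 ->
        [/\ `|F N x| <= M, `|d_tau (F N) x| <= M & `|d_y (F N) x| <= M],
      forall N x, 0 <= x.1 -> T + 1 < x.1 \/ Y + 1 < `|x.2| ->
        [/\ F N x = 0, d_tau (F N) x = 0 & d_y (F N) x = 0] &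
      forall x, 0 <= x.1 -> [/\ F N x @[N --> \oo] --> f x,
        d_tau (F N) x @[N --> \oo] --> f1 x & d_y (F N) x @[N --> \oo] --> f2 x]].
Proof.
move=> T0 Y0 tf; apply: (C1_test_approximation_bump T0 Y0 tf (b := bump (T + 1) (Y + 1))).
- exact: smooth_alg_bump.
- exact: bump_ge0.
- exact: bump_gt0.
- by move=> x /bump_root_eq0/bump_eq0.
Qed.

End TestFunctions.

(** * Weak formulations with C^1 test functions *)

Section RealDominatedConvergence.
Context {d : measure_display} {T : measurableType d} {R : realType}.
Variables (mu : {measure set T -> \bar R}) (D : set T) (mD : measurable D).

Lemma Rdominated_cvg (f_ : nat -> T -> R) (f g : T -> R) :
  (forall n, measurable_fun D (f_ n)) ->
  (forall x, D x -> f_ n x @[n --> \oo] --> f x) ->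
  mu.-integrable D (EFin \o g) ->
  (forall n x, D x -> `|f_ n x| <= g x) ->
  mu.-integrable D (EFin \o f) /\
  \int[mu]_(x in D) f_ n x @[n --> \oo] --> \int[mu]_(x in D) f x.
Proof.
move=> mf_ f_f ig fg.
have mf : measurable_fun D f by exact: (measurable_fun_cvg mf_ f_f).
have [|||||i1 _ i2] := @dominated_convergence _ _ _ mu D mD
  (fun n => EFin \o f_ n) (EFin \o f) (EFin \o g).
- by move=> n; exact/measurable_EFinP.
- exact/measurable_EFinP.
- apply: aeW => x Dx; apply: cvg_EFin; first by near=> n.
  exact: f_f.
- exact: ig.
- by apply: aeW => x n Dx; rewrite /= lee_fin fg.
split=> //; rewrite /Rintegral; apply: fine_cvg.
by rewrite fineK//; exact: integrable_fin_num.
Unshelve. all: by end_near. Qed.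

Lemma integrable_mulb (f g : T -> R) M :
  measurable_fun D g -> (forall x, D x -> `|g x| <= M) ->
  mu.-integrable D (EFin \o f) -> mu.-integrable D (EFin \o (fun x => g x * f x)).
Proof.
move=> mg gM fi.
have := @integrableMr _ _ _ mu D mD g (EFin \o f) mg _ fi.
apply; exists M; split; first exact: num_real.
by move=> y My x Dx; apply: le_trans (gM _ Dx) (ltW My).
Qed.

Lemma integrable_add (f g : T -> R) :
  mu.-integrable D (EFin \o f) -> mu.-integrable D (EFin \o g) ->
  mu.-integrable D (EFin \o (fun x => f x + g x)).
Proof. by move=> fi gi; exact: (integrableD mD fi gi). Qed.

Lemma integrable_opp (f : T -> R) :
  mu.-integrable D (EFin \o f) -> mu.-integrable D (EFin \o (fun x => - f x)).
Proof. by move=> fi; exact: (integrableN fi). Qed.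

Lemma integrable_sub (f g : T -> R) :
  mu.-integrable D (EFin \o f) -> mu.-integrable D (EFin \o g) ->
  mu.-integrable D (EFin \o (fun x => f x - g x)).
Proof. by move=> fi gi; exact: (integrableB mD fi gi). Qed.

End RealDominatedConvergence.

Section WeakBalance.
Context {R : realType}.
Local Notation R2 := (measurableTypeR R * measurableTypeR R)%type.
Local Notation ohp := (@open_half_plane R).

(** The line tau = 0 is left out, so that the box lies in [open_half_plane]. *)
Definition pbox (T Y : R) : set (R * R) := `]0, T]%classic `*` `[- Y, Y]%classic.

Lemma pboxP T Y x : pbox T Y x <-> 0 < x.1 <= T /\ `|x.2| <= Y.
Proof. by rewrite /pbox /setX /= !in_itv/= ler_norml. Qed.

Lemma measurable_pbox T Y : measurable (pbox T Y : set R2).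
Proof. by apply: measurableX; exact: measurable_itv. Qed.

Lemma pbox_lty T Y : (leb2 R (pbox T Y) < +oo)%E.
Proof.
have -> : leb2 R (pbox T Y) =
    (lebesgue_measure `]0%R, T]%classic * lebesgue_measure `[(- Y)%R, Y]%classic)%E.
  by apply: product_measure1E; exact: measurable_itv.
rewrite !lebesgue_measure_itv /=.
by case: ifP => _; case: ifP => _; rewrite ?mul0e ?mule0 ?ltry// -!EFinB -EFinM ltry.
Qed.

Lemma measurable_ohp : measurable (ohp : set R2).
Proof.
apply: open_measurable2.
have -> : ohp = fst @^-1` [set t : R | 0 < t] by [].
apply: open_comp => [x _|]; first exact: cvg_fst.
exact: open_gt.
Qed.

Lemma open_ohp : open ohp.
Proof.
have -> : ohp = fst @^-1` [set t : R | 0 < t] by [].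
apply: open_comp => [x _|]; first exact: cvg_fst.
exact: open_gt.
Qed.

Lemma pbox_ohp T Y : pbox T Y `<=` ohp.
Proof. by move=> x /pboxP[/andP[]]. Qed.

Definition L1box (f : R * R -> R) := forall T Y, (leb2 R).-integrable (pbox T Y) (EFin \o f).

Definition L1seg (f : R -> R) :=
  forall Y, (leb R).-integrable `[- Y, Y]%classic (EFin \o f).

Lemma L1box_add (f g : R * R -> R) : L1box f -> L1box g -> L1box (fun x => f x + g x).
Proof.
by move=> fi gi T Y; apply: integrable_add => //; exact: measurable_pbox.
Qed.

Lemma L1box_opp f : L1box f -> L1box (fun x => - f x).
Proof. by move=> fi T Y; apply: integrable_opp => //; exact: measurable_pbox. Qed.

Lemma L1box_mulb (g f : R * R -> R) : measurable_fun (ohp : set R2) g ->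
  (forall T Y, exists M, forall x, pbox T Y x -> `|g x| <= M) ->
  L1box f -> L1box (fun x => g x * f x).
Proof.
move=> mg gM fi T Y; have [M HM] := gM T Y.
apply: (@integrable_mulb _ _ R (leb2 R) (pbox T Y) (measurable_pbox T Y) f g M) => //.
by apply: measurable_funS mg; [exact: measurable_ohp|exact: pbox_ohp].
Qed.

Lemma L1box_bounded (g : R * R -> R) : measurable_fun (ohp : set R2) g ->
  (forall T Y, exists M, forall x, pbox T Y x -> `|g x| <= M) -> L1box g.
Proof.
move=> mg gM T Y; apply: measurable_bounded_integrable.
- exact: measurable_pbox.
- exact: pbox_lty.
- by apply: measurable_funS mg; [exact: measurable_ohp|exact: pbox_ohp].
have [M HM] := gM T Y; exists M; split; first exact: num_real.
by move=> y My x Dx; apply: le_trans (HM _ Dx) (ltW My).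
Qed.

Lemma C1_measurable (f f1 f2 : R * R -> R) : (forall x, C1_at f f1 f2 x) ->
  [/\ measurable_fun (setT : set R2) f, measurable_fun (setT : set R2) f1
    & measurable_fun (setT : set R2) f2].
Proof.
move=> C; split; apply: continuous_at_measurable => //; try exact: openT;
  by move=> x _; case: (C x).
Qed.

Lemma integral_pbox (f : R * R -> R) (T Y : R) :
  (forall x, ohp x -> T < x.1 \/ Y < `|x.2| -> f x = 0) ->
  (\int[leb2 R]_(x in ohp) (f x)%:E = \int[leb2 R]_(x in pbox T Y) (f x)%:E)%E.
Proof.
move=> f0; apply: integral_support; first exact: pbox_ohp.
move=> x ox npx; rewrite f0//; apply: contrapT => /not_orP[/negP + /negP].
by rewrite -!leNgt => a b; apply: npx; apply/pboxP; rewrite a b andbT.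
Qed.

Lemma Rintegral_pbox (f : R * R -> R) (T Y : R) :
  (forall x, ohp x -> T < x.1 \/ Y < `|x.2| -> f x = 0) ->
  \int[leb2 R]_(x in ohp) f x = \int[leb2 R]_(x in pbox T Y) f x.
Proof. by move=> f0; rewrite /Rintegral (integral_pbox f0). Qed.

Lemma Rintegral_seg (f : R -> R) (Y : R) : (forall y, Y < `|y| -> f y = 0) ->
  \int[leb R]_y f y = \int[leb R]_(y in `[- Y, Y]) f y.
Proof.
move=> f0; rewrite /Rintegral; congr fine; apply: integral_support => // y _.
rewrite /= in_itv/= => /negP; rewrite -ler_norml -ltNge => /f0 -> //.
Qed.

Lemma integrable_seg (f : R -> R) (Y : R) : (forall y, Y < `|y| -> f y = 0) ->
  (leb R).-integrable `[- Y, Y] (EFin \o f) -> (leb R).-integrable setT (EFin \o f).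
Proof.
move=> f0 fi.
have : (leb R).-integrable setT ((EFin \o f) \_ `[- Y, Y]).
  have mI : measurable (`[- Y, Y]%classic : set (measurableTypeR R)) by exact: measurable_itv.
  exact: (integrable_mkcond (mu := leb R) (EFin \o f) mI).1.
apply: eq_integrable => // y _; rewrite patchE; case: ifPn => // yI.
have : ~ `[- Y, Y]%classic y by move: yI; rewrite notin_setE.
by rewrite /= in_itv/= => /negP; rewrite -ler_norml -ltNge => /f0 /= ->.
Qed.

Lemma integrable_pbox (f : R * R -> R) (T Y : R) :
  (forall x, ohp x -> T < x.1 \/ Y < `|x.2| -> f x = 0) ->
  (leb2 R).-integrable (pbox T Y) (EFin \o f) -> (leb2 R).-integrable ohp (EFin \o f).
Proof.
move=> f0 fi; have mo := measurable_ohp; have mp := measurable_pbox T Y.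
have H : (leb2 R).-integrable (ohp `&` pbox T Y) (EFin \o f).
  by rewrite setIidr//; exact: pbox_ohp.
have := (integrable_restrict (leb2 R) mp mo (EFin \o f)).1 H.
apply: eq_integrable => // x; rewrite inE => ox; rewrite patchE; case: ifPn => //.
rewrite notin_setE => npx /=; rewrite f0//; apply: contrapT => /not_orP[/negP + /negP].
by rewrite -!leNgt => a b; apply: npx; apply/pboxP; rewrite a b andbT.
Qed.

(** [a] is the density, [b] the flux and [c] the source. All weak formulations are brought to this
    shape. *)
Definition balance_integrand (a b c f f1 f2 : R * R -> R) (x : R * R) : R :=
  f1 x * a x + f2 x * b x + f x * c x.

(** One sequence of test functions serves all coefficients at once; M (|a| + |b| + |c|) on a fixed
    box dominates. *)
Lemma C1_test_limit f f1 f2 (T Y : R) : 0 < T -> 0 < Y -> C1_test f f1 f2 T Y ->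
  exists F : nat -> R * R -> R, [/\ forall N, test_fun (F N),
    (forall x : R * R, 0 <= x.1 -> 0 <= f x) -> forall N x, 0 <= x.1 -> 0 <= F N x &
    forall a b c r0, L1box a -> L1box b -> L1box c -> L1seg r0 ->
    [/\ forall N, (leb2 R).-integrable ohp
          (EFin \o balance_integrand a b c (F N) (d_tau (F N)) (d_y (F N))),
        forall N, (leb R).-integrable setT (EFin \o (fun y => F N (0, y) * r0 y)),
     \int[leb2 R]_(x in ohp) balance_integrand a b c (F N) (d_tau (F N)) (d_y (F N)) x
       @[N --> \oo] --> \int[leb2 R]_(x in ohp) balance_integrand a b c f f1 f2 x &
     \int[leb R]_y (F N (0, y) * r0 y) @[N --> \oo] --> \int[leb R]_y (f (0, y) * r0 y)]].
Proof.
move=> T0 Y0 tf.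
have [F [M [sF F0 FM Fz Fc]]] := C1_test_approximation T0 Y0 tf.
exists F; split=> //; first by move=> N; case: (sF N).
move=> a b c r0 ia ib ic ir.
pose T' := T + 1; pose Y' := Y + 1.
have FC N x : C1_at (F N) (d_tau (F N)) (d_y (F N)) x.
  by apply: smooth_alg_C1_at; case: (sF N).
have mp := measurable_pbox T' Y'.
have FI N : (leb2 R).-integrable (pbox T' Y')
    (EFin \o balance_integrand a b c (F N) (d_tau (F N)) (d_y (F N))).
  have [m0 m1 m2] := C1_measurable (FC N).
  rewrite /balance_integrand; apply: integrable_add => //; first apply: integrable_add => //.
  - apply: (integrable_mulb mp (M := M)) => //; first exact: measurable_funTS.
    by move=> x /pboxP[/andP[/ltW x0 _] _]; case: (FM N x x0).
  - apply: (integrable_mulb mp (M := M)) => //; first exact: measurable_funTS.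
    by move=> x /pboxP[/andP[/ltW x0 _] _]; case: (FM N x x0).
  - apply: (integrable_mulb mp (M := M)) => //; first exact: measurable_funTS.
    by move=> x /pboxP[/andP[/ltW x0 _] _]; case: (FM N x x0).
have FZ N x : ohp x -> T' < x.1 \/ Y' < `|x.2| ->
    balance_integrand a b c (F N) (d_tau (F N)) (d_y (F N)) x = 0.
  move=> /ltW x0 H; rewrite /balance_integrand.
  by have [-> -> ->] := Fz N x x0 H; rewrite !mul0r !addr0.
have m0 N : measurable_fun `[- Y', Y'] (fun y : R => F N (0, y)).
  apply: measurable_funTS; apply: continuous_measurable_fun => y.
  by apply: continuous_section2; case: (FC N (0, y)).
have I0 N : (leb R).-integrable `[- Y', Y'] (EFin \o (fun y => F N (0, y) * r0 y)).
  apply: (@integrable_mulb _ _ R (leb R) `[- Y', Y']%classic (measurable_itv _)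
    r0 (fun y => F N (0, y)) M).
  - exact: m0.
  - by move=> y _; case: (FM N (0, y) (lexx _)).
  - exact: ir.
have Z0 N y : Y' < `|y| -> F N (0, y) * r0 y = 0.
  by move=> Yy; have [|-> _ _] := Fz N (0, y) (lexx _); [right|rewrite mul0r].
split.
- by move=> N; apply: integrable_pbox (FZ N) (FI N).
- by move=> N; apply: integrable_seg (Z0 N) (I0 N).
- rewrite (_ : (fun N => _) = fun N => \int[leb2 R]_(x in pbox T' Y')
     balance_integrand a b c (F N) (d_tau (F N)) (d_y (F N)) x); last first.
    by apply/funext => N; apply: Rintegral_pbox; exact: FZ.
  rewrite (@Rintegral_pbox _ T' Y'); last first.
    move=> x ox H; rewrite /balance_integrand.
    have [_ /(_ x)[]] := tf; last by move=> -> -> ->; rewrite !mul0r !addr0.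
    by case: H => H; [left|right]; move: H; rewrite /T' /Y'; lra.
  have [||||//] := @Rdominated_cvg _ _ _ (leb2 R) (pbox T' Y') mp
    (fun N => balance_integrand a b c (F N) (d_tau (F N)) (d_y (F N)))
    (balance_integrand a b c f f1 f2)
    (fun x => M * `|a x| + M * `|b x| + M * `|c x|).
  + by move=> N; have /measurable_int/measurable_EFinP := FI N.
  + move=> x /pboxP[/andP[/ltW x0 _] _]; have [c0 c1 c2] := Fc x x0.
    apply: cvgD; first apply: cvgD.
    * by apply: cvgM => //; exact: cvg_cst.
    * by apply: cvgM => //; exact: cvg_cst.
    * by apply: cvgM => //; exact: cvg_cst.
  + apply: integrable_add => //; first apply: integrable_add => //.
    * exact: (integrableZl mp M (integrable_norm (ia T' Y'))).
    * exact: (integrableZl mp M (integrable_norm (ib T' Y'))).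
    * exact: (integrableZl mp M (integrable_norm (ic T' Y'))).
  + move=> N x /pboxP[/andP[/ltW x0 _] _]; have [b0 b1 b2] := FM N x x0.
    apply: le_trans (ler_normD _ _) _; apply: lerD; last by rewrite normrM ler_wpM2r.
    by apply: le_trans (ler_normD _ _) _; apply: lerD; rewrite normrM ler_wpM2r.
- rewrite (_ : (fun N => _) = fun N => \int[leb R]_(y in `[- Y', Y']) (F N (0, y) * r0 y)).
    rewrite (@Rintegral_seg _ Y'); last first.
      move=> y Yy; have [_ /(_ (0, y))[]] := tf; last by move=> -> _ _; rewrite mul0r.
      by right; move: Yy; rewrite /Y' /=; lra.
    have [|||||//] := @Rdominated_cvg _ _ _ (leb R) `[- Y', Y'] _
      (fun N y => F N (0, y) * r0 y) (fun y => f (0, y) * r0 y) (fun y => M * `|r0 y|).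
    + exact: measurable_itv.
    + by move=> N; have /measurable_int/measurable_EFinP := I0 N.
    + move=> y _; apply: cvgM; last exact: cvg_cst.
      by have [] := Fc (0, y) (lexx _).
    + exact: (integrableZl _ M (integrable_norm (ir Y'))).
    + by move=> N y _; rewrite normrM ler_wpM2r//; case: (FM N (0, y) (lexx _)).
  by apply/funext => N; apply: Rintegral_seg; exact: Z0.
Qed.

End WeakBalance.

Section Extension.
Context {R : realType}.
Local Notation R2 := (measurableTypeR R * measurableTypeR R)%type.
Local Notation ohp := (@open_half_plane R).

(** Weak form of a_t + b_y = c with a(0) = r0. *)
Definition weak_balance (a b c : R * R -> R) (r0 : R -> R) : Prop :=
  forall f f1 f2 (T Y : R), 0 < T -> 0 < Y -> C1_test f f1 f2 T Y ->
    \int[leb2 R]_(x in ohp) balance_integrand a b c f f1 f2 x =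
    - \int[leb R]_y (f (0, y) * r0 y).

Lemma weak_balance_test_fun a b c r0 : L1box a -> L1box b -> L1box c -> L1seg r0 ->
  (forall F, test_fun F ->
    (leb2 R).-integrable ohp (EFin \o balance_integrand a b c F (d_tau F) (d_y F)) ->
    (leb R).-integrable setT (EFin \o (fun y => F (0, y) * r0 y)) ->
    \int[leb2 R]_(x in ohp) balance_integrand a b c F (d_tau F) (d_y F) x =
    - \int[leb R]_y (F (0, y) * r0 y)) ->
  weak_balance a b c r0.
Proof.
move=> ia ib ic ir H f f1 f2 T Y T0 Y0 tf.
have [F [tF _ L]] := C1_test_limit T0 Y0 tf.
have [I1 I2 L1 /cvgN L2] := L _ _ _ _ ia ib ic ir.
rewrite (_ : (fun N => _) = fun N => - \int[leb R]_y (F N (0, y) * r0 y)) in L1.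
  by apply: cvg_unique L1 L2.
by apply/funext => N; exact: H.
Qed.

(** Here it matters that the approximation preserves signs: the inequality is available for
    nonnegative smooth functions only. *)
Lemma weak_ineq_test_fun a b c r0 : L1box a -> L1box b -> L1box c -> L1seg r0 ->
  (forall F, test_fun F -> (forall x : R * R, 0 <= x.1 -> 0 <= F x) ->
    (leb2 R).-integrable ohp (EFin \o balance_integrand a b c F (d_tau F) (d_y F)) ->
    (leb R).-integrable setT (EFin \o (fun y => F (0, y) * r0 y)) ->
    \int[leb2 R]_(x in ohp) balance_integrand a b c F (d_tau F) (d_y F) x <=
    \int[leb R]_y (F (0, y) * r0 y)) ->
  forall f f1 f2 (T Y : R), 0 < T -> 0 < Y -> C1_test f f1 f2 T Y ->
    (forall x : R * R, 0 <= x.1 -> 0 <= f x) ->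
    \int[leb2 R]_(x in ohp) balance_integrand a b c f f1 f2 x <=
    \int[leb R]_y (f (0, y) * r0 y).
Proof.
move=> ia ib ic ir H f f1 f2 T Y T0 Y0 tf f0.
have [F [tF Fge0 L]] := C1_test_limit T0 Y0 tf.
have [I1 I2 L1 L2] := L _ _ _ _ ia ib ic ir.
rewrite -(cvg_lim _ L1)// -(cvg_lim _ L2)//; apply: ler_lim.
- by apply/cvg_ex; eexists; exact: L1.
- by apply/cvg_ex; eexists; exact: L2.
- by near=> N; apply: H => //; exact: Fge0.
Unshelve. all: by end_near. Qed.

Lemma leb_seg (Y : R) : 0 <= Y -> leb R `[- Y, Y]%classic = (2 * Y)%:E.
Proof.
move=> Y0; transitivity (lebesgue_measure `[(- Y)%R, Y]%classic); first by [].
rewrite lebesgue_measure_itv/= lte_fin; case: ltP => [_|YY].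
  by rewrite -EFinB; congr EFin; ring.
by congr EFin; lra.
Qed.

Lemma FTC_segment (F f : R -> R) (a b : R) : a < b ->
  (forall x : R, a <= x <= b -> is_derive x 1 F (f x)) ->
  {within `[a, b], continuous f} ->
  (\int[leb R]_(x in `[a, b]) (f x)%:E = (F b - F a)%:E)%E.
Proof.
move=> ab D cf; rewrite EFinB; apply: continuous_FTC2 => //.
- have cF (x : R) : a <= x <= b -> {for x, continuous F}.
    by move=> /D[d _]; apply: differentiable_continuous; exact/derivable1_diffP.
  split.
  + by move=> x; rewrite in_itv/= => /andP[/ltW ax /ltW xb]; case: (D x); rewrite ?ax.
  + by apply: cvg_at_right_filter; apply: cF; rewrite lexx ltW.
  + by apply: cvg_at_left_filter; apply: cF; rewrite lexx ltW.
- move=> x; rewrite in_itv/= => /andP[/ltW ax /ltW xb]; rewrite derive1E.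
  by case: (D x); rewrite ?ax.
Qed.

Lemma C1_test_bounded f f1 f2 (T Y : R) : C1_test f f1 f2 T Y ->
  [/\ L1box f, L1box f1 & L1box f2].
Proof.
move=> [C _]; have [m0 m1 m2] := C1_measurable C.
have B (k : R * R -> R) : (forall x : R * R, {for x, continuous k}) ->
    forall T' Y', exists M, forall x, pbox T' Y' x -> `|k x| <= M.
  move=> ck T' Y'; have [M _ HM] := continuous_at_compact_bounded
    (@box_compact R T' Y') (fun x _ => ck x).
  exists M => x /pboxP[/andP[/ltW a b] c]; apply: HM; apply/boxP.
  by rewrite a b -ler_norml c.
split; apply: L1box_bounded; try exact: measurable_funTS;
  by apply: B => x; case: (C x).
Qed.

(** Fubini and the fundamental theorem of calculus. Together with [weak_balance_space] this is the
    trivial balance through which functions of the reference state alone enter a sum of balances, as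
    multipliers of the constant 1. *)
Lemma weak_balance_time : weak_balance (fun=> 1) (fun=> 0) (fun=> 0) (fun=> 1).
Proof.
move=> f f1 f2 T Y T0 Y0 tf; have [_ i1 _] := C1_test_bounded tf.
have [C Z] := tf.
have z1 x : ohp x -> T < x.1 \/ Y < `|x.2| -> f1 x = 0.
  by move=> _ H; have [|_ -> _ //] := Z x; case: H => /ltW; [left|right].
have i1o := integrable_pbox z1 (i1 T Y).
rewrite (_ : \int[leb2 R]_(x in ohp) _ = \int[leb2 R]_(x in ohp) f1 x); last first.
  by apply: eq_Rintegral => x _; rewrite /balance_integrand mulr1 !mulr0 !addr0.
rewrite /Rintegral integral_mkcond.
have ik : (leb2 R).-integrable setT ((EFin \o f1) \_ ohp).
  by apply: (integrable_mkcond _ measurable_ohp).1.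
rewrite -(integral21_prod_meas1 ik) /fubini_G.
rewrite (_ : (fun y => _) = fun y => (- (f (0, y) * 1))%:E).
  rewrite -fineN; congr fine; rewrite -integralN.
    by apply: eq_integral => y _; rewrite EFinN.
  have I : (leb R).-integrable setT (EFin \o (fun y => f (0, y) * 1)).
    apply: (@integrable_seg _ (fun y => f (0, y) * 1) Y).
      by move=> y Yy; have [|-> _ _] := Z (0, y); [right; exact: ltW|rewrite mul0r].
    apply: measurable_bounded_integrable; first exact: measurable_itv.
    - by rewrite leb_seg ?ltry// ltW.
    - apply: measurable_funTS; apply: continuous_measurable_fun => y.
      apply: cvgM; last exact: cvg_cst.
      by apply: continuous_section2; case: (C (0, y)).
    have [M _ HM] := continuous_at_compact_bounded
      (@box_compact R 1 Y) (fun x _ => let: And5 _ _ H _ _ := C x in H).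
    exists M; split; first exact: num_real.
    move=> z Mz y; rewrite /= in_itv/= => yY; rewrite mulr1.
    apply: le_trans (ltW Mz); apply: HM; apply/boxP => /=.
    by rewrite lexx ler01.
  exact: integrable_add_def I.
apply/funext => y; rewrite mulr1.
transitivity (\int[leb R]_(t in `]0%R, T]) (f1 (t, y))%:E)%E.
  rewrite [RHS]integral_mkcond; apply: eq_integral => t _; rewrite !patchE /=.
  have [t0|t0] := boolP (t \in `]0, T]%classic).
    rewrite ifT// inE /open_half_plane/=.
    by move: t0; rewrite inE/= in_itv/= => /andP[].
  case: ifPn => //; rewrite inE /open_half_plane/= => tp.
  rewrite z1//; left => /=; rewrite ltNge; apply/negP => tT.
  by move: t0; rewrite notin_setE/= in_itv/= tp tT.
rewrite integral_itv_obnd_cbnd; last first.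
  apply: measurable_funTS; apply/measurable_EFinP; apply: continuous_measurable_fun => t.
  by apply: continuous_section1; case: (C (t, y)).
have D t : is_derive (t : R) 1 (fun t => f (t, y)) (f1 (t, y)).
  by apply/is_derive_section1; case: (C (t, y)).
apply: etrans (FTC_segment T0 (fun t _ => D t) _) _.
- by apply: continuous_subspaceT => t; apply: continuous_section1; case: (C (t, y)).
- by have [|-> _ _] := Z (T, y); [left|rewrite sub0r].
Qed.

Lemma weak_balance_space : weak_balance (fun=> 0) (fun=> 1) (fun=> 0) (fun=> 0).
Proof.
move=> f f1 f2 T Y T0 Y0 tf; have [_ _ i2] := C1_test_bounded tf.
have [C Z] := tf.
have z2 x : ohp x -> T < x.1 \/ Y < `|x.2| -> f2 x = 0.
  by move=> _ H; have [|_ _ -> //] := Z x; case: H => /ltW; [left|right].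
have i2o := integrable_pbox z2 (i2 T Y).
rewrite (_ : \int[leb2 R]_(x in ohp) _ = \int[leb2 R]_(x in ohp) f2 x); last first.
  by apply: eq_Rintegral => x _; rewrite /balance_integrand mulr1 !mulr0 addr0 add0r.
rewrite (_ : \int[leb R]_y _ = 0); last first.
  by rewrite /Rintegral integral0_eq// => y _; rewrite mulr0.
rewrite oppr0 /Rintegral integral_mkcond.
have ik : (leb2 R).-integrable setT ((EFin \o f2) \_ ohp).
  by apply: (integrable_mkcond _ measurable_ohp).1.
rewrite -(integral12_prod_meas1 ik) /fubini_F integral0_eq// => t _.
have [t0|t0] := ltP 0 t; last first.
  by rewrite integral0_eq// => y _; rewrite patchE ifN// notin_setE /open_half_plane/= => t1; move: t0; rewrite leNgt t1.
transitivity (\int[leb R]_(y in `[(- Y)%R, Y]) (f2 (t, y))%:E)%E.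
  rewrite [RHS]integral_mkcond; apply: eq_integral => y _; rewrite !patchE /=.
  rewrite ifT ?inE//; case: ifPn => // yI.
  have : ~ `[- Y, Y]%classic y by move: yI; rewrite notin_setE.
  rewrite /= in_itv/= => /negP; rewrite -ler_norml -ltNge => Yy.
  by rewrite z2//; right.
have D y : is_derive (y : R) 1 (fun y => f (t, y)) (f2 (t, y)).
  by apply/is_derive_section2; case: (C (t, y)).
have YY : - Y < Y by rewrite gtrN.
apply: etrans (FTC_segment YY (fun y _ => D y) _) _.
- by apply: continuous_subspaceT => y; apply: continuous_section2; case: (C (t, y)).
- have [|-> _ _] := Z (t, Y); first by right; rewrite /= ger0_norm// ltW.
  have [|-> _ _] := Z (t, - Y); first by right; rewrite /= normrN ger0_norm// ltW.
  by rewrite subr0.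
Qed.

End Extension.

(** * Initial traces *)

Section Cutoffs.
Context {R : realType}.
Implicit Types s t : R.

Definition ramp s : R := Num.max s 0.

Lemma ramp_ge0 s : 0 <= ramp s. Proof. by rewrite /ramp le_max lexx orbT. Qed.

Lemma ramp_eq0 s : s <= 0 -> ramp s = 0.
Proof. by move=> s0; rewrite /ramp max_r. Qed.

Lemma ramp_id s : 0 <= s -> ramp s = s.
Proof. by move=> s0; rewrite /ramp max_l. Qed.

Lemma ramp_le s (c : R) : 0 <= c -> s <= c -> ramp s <= c.
Proof. by move=> c0 sc; rewrite /ramp ge_max sc. Qed.

Lemma continuous_ramp : continuous ramp.
Proof. by move=> s; apply: continuous_max; [exact: cvg_id|exact: cvg_cst]. Qed.

Definition ramp2 s : R := ramp s ^+ 2.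

Definition dramp2 s : R := 2 * ramp s.

Lemma continuous_dramp2 : continuous dramp2.
Proof. by move=> s; apply: cvgM; [exact: cvg_cst|exact: continuous_ramp]. Qed.

Lemma is_derive_ramp2 s : is_derive s 1 ramp2 (dramp2 s).
Proof.
have [s0|s0|->] := ltgtP s 0.
- have E : \forall z \near s, cst 0 z = ramp2 z.
    near=> z; rewrite /ramp2 ramp_eq0 ?expr0n//; apply/ltW; near: z; exact: lt_nbhsl.
  rewrite /dramp2 ramp_eq0 ?ltW// mulr0.
  exact: near_eq_is_derive E (is_derive_cst _ _ _).
- have E : \forall z \near s, z * z = ramp2 z.
    near=> z; rewrite /ramp2 ramp_id ?expr2//; apply/ltW; near: z; exact: lt_nbhsr.
  have D := is_derive_mul (is_derive_id s 1) (is_derive_id s 1).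
  apply: is_derive_eq (near_eq_is_derive E D) _.
  by rewrite /dramp2 ramp_id ?ltW// mulr1 mul1r mulr_natl mulr2n.
- rewrite /dramp2 ramp_eq0// mulr0; apply: (@is_derive0_le_sqr _ _ 1) => z.
  rewrite mul1r /ramp2 normrX; have [z0|/ltW z0] := leP 0 z.
    by rewrite ramp_id// real_normK ?num_real.
  by rewrite ramp_eq0// normr0 expr0n/= sqr_ge0.
Unshelve. all: by end_near. Qed.

(* Vanishes for t <= e, equals 1 for 2 e <= t. *)
Definition cutoff (e t : R) : R := 1 - ramp2 (1 - ramp2 (t / e - 1)).

Definition dcutoff (e t : R) : R :=
  dramp2 (1 - ramp2 (t / e - 1)) * (dramp2 (t / e - 1) / e).

Lemma is_derive_cutoff e t : is_derive t 1 (cutoff e) (dcutoff e t).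
Proof.
have Da : is_derive t 1 (fun t : R => t / e) e^-1.
  by apply: is_derive_eq (is_derive_mul (is_derive_id t 1) (is_derive_cst e^-1 t 1)) _;
    rewrite mulr0 mul1r addr0.
have D0 : is_derive t 1 (fun t : R => t / e - 1) e^-1.
  exact: (is_derive_eq (is_deriveB Da (is_derive_cst (1 : R) t 1)) (subr0 _)).
have D1 := @is_derive_chain _ R ramp2 (fun t => t / e - 1) t 1 _ _ (is_derive_ramp2 _) D0.
have D2 : is_derive t 1 (fun t => 1 - ramp2 (t / e - 1)) (- (dramp2 (t / e - 1) / e)).
  exact: (is_derive_eq (is_deriveB (is_derive_cst (1 : R) t 1) D1) (sub0r _)).
have D3 := @is_derive_chain _ R ramp2 (fun t => 1 - ramp2 (t / e - 1)) t 1 _ _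
  (is_derive_ramp2 _) D2.
apply: is_derive_eq (is_deriveB (is_derive_cst (1 : R) t 1) D3) _.
by rewrite sub0r mulrN opprK.
Qed.

Lemma continuous_dcutoff e : continuous (dcutoff e).
Proof.
move=> t.
have c0 : {for t, continuous (fun t => t / e - 1)}.
  by apply: cvgB; [apply: cvgM; [exact: cvg_id|exact: cvg_cst]|exact: cvg_cst].
have c1 : {for t, continuous (fun t => 1 - ramp2 (t / e - 1))}.
  apply: cvgB; first exact: cvg_cst.
  apply: (@continuous_comp _ _ _ (fun t => t / e - 1) ramp2) => //.
  apply: differentiable_continuous; apply/derivable1_diffP.
  by case: (is_derive_ramp2 (t / e - 1)).
apply: cvgM.
  exact: (@continuous_comp _ _ _ _ dramp2 _ c1 (@continuous_dramp2 _)).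
apply: cvgM; last exact: cvg_cst.
exact: (@continuous_comp _ _ _ _ dramp2 _ c0 (@continuous_dramp2 _)).
Qed.

Section CutoffValues.
Variables (e t : R).
Hypothesis e0 : 0 < e.

Lemma cutoff_small : t <= e -> cutoff e t = 0 /\ dcutoff e t = 0.
Proof.
move=> te; have H : ramp (t / e - 1) = 0.
  by apply: ramp_eq0; rewrite subr_le0 ler_pdivrMr// mul1r.
rewrite /cutoff /dcutoff /dramp2 /ramp2 H expr0n/= subr0 ramp_id ?ler01//.
by rewrite expr1n subrr !mulr0 !mul0r mulr0.
Qed.

Lemma cutoff_large : 2 * e <= t -> cutoff e t = 1 /\ dcutoff e t = 0.
Proof.
move=> te; have H1 : 1 <= t / e - 1.
  by rewrite lerBrDl ler_pdivlMr.
have H : ramp (1 - ramp2 (t / e - 1)) = 0.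
  rewrite ramp_eq0// subr_le0 /ramp2 ramp_id ?(le_trans _ H1)//.
  by rewrite exprn_ege1.
by rewrite /cutoff /dcutoff /dramp2 [ramp2 (1 - _)]/ramp2 H expr0n/= subr0 mulr0 mul0r.
Qed.

Lemma cutoff_itv : 0 <= cutoff e t <= 1.
Proof.
have a := ramp_ge0 (1 - ramp2 (t / e - 1)).
have b : ramp (1 - ramp2 (t / e - 1)) <= 1.
  by apply: ramp_le => //; rewrite gerBl /ramp2 sqr_ge0.
by rewrite /cutoff {1 3}/ramp2 subr_ge0 gerBl sqr_ge0 andbT exprn_ile1.
Qed.

(** Where the product does not vanish, each factor [dramp2] is at most 2. On a support of length e
    this keeps the integral in time bounded independently of e. *)
Lemma dcutoff_itv : 0 <= dcutoff e t <= 4 / e.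
Proof.
have a := ramp_ge0 (1 - ramp2 (t / e - 1)).
have b : ramp (1 - ramp2 (t / e - 1)) <= 1.
  by apply: ramp_le => //; rewrite gerBl /ramp2 sqr_ge0.
have c := ramp_ge0 (t / e - 1).
apply/andP; split; first by rewrite /dcutoff /dramp2 !mulr_ge0// invr_ge0 ltW.
have [te|te] := leP (2 * e) t.
  by rewrite (cutoff_large te).2 divr_ge0// ltW.
have f : ramp (t / e - 1) <= 1.
  by apply: ramp_le => //; rewrite lerBlDl ler_pdivrMr// ltW.
rewrite /dcutoff /dramp2 !mulrA ler_wpM2r ?invr_ge0 ?(ltW e0)//.
apply: le_trans (_ : 2 * 1 * 2 * 1 <= _); last by rewrite !mulr1 -natrM.
by rewrite !ler_pM// ?mulr_ge0.
Qed.

End CutoffValues.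

Lemma cutoff_cvg (t : R) : 0 < t -> cutoff n.+1%:R^-1 t @[n --> \oo] --> (1 : R).
Proof.
move=> t0; apply: cvg_near_cst; near=> n.
have n0 : 0 < n.+1%:R^-1 :> R by rewrite invr_gt0.
suff H : 2 * n.+1%:R^-1 <= t by have [] := cutoff_large n0 H.
rewrite -ler_pdivlMl//; apply: ltW; near: n.
have t2 : 0 < 2^-1 * t by rewrite mulr_gt0// invr_gt0.
exact: (near_infty_natSinv_lt (PosNum t2)).
Unshelve. all: by end_near. Qed.

End Cutoffs.

Section InitialTrace.
Context {R : realType}.
Local Notation R2 := (measurableTypeR R * measurableTypeR R)%type.
Local Notation ohp := (@open_half_plane R).

Let eps (n : nat) : R := n.+1%:R^-1.
Let eps0 n : 0 < eps n. Proof. by rewrite /eps invr_gt0. Qed.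

Lemma C1_at_time (k dk : R -> R) (x : R * R) :
  is_derive x.1 1 k (dk x.1) -> continuous dk ->
  C1_at (fun z => k z.1) (fun z => dk z.1) (fun=> 0) x.
Proof.
move=> K dkc; have := C1_at_comp (C1_at_fst x) K (dkc _).
apply: near_eq_C1_at; near=> z; by rewrite mulr1 mulr0.
Unshelve. all: by end_near. Qed.

(** Tube argument over a compact segment: joint continuity along tau = 0 gives one time span valid
    for all y. *)
Lemma small_time_uniform (g : R * R -> R) (Y e : R) : 0 < e ->
  (forall x : R * R, {for x, continuous g}) ->
  exists2 s : R, 0 < s & forall t y, 0 <= t <= s -> - Y <= y <= Y -> `|g (t, y) - g (0, y)| <= e.
Proof.
move=> e0 cg.
have : \forall t \near (0 : R), `[- Y, Y]%classic `<=` [set y | `|g (t, y) - g (0, y)| <= e].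
  have nc := (compact_near_coveringP _).1 (@segment_compact R (- Y) Y).
  apply: (nc R (nbhs (0 : R)) (fun t y => `|g (t, y) - g (0, y)| <= e)) => y _.
  have c : {for (y, 0), continuous (fun z : R * R => g (z.2, z.1) - g (0, z.1))}.
    apply: cvgB.
      apply: (@continuous_comp _ _ _ (fun z : R * R => (z.2, z.1)) g) => //.
      exact: (cvg_pair cvg_snd cvg_fst).
    apply: (@continuous_comp _ _ _ (fun z : R * R => (0, z.1)) g) => //.
    exact: (cvg_pair (cvg_cst _) cvg_fst).
  have : \forall z \near ((y, 0) : R * R), `|g (z.2, z.1) - g (0, z.1)| <= e.
    move/cvgrPdist_le : c => /(_ e e0) /=; rewrite subrr.
    by apply: filterS => z; rewrite sub0r normrN.
  by case=> -[A B] [/= A0 B0] AB; exists (A, B) => //.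
move=> /nbhs_ballP[s /= s0 sP]; exists (s / 2); first by rewrite divr_gt0.
move=> t y /andP[t0 ts] yY; apply: (sP t); last by rewrite /= in_itv.
rewrite /ball/= sub0r normrN ger0_norm//; apply: le_lt_trans ts _.
by rewrite gtr_pMr// invf_lt1// ltr1n.
Qed.

Lemma Rintegral_rect_le (F : R * R -> R) (a b Y C : R) : a <= b -> 0 <= Y -> 0 <= C ->
  (leb2 R).-integrable (`[a, b]%classic `*` `[- Y, Y]%classic) (EFin \o F) ->
  (forall x : R * R, a <= x.1 <= b -> - Y <= x.2 <= Y -> `|F x| <= C) ->
  `|\int[leb2 R]_(x in `[a, b]%classic `*` `[- Y, Y]%classic) F x| <= C * ((b - a) * (2 * Y)).
Proof.
move=> ab Y0 C0 iF FC; set S := _ `*` _ in iF *.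
have mS : measurable (S : set R2) by apply: measurableX; exact: measurable_itv.
have vS : leb2 R S = ((b - a) * (2 * Y))%:E.
  have -> : leb2 R S = (lebesgue_measure `[a, b]%classic * leb R `[(- Y)%R, Y]%classic)%E.
    by apply: product_measure1E; exact: measurable_itv.
  rewrite leb_seg//; suff -> : lebesgue_measure `[a, b]%classic = (b - a)%:E by rewrite -EFinM.
  rewrite lebesgue_measure_itv/= lte_fin; case: ltP => [_|ba]; first by rewrite -EFinB.
  by congr EFin; lra.
apply: le_trans (le_normr_Rintegral _ iF) _ => //.
apply: (@le_trans _ _ (\int[leb2 R]_(x in S) C)); last first.
  by rewrite Rintegral_cst// vS.
apply: le_Rintegral => //.
- exact: integrable_norm.
- by apply: (@measurable_bounded_integrable _ _ _ (leb2 R)) => //;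
    [rewrite vS ltry|exists C; split; [exact: num_real|move=> z Cz x _ /=;
      rewrite ger0_norm//; exact: ltW]].
- by move=> x [/=]; rewrite !in_itv/=; exact: FC.
Qed.

Lemma continuous_box_bounded (G : R * R -> R) : (forall x : R * R, {for x, continuous G}) ->
  forall T Y, exists M, forall x, pbox T Y x -> `|G x| <= M.
Proof.
move=> cG T Y; have [M _ HM] := continuous_at_compact_bounded
  (@box_compact R T Y) (fun x _ => cG x).
exists M => x /pboxP[/andP[/ltW a b] c]; apply: HM; apply/boxP.
by rewrite a b -ler_norml c.
Qed.

Lemma L1box_continuous_mul (G f : R * R -> R) : (forall x : R * R, {for x, continuous G}) ->
  L1box f -> L1box (fun x => G x * f x).
Proof.
move=> cG; apply: L1box_mulb; last exact: continuous_box_bounded.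
by apply: measurable_funTS; apply: continuous_at_measurable => //; exact: openT.
Qed.

(** For a profile [k] depending on y alone, (1 - cutoff) k is an admissible test function, and the
    balance itself identifies the limit. The slice g(0, .) is only continuous and cannot serve as
    profile. The slice at a small positive time [s] can, and the error is small because [a] is
    bounded and [dcutoff] has a bounded integral. *)
Lemma initial_trace (a b c : R * R -> R) (r0 : R -> R) (g gy : R * R -> R) (Y M : R) :
  0 < Y -> L1box a -> L1box b -> L1box c -> L1seg r0 -> weak_balance a b c r0 ->
  (forall x, pbox 2 Y x -> `|a x| <= M) ->
  (forall x : R * R, {for x, continuous g}) ->
  (forall s y : R, 0 < s -> is_derive y 1 (fun z => g (s, z)) (gy (s, y)) /\
                      {for y, continuous (fun z => gy (s, z))}) ->
  (forall s y : R, 0 <= s -> Y <= `|y| -> g (s, y) = 0 /\ gy (s, y) = 0) ->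
  \int[leb2 R]_(x in ohp) (dcutoff (eps n) x.1 * g x * a x) @[n --> \oo] -->
    \int[leb R]_y (g (0, y) * r0 y).
Proof.
move=> Y0 ia ib ic ir W aM cg Dg Zg.
have M0 : 0 <= M.
  apply: le_trans (aM (1, 0) _); first exact: normr_ge0.
  by apply/pboxP; rewrite /= normr0 ler1n ltW// ltr01.
have mo := @measurable_ohp R.
have mp := @measurable_pbox R 2 Y.
have cdc n (x : R * R) : {for x, continuous (fun x : R * R => dcutoff (eps n) x.1)}.
  apply: (@continuous_comp _ _ _ fst (dcutoff (eps n))); first exact: cvg_fst.
  exact: continuous_dcutoff.
have eps1 n : eps n <= 1 by rewrite /eps invf_le1// ler1n.
have supp n (k : R * R -> R) :
    (forall x : R * R, 0 <= x.1 -> Y < `|x.2| -> k x = 0) ->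
    forall x : R * R, ohp x -> 2 < x.1 \/ Y < `|x.2| -> dcutoff (eps n) x.1 * k x * a x = 0.
  move=> k0 x ox [x2|/(k0 _ (ltW ox)) ->]; last by rewrite mulr0 mul0r.
  rewrite (cutoff_large (eps0 n) _).2 ?mul0r//; apply: ltW; apply: le_lt_trans x2.
  by rewrite ler_piMr// eps1.
have int n (k : R * R -> R) : (forall x : R * R, {for x, continuous k}) ->
    (forall x : R * R, 0 <= x.1 -> Y < `|x.2| -> k x = 0) ->
    (leb2 R).-integrable ohp (EFin \o (fun x => dcutoff (eps n) x.1 * k x * a x)).
  move=> ck k0; apply: integrable_pbox (supp n k k0) _.
  apply: (L1box_continuous_mul (G := fun x => dcutoff (eps n) x.1 * k x)) => // x.
  by apply: cvgM; [exact: cdc|exact: ck].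
have profile (k dk : R -> R) : (forall y : R, is_derive y 1 k (dk y)) -> continuous dk ->
    (forall y, Y <= `|y| -> k y = 0 /\ dk y = 0) ->
    \int[leb2 R]_(x in ohp) (dcutoff (eps n) x.1 * k x.2 * a x) @[n --> \oo] -->
      \int[leb R]_y (k y * r0 y).
  move=> Dk cdk Zk.
  have ck : continuous k.
    by move=> y; apply: differentiable_continuous; apply/derivable1_diffP; case: (Dk y).
  have ck2 (l : R -> R) (x : R * R) : continuous l -> {for x, continuous (fun x => l x.2)}.
    move=> cl; apply: (@continuous_comp _ _ _ snd l); first exact: cvg_snd.
    exact: cl.
  (* Equal to [k] at tau = 0 and to 0 from time 2 eps on. *)
  pose f n x := (1 - cutoff (eps n) x.1) * k x.2.
  pose f1 n x := - dcutoff (eps n) x.1 * k x.2.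
  pose f2 n x := (1 - cutoff (eps n) x.1) * dk x.2.
  have tf n : C1_test (f n) (f1 n) (f2 n) 2 Y.
    split=> [x|x]; last first.
      case=> [x2|/Zk[k0 dk0]]; last by rewrite /f /f1 /f2 k0 dk0 !mulr0.
      have [e1 e2] : cutoff (eps n) x.1 = 1 /\ dcutoff (eps n) x.1 = 0.
        by apply: cutoff_large => //; apply: le_trans x2; rewrite ler_piMr.
      by rewrite /f /f1 /f2 e1 e2 subrr oppr0 !mul0r.
    have D : is_derive x.1 1 (fun t => 1 - cutoff (eps n) t) (- dcutoff (eps n) x.1).
      exact: (is_derive_eq (is_deriveB (is_derive_cst (1 : R) x.1 1)
        (is_derive_cutoff (eps n) x.1)) (sub0r _)).
    have C1 : C1_at (fun z => 1 - cutoff (eps n) z.1) (fun z => - dcutoff (eps n) z.1)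
        (fun=> 0) x.
      apply: (C1_at_time (dk := fun t => - dcutoff (eps n) t)) => //.
      by move=> t; apply: cvgN; exact: continuous_dcutoff.
    have C2 : C1_at (fun z : R * R => k z.2) (fun=> 0) (fun z => dk z.2) x.
      have := C1_at_comp (C1_at_snd x) (Dk _) (cdk _).
      by apply: near_eq_C1_at; near=> z; rewrite mulr1 mulr0.
    have := C1_at_mul C1 C2; apply: near_eq_C1_at; near=> z.
    by rewrite /f /f1 /f2 mulr0 addr0 mul0r add0r.
  have ik : L1box (fun x => dk x.2 * b x + k x.2 * c x).
    by apply: L1box_add; apply: (L1box_continuous_mul (G := fun x => _ x.2)) => // x;
      exact: ck2.
  have ck0 (x : R * R) : 0 <= x.1 -> Y < `|x.2| -> k x.2 = 0.
    by move=> _ /ltW/Zk[].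
  (* Flux and source terms. They disappear in the limit, because they live on a time interval that
     shrinks to 0. *)
  pose h n x := (1 - cutoff (eps n) x.1) * (dk x.2 * b x + k x.2 * c x).
  have hz n x : ohp x -> 2 < x.1 \/ Y < `|x.2| -> h n x = 0.
    move=> ox [x2|/ltW/Zk[k0 dk0]]; last by rewrite /h k0 dk0 !mul0r addr0 mulr0.
    rewrite /h (cutoff_large (eps0 n) _).1 ?subrr ?mul0r//.
    by apply: ltW; apply: le_lt_trans x2; rewrite ler_piMr.
  have mh n : measurable_fun (pbox 2 Y : set R2) (h n).
    apply: measurable_funM; last by have /measurable_int/measurable_EFinP := ik 2 Y.
    apply: measurable_funTS; apply: continuous_at_measurable => [|x _]; first exact: openT.
    apply: cvgB; first exact: cvg_cst.
    apply: (@continuous_comp _ _ _ fst (cutoff (eps n))); first exact: cvg_fst.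
    apply: differentiable_continuous; apply/derivable1_diffP.
    by case: (is_derive_cutoff (eps n) x.1).
  have hle n x : pbox 2 Y x -> `|h n x| <= `|dk x.2 * b x + k x.2 * c x|.
    move=> _; rewrite /h normrM ler_piMl//.
    have /andP[p q] := cutoff_itv (eps n) x.1.
    by rewrite ger0_norm ?subr_ge0// gerBl.
  have hp x : pbox 2 Y x -> h n x @[n --> \oo] --> (0 : R).
    move=> px.
    rewrite (_ : 0 = (1 - 1) * (dk x.2 * b x + k x.2 * c x)); last by rewrite subrr mul0r.
    apply: cvgM; last exact: cvg_cst.
    by apply: cvgB; [exact: cvg_cst|apply: cutoff_cvg; exact: pbox_ohp px].
  have [_ hcvg] := @Rdominated_cvg _ _ _ (leb2 R) _ mp h (fun=> 0)
    (fun x => `|dk x.2 * b x + k x.2 * c x|) mh hp (integrable_norm (ik 2 Y)) hle.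
  have hi n : (leb2 R).-integrable ohp (EFin \o h n).
    apply: integrable_pbox (hz n) _.
    apply: (le_integrable _ _ _ (integrable_norm (ik 2 Y))) => //.
    + exact/measurable_EFinP.
    + by move=> x px /=; rewrite lee_fin normr_id; exact: hle.
  have E n : \int[leb2 R]_(x in ohp) (dcutoff (eps n) x.1 * k x.2 * a x) =
      \int[leb R]_y (k y * r0 y) + \int[leb2 R]_(x in pbox 2 Y) h n x.
    have := W _ _ _ _ _ (ltr0n R 2) Y0 (tf n).
    have -> : \int[leb R]_y (f n (0, y) * r0 y) = \int[leb R]_y (k y * r0 y).
      apply: eq_Rintegral => y _; rewrite /f /=.
      by rewrite (cutoff_small (eps0 n) (ltW (eps0 n))).1 subr0 mul1r.
    have -> : \int[leb2 R]_(x in ohp) balance_integrand a b c (f n) (f1 n) (f2 n) x =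
        \int[leb2 R]_(x in ohp) (h n x - dcutoff (eps n) x.1 * k x.2 * a x).
      by apply: eq_Rintegral => x _; rewrite /balance_integrand /f /f1 /f2 /h; ring.
    rewrite RintegralB//; last first.
      by apply: (int n (fun x => k x.2)); [move=> x; exact: ck2|exact: ck0].
    by rewrite -(Rintegral_pbox (hz n)) => ?; lra.
  rewrite (_ : (fun n => _) = fun n => \int[leb R]_y (k y * r0 y) +
    \int[leb2 R]_(x in pbox 2 Y) h n x); last exact/funext.
  rewrite -[X in _ --> X]addr0; apply: cvgD; first exact: cvg_cst.
  by move: hcvg; rewrite [X in _ --> X -> _](_ : _ = 0)// /Rintegral integral0.
apply/cvgrPdist_le => e e0.
pose I0 := \int[leb R]_(y in `[- Y, Y]) `|r0 y|.
have I00 : 0 <= I0 by apply: Rintegral_ge0.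
(* The denominator collects the three errors below: 16 M Y from [E1], 1 from [E2] and [I0] from
   [E3]. In [E1] the derivative of the cut-off is at most 4 / eps, the two slices differ by 2 e',
   [a] is at most [M], and the area is 2 eps Y. *)
pose e' := e / (16 * M * Y + I0 + 1).
have D0 : 0 < 16 * M * Y + I0 + 1.
  by rewrite ltr_wpDl// addr_ge0// !mulr_ge0// ltW.
have e'0 : 0 < e' by rewrite divr_gt0.
have [s s0 gs] := @small_time_uniform g Y e' e'0 cg.
pose k y := g (s, y).
have gz (x : R * R) : 0 <= x.1 -> Y < `|x.2| -> g x = 0.
  by case: x => t y /= t0 /ltW/(Zg _ _ t0)[].
have kz (x : R * R) : 0 <= x.1 -> Y < `|x.2| -> k x.2 = 0.
  by move=> _ /ltW/(Zg _ _ (ltW s0))[].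
have ck (x : R * R) : {for x, continuous (fun x => k x.2)}.
  apply: (@continuous_comp _ _ _ snd k); first exact: cvg_snd.
  exact: continuous_section2.
have P := profile k (fun y => gy (s, y)) (fun y => (Dg s y s0).1)
  (fun y => (Dg s y s0).2) (fun y => Zg s y (ltW s0)).
have gk t y : 0 <= t <= s -> - Y <= y <= Y -> `|g (t, y) - k y| <= 2 * e'.
  move=> ts yY; have A := gs _ _ ts yY.
  have B := gs s y; rewrite lexx (ltW s0) in B; have {}B := B isT yY.
  rewrite /k -(subrKA (g (0, y))); apply: le_trans (ler_normD _ _) _.
  by rewrite [`|g (0, y) - _|]distrC mulr_natl mulr2n lerD.
have E3 : `|\int[leb R]_y (g (0, y) * r0 y) - \int[leb R]_y (k y * r0 y)| <= e' * I0.
  have iseg (l : R -> R) : continuous l ->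
      (leb R).-integrable `[- Y, Y] (EFin \o (fun y => l y * r0 y)).
    move=> cl.
    have cl2 (x : R * R) : {for x, continuous (fun x : R * R => l x.2)}.
      by apply: (@continuous_comp _ _ _ snd l); [exact: cvg_snd|exact: cl].
    have [B _ HB] := continuous_at_compact_bounded (@box_compact R 1 Y) (fun x _ => cl2 x).
    apply: (@integrable_mulb _ _ R (leb R) `[- Y, Y]%classic (measurable_itv _) r0 l B).
    - by apply: measurable_funTS; exact: continuous_measurable_fun.
    - move=> y; rewrite /= in_itv/= => yY; apply: (HB (0, y)).
      by apply/boxP; rewrite /= lexx ler01.
    - exact: ir.
  have cg0 : continuous (fun y => g (0, y)) by move=> y; exact: continuous_section2.
  have ck1 : continuous k by move=> y; exact: continuous_section2.
  have i1 := iseg _ cg0; have i2 := iseg _ ck1.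
  rewrite (@Rintegral_seg _ (fun y => g (0, y) * r0 y) Y); last first.
    by move=> y /ltW/(Zg _ _ (lexx _))[-> _]; rewrite mul0r.
  rewrite (@Rintegral_seg _ (fun y => k y * r0 y) Y); last first.
    by move=> y /ltW/(Zg _ _ (ltW s0))[]; rewrite /k => -> _; rewrite mul0r.
  rewrite -RintegralB//.
  apply: le_trans (le_normr_Rintegral _ _) _; first exact: measurable_itv.
    exact: integrable_sub i1 i2.
  have ir1 := integrable_norm (ir Y).
  rewrite /I0 -RintegralZl//.
  apply: le_Rintegral; first exact: measurable_itv.
  - apply: integrable_norm; exact: integrable_sub i1 i2.
  - have mI : measurable (`[- Y, Y]%classic : set (measurableTypeR R)) by exact: measurable_itv.
    exact: (integrableZl mI e' ir1).
  - move=> y; rewrite /= in_itv/= => yY; rewrite -mulrBl normrM ler_wpM2r//.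
    by rewrite distrC; apply: gs => //; rewrite lexx ltW.
near=> n.
have ns : 2 * eps n <= s.
  rewrite -ler_pdivlMl//; apply: ltW; near: n.
  have t2 : 0 < 2^-1 * s by rewrite mulr_gt0// invr_gt0.
  exact: (near_infty_natSinv_lt (PosNum t2)).
have E2 : `|\int[leb2 R]_(x in ohp) (dcutoff (eps n) x.1 * k x.2 * a x) -
    \int[leb R]_y (k y * r0 y)| <= e'.
  rewrite distrC; near: n; move/cvgrPdist_le : P => /(_ e' e'0); exact.
have E1 : `|\int[leb2 R]_(x in ohp) (dcutoff (eps n) x.1 * g x * a x) -
    \int[leb2 R]_(x in ohp) (dcutoff (eps n) x.1 * k x.2 * a x)| <= 16 * M * Y * e'.
  have ig1 := int n g cg gz; have ik1 := int n (fun x => k x.2) ck kz.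
  rewrite -(RintegralB mo ig1 ik1).
  have en : eps n <= 2 * eps n by rewrite ler_peMl ?ler1n// ltW.
  pose S : set (R * R) := `[eps n, 2 * eps n]%classic `*` `[- Y, Y]%classic.
  have SP x : S x -> eps n <= x.1 <= 2 * eps n /\ - Y <= x.2 <= Y.
    by rewrite /S /setX/= !in_itv.
  have So : S `<=` ohp by move=> x /SP[/andP[p _] _]; exact: lt_le_trans p.
  have mS : measurable (S : set R2) by apply: measurableX; exact: measurable_itv.
  set F := fun x => _ - _.
  have iF : (leb2 R).-integrable ohp (EFin \o F).
    exact: (integrable_sub mo (int n g cg gz) (int n (fun x => k x.2) ck kz)).
  have -> : \int[leb2 R]_(x in ohp) F x = \int[leb2 R]_(x in S) F x.
    congr fine; apply: integral_support => // x ox nS; rewrite /F; congr EFin.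
    have [xe|xe] := leP x.1 (eps n); first by rewrite (cutoff_small (eps0 n) xe).2 !mul0r subrr.
    have [xe2|xe2] := leP (2 * eps n) x.1.
      by rewrite (cutoff_large (eps0 n) xe2).2 !mul0r subrr.
    have [Yx|xY] := ltP Y `|x.2|.
      by rewrite gz ?kz ?mulr0 ?mul0r ?subrr// ltW.
    by exfalso; apply: nS; rewrite /S /setX/= !in_itv/= -ler_norml xY (ltW xe) (ltW xe2).
  have C0 : 0 <= 4 / eps n * (2 * e') * M by rewrite !mulr_ge0// ?invr_ge0// ltW.
  have := Rintegral_rect_le en (ltW Y0) C0 (integrableS mo mS So iF).
  rewrite (_ : 4 / eps n * (2 * e') * M * _ = 16 * M * Y * e'); last first.
    by field; rewrite gt_eqF.
  apply => x /andP[xe xe2] xY.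
  rewrite /F -mulrBl -mulrBr normrM (normrM (dcutoff _ _)).
  have /andP[d0 d4] := dcutoff_itv x.1 (eps0 n).
  apply: ler_pM => //.
    apply: ler_pM => //; first by rewrite ger0_norm.
    case: (x) xe xe2 xY {d0 d4} => t y /= xe xe2 xY; apply: gk => //.
    by rewrite (le_trans xe2 ns) (le_trans _ xe)// ltW.
  apply: aM; apply/pboxP; rewrite (lt_le_trans _ xe)// ler_norml xY; split=> //.
  by apply: le_trans xe2 _; rewrite ler_piMr.
have -> : e = 16 * M * Y * e' + e' + e' * I0.
  by rewrite /e'; field; rewrite gt_eqF.
rewrite distrC; move: E1 E2 E3; rewrite !ler_norml => /andP[? ?] /andP[? ?] /andP[? ?].
by apply/andP; split; lra.
Unshelve. all: by end_near. Qed.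

End InitialTrace.

(** * Travelling space cut-offs *)

Section SpaceCutoff.
Context {R : realType}.
Local Notation R2 := (measurableTypeR R * measurableTypeR R)%type.
Local Notation ohp := (@open_half_plane R).

Variable kappa : R.
Hypothesis kappa0 : 0 <= kappa.

(* For t >= 0 this is exp(kappa t); it stays bounded away from 0 for t < 0. *)
Definition growth (t : R) : R := expR (kappa * (t + ramp2 (- t))).
Definition dgrowth (t : R) : R := growth t * (kappa * (1 - dramp2 (- t))).

Lemma is_derive_growth (t : R) : is_derive t 1 growth (dgrowth t).
Proof.
have D1 := @is_derive_chain _ R ramp2 (fun t => - t) t 1 _ _ (is_derive_ramp2 _)
  (is_deriveNid t 1).
have D2 : is_derive t 1 (fun t => kappa * (t + ramp2 (- t))) (kappa * (1 - dramp2 (- t))).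
  apply: is_derive_eq (is_derive_mul (is_derive_cst kappa t 1)
    (is_derive_add (is_derive_id t 1) D1)) _.
  by rewrite mul0r add0r mulrN1.
exact: (@is_derive_chain _ R expR _ t 1 _ _ (is_derive_expR _) D2).
Qed.

Lemma continuous_dgrowth : continuous dgrowth.
Proof.
move=> t; apply: cvgM.
  by apply: differentiable_continuous; apply/derivable1_diffP; case: (is_derive_growth t).
apply: cvgM; first exact: cvg_cst.
apply: cvgB; first exact: cvg_cst.
apply: (@continuous_comp _ _ _ -%R dramp2); first by apply: cvgN; exact: cvg_id.
exact: continuous_dramp2.
Qed.

Lemma growth_gt0 t : 0 < growth t. Proof. exact: expR_gt0. Qed.

Lemma dgrowth_ge0 t : 0 <= t -> dgrowth t = kappa * growth t.
Proof.
by move=> t0; rewrite /dgrowth /dramp2 ramp_eq0 ?oppr_le0// mulr0 subr0 mulr1 mulrC.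
Qed.

(** For t < 0 the exponent is kappa (t + t^2), and t + t^2 >= - 1 / 4. The bound keeps the support
    of [weight] bounded in y at all times, as [C1_test] requires. *)
Lemma growth_ge t : expR (- kappa) <= growth t.
Proof.
rewrite ler_expR -mulrN1 ler_wpM2l//.
have [t0|t0] := leP 0 t; first by rewrite (le_trans _ (ler_wpDr _ t0)) ?sqr_ge0//; lra.
rewrite /ramp2 ramp_id ?oppr_ge0 ?ltW//; have := sqr_ge0 (t + 2^-1); nra.
Qed.

Variable m : nat.

Definition dilation (x : R * R) : R := 1 - (1 + x.2 * x.2) * growth x.1 / m.+1%:R.
Definition dilation1 (x : R * R) : R := - ((1 + x.2 * x.2) * dgrowth x.1 / m.+1%:R).
Definition dilation2 (x : R * R) : R := - (2 * x.2 * growth x.1 / m.+1%:R).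

(** Positive exactly where (1 + y^2) growth < m + 1. This region shrinks exponentially in time and
    exhausts the half plane as [m] grows. The exponential rate matches transport speeds that grow
    linearly in y. *)
Definition weight (x : R * R) : R := ramp2 (dilation x).
Definition weight1 (x : R * R) : R := dramp2 (dilation x) * dilation1 x.
Definition weight2 (x : R * R) : R := dramp2 (dilation x) * dilation2 x.

Lemma C1_at_weight x : C1_at weight weight1 weight2 x.
Proof.
apply: (C1_at_comp (f := dilation)); last 2 first.
- exact: is_derive_ramp2.
- exact: continuous_dramp2.
have C := C1_at_add (C1_at_cst 1 x) (C1_at_mul (C1_at_cst (- m.+1%:R^-1) x)
  (C1_at_mul (C1_at_add (C1_at_cst 1 x) (C1_at_mul (C1_at_snd x) (C1_at_snd x)))
   (C1_at_time (is_derive_growth x.1) continuous_dgrowth))).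
apply: near_eq_C1_at C; near=> z.
rewrite /dilation /dilation1 /dilation2.
by split; ring.
Unshelve. all: by end_near. Qed.

Lemma weight_itv x : 0 <= weight x <= 1.
Proof.
have a := ramp_ge0 (dilation x).
rewrite /weight /ramp2 sqr_ge0/= exprn_ile1//; apply: ramp_le => //.
by rewrite gerBl divr_ge0// mulr_ge0 ?(ltW (growth_gt0 _))// addr_ge0// -expr2 sqr_ge0.
Qed.

(** Large enough for all times at once, by [growth_ge] and |y| <= 1 + y^2. *)
Definition width : R := m.+1%:R * expR kappa.

Lemma width_gt0 : 0 < width.
Proof. by rewrite mulr_gt0// expR_gt0. Qed.

Lemma dilation_far (x : R * R) : width <= `|x.2| -> dilation x <= 0.
Proof.
move=> wx; rewrite subr_le0 ler_pdivlMr ?ltr0n// mul1r.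
have a : `|x.2| <= 1 + x.2 * x.2.
  by have := sqr_ge0 (`|x.2| - 2^-1); rewrite -expr2 -(real_normK (num_real x.2)); nra.
apply: (@le_trans _ _ ((1 + x.2 * x.2) * expR (- kappa))).
  rewrite expRN ler_pdivlMr ?expR_gt0//; exact: le_trans wx a.
by rewrite ler_wpM2l ?growth_ge// addr_ge0// -expr2 sqr_ge0.
Qed.

Lemma weight_far (x : R * R) : width <= `|x.2| ->
  [/\ weight x = 0, weight1 x = 0 & weight2 x = 0].
Proof.
move=> /dilation_far d; rewrite /weight1 /weight2 /weight /ramp2 /dramp2 ramp_eq0//.
by rewrite expr0n/= mulr0 !mul0r.
Qed.

End SpaceCutoff.

Section WeightLimits.
Context {R : realType}.
Variable kappa : R.

(** Prepares monotone convergence, the only passage to the limit possible before [eta] is known to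
    be integrable. *)
Lemma weight_nondecreasing (x : R * R) (m k : nat) : (m <= k)%N ->
  weight kappa m x <= weight kappa k x.
Proof.
move=> mk; rewrite /weight /ramp2 lerXn2r ?nnegrE ?ramp_ge0//.
suff : dilation kappa m x <= dilation kappa k x.
  by move=> H; rewrite /ramp le_max2 //.
rewrite /dilation lerB// ler_wpM2l//.
  by rewrite mulr_ge0 ?(ltW (growth_gt0 _ _))// addr_ge0// -expr2 sqr_ge0.
by rewrite lef_pV2 ?posrE ?ltr0n// ler_nat.
Qed.

Lemma weight_cvg (x : R * R) : weight kappa m x @[m --> \oo] --> (1 : R).
Proof.
have c : {for 1, continuous (@ramp2 R)}.
  by apply: differentiable_continuous; apply/derivable1_diffP; case: (is_derive_ramp2 (1 : R)).
have -> : (1 : R) = ramp2 (1 - (1 + x.2 * x.2) * growth kappa x.1 * 0).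
  by rewrite mulr0 subr0 /ramp2 ramp_id ?ler01// expr1n.
apply: (@cvg_comp _ _ _ (fun m => dilation kappa m x) ramp2 _
  (nbhs (1 - (1 + x.2 * x.2) * growth kappa x.1 * 0))); last first.
  by rewrite mulr0 subr0; exact: c.
apply: cvgB; first exact: cvg_cst.
by apply: cvgM; [exact: cvg_cst|exact: cvg_harmonic].
Qed.

End WeightLimits.

Definition energy (R : realType) (alpha : R) (eta K : R * R -> R) (phi dphi : R -> R)
    (x : R * R) : R :=
  - dphi x.1 * eta x + phi x.1 * (2^-1 * eta x + alpha * K x).

Definition strip (R : realType) (T : R) : set (R * R) := [set x | 0 < x.1 <= T].

(** Both kinds of reference state lead to this statement. Integrability of [eta] and [K] belongs to
    the conclusion, being known beforehand on bounded boxes only. *)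
Definition energy_estimate (R : realType) (alpha : R) (eta K xi : R * R -> R) (eta0 : R -> R) : Prop :=
  (forall T : R, 0 <= T -> (leb2 R).-integrable (strip T) (EFin \o eta) /\
    (leb2 R).-integrable (strip T) (EFin \o K)) /\
  forall (phi dphi : R -> R) (T : R), 0 < T ->
    (forall t : R, is_derive t 1 phi (dphi t)) -> continuous dphi ->
    (forall t : R, T <= t -> phi t = 0 /\ dphi t = 0) ->
    (forall t : R, 0 <= t -> 0 <= phi t) ->
    (leb2 R).-integrable (@open_half_plane R) (EFin \o energy alpha eta K phi dphi) /\
    \int[leb2 R]_(x in @open_half_plane R) energy alpha eta K phi dphi x <=
      phi 0 * \int[leb R]_y eta0 y + \int[leb2 R]_(x in @open_half_plane R) (phi x.1 * xi x).

(** * From the local to the integrated inequality *)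

Section Localization.
Context {R : realType}.
Local Notation R2 := (measurableTypeR R * measurableTypeR R)%type.
Local Notation ohp := (@open_half_plane R).

Lemma measurable_strip (T : R) : measurable (strip T : set R2).
Proof.
have -> : strip T = `]0, T]%classic `*` setT.
  by apply/seteqP; split=> [x|x [/=]]; rewrite /strip /setX/= in_itv.
by apply: measurableX => //; exact: measurable_itv.
Qed.

Lemma strip_ohp (T : R) : strip T `<=` ohp.
Proof. by move=> x /andP[]. Qed.

Lemma pbox_strip (T Y : R) : pbox T Y `<=` strip T.
Proof. by move=> x /pboxP[]. Qed.

Lemma integral_strip (f : R * R -> R) T : (forall x : R * R, T < x.1 -> f x = 0) ->
  \int[leb2 R]_(x in ohp) f x = \int[leb2 R]_(x in strip T) f x.
Proof.
move=> f0; congr fine; apply: integral_support; first exact: strip_ohp.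
move=> x ox nx; rewrite f0// ltNge; apply/negP => xT; apply: nx.
by rewrite /strip /= xT andbT.
Qed.

Lemma integrable_strip (f : R * R -> R) T : (forall x : R * R, T < x.1 -> f x = 0) ->
  (leb2 R).-integrable (strip T) (EFin \o f) -> (leb2 R).-integrable ohp (EFin \o f).
Proof.
move=> f0 fi; have mo := @measurable_ohp R; have mp := measurable_strip T.
have H : (leb2 R).-integrable (ohp `&` strip T) (EFin \o f).
  by rewrite setIidr//; exact: strip_ohp.
have := (integrable_restrict (leb2 R) mp mo (EFin \o f)).1 H.
apply: eq_integrable => // x; rewrite inE => ox; rewrite patchE; case: ifPn => //.
rewrite notin_setE => npx /=; rewrite f0// ltNge; apply/negP => xT; apply: npx.
by rewrite /strip /= xT andbT.
Qed.

Variables (alpha : R) (eta K q xi : R * R -> R) (eta0 : R -> R).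
Hypotheses (alpha0 : 0 <= alpha)
  (ieta : L1box eta) (iK : L1box K) (iq : L1box q)
  (ixi : forall T, (leb2 R).-integrable (strip T) (EFin \o xi))
  (ieta0 : (leb R).-integrable setT (EFin \o eta0))
  (eta0_ge0 : forall y, 0 <= eta0 y)
  (eta_ge0 : forall x, ohp x -> 0 <= eta x)
  (K_ge0 : forall x, ohp x -> 0 <= K x)
  (control : forall T : R, exists2 C : R, 0 <= C & forall x, strip T x ->
     K x <= C * eta x /\ `|q x| <= C * eta x)
  (meta : measurable_fun (ohp : set R2) eta)
  (mK : measurable_fun (ohp : set R2) K).

Hypothesis local_ineq : forall f f1 f2 (T Y : R), 0 < T -> 0 < Y ->
  C1_test f f1 f2 T Y -> (forall x : R * R, 0 <= x.1 -> 0 <= f x) ->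
  \int[leb2 R]_(x in ohp) balance_integrand (fun x => - eta x)
    (fun x => x.2 / 2 * eta x - q x)
    (fun x => 2^-1 * eta x + alpha * K x - xi x) f f1 f2 x <=
  \int[leb R]_y (f (0, y) * eta0 y).

Section TimeWeight.
Variables (phi dphi : R -> R) (T : R).
Hypotheses (T0 : 0 < T) (Dphi : forall t : R, is_derive t 1 phi (dphi t))
  (cdphi : continuous dphi)
  (phi_end : forall t : R, T <= t -> phi t = 0 /\ dphi t = 0)
  (phi_ge0 : forall t : R, 0 <= t -> 0 <= phi t).

Local Notation energy := (energy alpha eta K phi dphi).

Let cphi : continuous phi.
Proof. by move=> t; apply: differentiable_continuous; apply/derivable1_diffP; case: (Dphi t). Qed.

Let ctime (k : R -> R) (x : R * R) : continuous k -> {for x, continuous (fun x : R * R => k x.1)}.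
Proof.
by move=> ck; apply: (@continuous_comp _ _ _ fst k); [exact: cvg_fst|exact: ck].
Qed.

Let ixi_box : L1box xi.
Proof.
move=> T' Y'; apply: integrableS (ixi T'); [exact: measurable_strip|exact: measurable_pbox|].
exact: pbox_strip.
Qed.

Let ienergy : L1box energy.
Proof.
have L1scale (c : R) (f : R * R -> R) : L1box f -> L1box (fun x => c * f x).
  by apply: (L1box_continuous_mul (G := fun=> c)) => x; exact: cvg_cst.
apply: L1box_add.
  apply: (L1box_continuous_mul (G := fun x => - dphi x.1)) => // x.
  by apply: cvgN; exact: ctime.
apply: (L1box_continuous_mul (G := fun x => phi x.1)) => [x|]; first exact: ctime.
by apply: L1box_add; exact: L1scale.
Qed.

Let C := sval (cid2 (control T)).
Let C0 : 0 <= C. Proof. by rewrite /C; case: cid2. Qed.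
Let CP x : strip T x -> K x <= C * eta x /\ `|q x| <= C * eta x.
Proof. by rewrite /C; case: cid2 => /= ? _; apply. Qed.

(** The 1 absorbs the drift y / 2, and [C] absorbs the flux [q]. *)
Let kappa := 1 + C.
Let kappa0 : 0 <= kappa. Proof. exact: addr_ge0. Qed.
Let w m := weight kappa m.

Let cw m (x : R * R) : {for x, continuous (w m)}.
Proof. by case: (C1_at_weight kappa m x). Qed.

Let w_energy0 m (x : R * R) : ohp x -> T < x.1 \/ width kappa m < `|x.2| -> w m x * energy x = 0.
Proof.
move=> ox [/ltW/phi_end[p0 p1]|/ltW/(weight_far kappa0)[w0 _ _]].
  by rewrite /energy p0 p1 oppr0 !mul0r addr0 mulr0.
by rewrite /w w0 mul0r.
Qed.

Let w_xi0 m (x : R * R) : ohp x -> T < x.1 \/ width kappa m < `|x.2| -> w m x * (phi x.1 * xi x) = 0.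
Proof.
move=> ox [/ltW/phi_end[p0 p1]|/ltW/(weight_far kappa0)[w0 _ _]].
  by rewrite p0 mul0r mulr0.
by rewrite /w w0 mul0r.
Qed.

Lemma weighted_energy_integrable m : (leb2 R).-integrable ohp (EFin \o (fun x => w m x * energy x)).
Proof.
apply: integrable_pbox (w_energy0 (m := m)) _.
by apply: L1box_continuous_mul => // x; exact: cw.
Qed.

Let iw_xi m : (leb2 R).-integrable ohp (EFin \o (fun x => w m x * (phi x.1 * xi x))).
Proof.
apply: integrable_pbox (w_xi0 (m := m)) _.
apply: L1box_continuous_mul => [x|]; first exact: cw.
by apply: L1box_continuous_mul => // x; exact: ctime.
Qed.

(* The contribution of the space cut-off has a sign because its level sets travel
   inwards faster than the relative entropy can be transported. *)
Lemma weighted_energy_ineq m :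
  \int[leb2 R]_(x in ohp) (w m x * energy x) <=
  phi 0 * \int[leb R]_y eta0 y + \int[leb2 R]_(x in ohp) (w m x * (phi x.1 * xi x)).
Proof.
have mo := @measurable_ohp R.
pose f x := phi x.1 * w m x.
pose f1 x := dphi x.1 * w m x + phi x.1 * weight1 kappa m x.
pose f2 x := phi x.1 * weight2 kappa m x.
have tf : C1_test f f1 f2 T (width kappa m).
  split=> [x|x].
    have := C1_at_mul (C1_at_time (Dphi x.1) cdphi) (C1_at_weight kappa m x).
    by apply: near_eq_C1_at; near=> z; rewrite /f /f1 /f2 mul0r add0r.
  case=> [/phi_end[p0 p1]|/(weight_far kappa0)[w0 w1 w2]].
    by rewrite /f /f1 /f2 p0 p1 !mul0r addr0.
  by rewrite /f /f1 /f2 /w w0 w1 w2 !mulr0 addr0.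
have f0 (x : R * R) : 0 <= x.1 -> 0 <= f x.
  by move=> x0; rewrite mulr_ge0 ?phi_ge0//; case/andP: (weight_itv kappa m x).
have := local_ineq T0 (width_gt0 kappa m) tf f0.
set B := balance_integrand _ _ _ f f1 f2.
have iB : (leb2 R).-integrable ohp (EFin \o B).
  have [[CC Z] [if0 if1 if2]] := (tf, C1_test_bounded tf).
  apply: (@integrable_pbox _ B T (width kappa m)).
    move=> x _ H; have [|z0 z1 z2] := Z x; first by case: H => /ltW; [left|right].
    by rewrite /B /balance_integrand z0 z1 z2 !mul0r !addr0.
  apply: L1box_add; first apply: L1box_add.
  - apply: L1box_continuous_mul => [x|]; first by case: (CC x).
    exact: L1box_opp.
  - apply: L1box_continuous_mul => [x|]; first by case: (CC x).
    apply: L1box_add; last exact: L1box_opp.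
    apply: (L1box_continuous_mul (G := fun x => x.2 / 2)) => // x.
    by apply: cvgM; [exact: cvg_snd|exact: cvg_cst].
  - apply: L1box_continuous_mul => [x|]; first by case: (CC x).
    have L1scale (c : R) (k : R * R -> R) : L1box k -> L1box (fun x => c * k x).
      by apply: (L1box_continuous_mul (G := fun=> c)) => x; exact: cvg_cst.
    by apply: L1box_add; [apply: L1box_add; exact: L1scale|exact: L1box_opp].
have lower x : ohp x -> w m x * energy x - w m x * (phi x.1 * xi x) <= B x.
  move=> ox; have := ox; rewrite /open_half_plane /= => x0.
  have [xT|/ltW xT] := leP x.1 T; last first.
    have [p0 p1] := phi_end xT.
    rewrite /B /balance_integrand /energy /f /f1 /f2 p0 p1.
    by rewrite le_eqVlt; apply/orP; left; apply/eqP; ring.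
  have [_ Cq] : K x <= C * eta x /\ `|q x| <= C * eta x by apply: CP; rewrite /strip /= x0 xT.
  rewrite -subr_ge0.
  (* Everything cancels except the terms with derivatives of the weight. *)
  have -> : B x - (w m x * energy x - w m x * (phi x.1 * xi x)) =
      phi x.1 * dramp2 (dilation kappa m x) * (growth kappa x.1 / m.+1%:R) *
      (kappa * (1 + x.2 * x.2) * eta x - 2 * x.2 * (x.2 / 2 * eta x - q x)).
    rewrite /B /balance_integrand /energy /f /f1 /f2 /weight1 /weight2 /dilation1 /dilation2.
    by rewrite (dgrowth_ge0 kappa (ltW x0)); field; rewrite nat1r pnatr_eq0.
  apply: mulr_ge0.
    rewrite !mulr_ge0 ?phi_ge0 ?ramp_ge0 ?(ltW (growth_gt0 _ _))//; exact: ltW.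
  have e0 := eta_ge0 ox.
  rewrite ler_norml in Cq; case/andP: Cq => q1 q2.
  have yq : `|x.2 * q x| <= (1 + x.2 * x.2) / 2 * (C * eta x).
    have hx : `|x.2| <= (1 + x.2 * x.2) / 2.
      by have := sqr_ge0 (`|x.2| - 1); rewrite -expr2 -(real_normK (num_real x.2)); nra.
    by rewrite normrM ler_pM// ler_norml q1.
  rewrite ler_norml in yq; case/andP: yq => y1 _.
  (* Here kappa = 1 + C is used: the term y^2 eta from the drift cancels, and 2 |y q| is at most C
     (1 + y^2) eta. *)
  have -> : kappa * (1 + x.2 * x.2) * eta x - 2 * x.2 * (x.2 / 2 * eta x - q x) =
    eta x + 2 * ((1 + x.2 * x.2) / 2 * (C * eta x) + x.2 * q x) by rewrite /kappa; field.
  by rewrite addr_ge0// mulr_ge0//; lra.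
have le1 := le_Rintegral mo (integrable_sub mo (weighted_energy_integrable m) (iw_xi m)) iB lower.
rewrite (RintegralB mo (weighted_energy_integrable m) (iw_xi m)) in le1.
have le2 : \int[leb R]_y (f (0, y) * eta0 y) <= phi 0 * \int[leb R]_y eta0 y.
  have mI : measurable (setT : set (measurableTypeR R)) by [].
  rewrite -(RintegralZl _ mI ieta0).
  have w01 y := weight_itv kappa m (0, y).
  have p0 := phi_ge0 (lexx 0).
  apply: le_Rintegral => //; last 2 first.
  - exact: (integrableZl mI (phi 0) ieta0).
  - move=> y _; rewrite ler_wpM2r// /f /= ler_piMr//.
    by case/andP: (w01 y).
  apply: (@integrable_mulb _ _ R (leb R) setT mI eta0 (fun y => f (0, y)) (phi 0)) => //.
    apply: continuous_measurable_fun => y; apply: continuous_section2.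
    by case: tf => CC _; case: (CC (0, y)).
  move=> y _; rewrite /f /= ger0_norm; last by rewrite mulr_ge0//; case/andP: (w01 y).
  by rewrite ler_piMr//; case/andP: (w01 y).
by move=> le3; move: le1 le2 le3; set X1 := \int[_]_(x in _) _; lra.
Unshelve. all: by end_near. Qed.

Lemma iphi_xi : (leb2 R).-integrable ohp (EFin \o (fun x => phi x.1 * xi x)).
Proof.
apply: (@integrable_strip _ T); first by move=> x /ltW/phi_end[-> _]; rewrite mul0r.
have [M _ HM] := continuous_at_compact_bounded (@box_compact R T 1)
  (fun x _ => ctime (x := x) cphi).
apply: (integrable_mulb (measurable_strip T) (M := M)) => //.
  by apply: measurable_funTS; apply: continuous_at_measurable => [|x _]; [exact: openT|exact: ctime].
move=> x /andP[/ltW a b]; apply: (HM (x.1, 0)); apply/boxP => /=.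
by rewrite a b oppr_le0 ler01.
Qed.

(** A bound independent of [m], available before [eta] is known to be integrable. *)
Lemma weighted_xi_le m : \int[leb2 R]_(x in ohp) (w m x * (phi x.1 * xi x)) <=
  \int[leb2 R]_(x in ohp) `|phi x.1 * xi x|.
Proof.
apply: le_Rintegral => //.
- exact: measurable_ohp.
- exact: (integrable_norm iphi_xi).
- move=> x _; have /andP[a b] := weight_itv kappa m x.
  by apply: le_trans (ler_norm _) _; rewrite normrM ger0_norm// ler_piMl.
Qed.

(** Once [eta] and [K] are integrable over the strip, dominated convergence removes the weights from
    [weighted_energy_ineq]. *)
Lemma energy_ineq_integrable : (leb2 R).-integrable (strip T) (EFin \o eta) ->
  (leb2 R).-integrable (strip T) (EFin \o K) ->
  (leb2 R).-integrable ohp (EFin \o energy) /\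
  \int[leb2 R]_(x in ohp) energy x <=
    phi 0 * \int[leb R]_y eta0 y + \int[leb2 R]_(x in ohp) (phi x.1 * xi x).
Proof.
move=> ie iKT; have mo := @measurable_ohp R; have ms := measurable_strip T.
have bounded_time (k : R -> R) : continuous k -> exists M, forall x, strip T x -> `|k x.1| <= M.
  move=> ck; have [M _ HM] := continuous_at_compact_bounded (@box_compact R T 1)
    (fun x _ => ctime (x := x) ck).
  exists M => x /andP[/ltW a b]; apply: (HM (x.1, 0)); apply/boxP => /=.
  by rewrite a b oppr_le0 ler01.
have mtime (k : R -> R) : continuous k -> measurable_fun (strip T : set R2) (fun x : R * R => k x.1).
  move=> ck; apply: measurable_funTS; apply: continuous_at_measurable => [|x _].
    exact: openT.
  exact: ctime.
have ien : (leb2 R).-integrable ohp (EFin \o energy).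
  apply: (@integrable_strip _ T).
    by move=> x /ltW/phi_end[p0 p1]; rewrite /energy p0 p1 oppr0 !mul0r addr0.
  apply: integrable_add => //.
    have cN : continuous (fun t => - dphi t) by move=> t; apply: cvgN; exact: cdphi.
    have [M HM] := bounded_time _ cN.
    exact: (integrable_mulb ms (mtime _ cN) HM).
  have [M HM] := bounded_time _ cphi.
  apply: (integrable_mulb ms (mtime _ cphi) HM).
  apply: integrable_add => //; first exact: (integrableZl ms 2^-1 ie).
  exact: (integrableZl ms alpha iKT).
split=> //.
have wl (k : R * R -> R) : (leb2 R).-integrable ohp (EFin \o k) ->
    \int[leb2 R]_(x in ohp) (w m x * k x) @[m --> \oo] --> \int[leb2 R]_(x in ohp) k x.
  move=> ik; have [||||] := @Rdominated_cvg _ _ _ (leb2 R) ohp mo (fun m x => w m x * k x) k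
    (fun x => `|k x|).
  - move=> m; apply: measurable_funM; last by move/measurable_int/measurable_EFinP: ik.
    apply: measurable_funTS; apply: continuous_at_measurable => [|x _]; first exact: openT.
    exact: cw.
  - move=> x _; rewrite -[X in _ --> X]mul1r; apply: cvgM; last exact: cvg_cst.
    exact: weight_cvg.
  - exact: integrable_norm.
  - move=> m x _; rewrite normrM; have /andP[a b] := weight_itv kappa m x.
    by rewrite ger0_norm// ler_piMl.
  - by [].
have L1 := wl _ ien; have L2 := wl _ iphi_xi.
rewrite -(cvg_lim _ L1)//.
have L3 : phi 0 * \int[leb R]_y eta0 y + \int[leb2 R]_(x in ohp) (w m x * (phi x.1 * xi x))
    @[m --> \oo] --> phi 0 * \int[leb R]_y eta0 y + \int[leb2 R]_(x in ohp) (phi x.1 * xi x).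
  by apply: cvgD => //; exact: cvg_cst.
rewrite -(cvg_lim _ L3)//; apply: ler_lim.
- by apply/cvg_ex; eexists; exact: L1.
- by apply/cvg_ex; eexists; exact: L3.
- by near=> m; exact: weighted_energy_ineq.
Unshelve. all: by end_near. Qed.

End TimeWeight.

Let final_time_decay (T : R) (t : R) : is_derive t 1 (fun t => ramp2 (T + 1 - t)) (- dramp2 (T + 1 - t)).
Proof.
have D1 : is_derive t 1 (fun t => T + 1 - t) (- 1).
  exact: (is_derive_eq (is_deriveB (is_derive_cst (T + 1) t 1) (is_derive_id t 1)) (sub0r _)).
apply: is_derive_eq (@is_derive_chain _ R ramp2 _ t 1 _ _ (is_derive_ramp2 _) D1) _.
by rewrite mulrN1.
Qed.

(** The time weight ((T + 1 - t)_+)^2 is nonincreasing, so every term of [energy] is nonnegative;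
    its derivative is at most - 2 for t <= T, so [energy] dominates [eta] there. The weighted
    inequality thus bounds the integral of the weighted [eta] by a constant independent of [m], and
    monotone convergence removes the weight. *)
Lemma strip_integrable (T : R) : 0 <= T ->
  (leb2 R).-integrable (strip T) (EFin \o eta) /\ (leb2 R).-integrable (strip T) (EFin \o K).
Proof.
move=> T0; have mo := @measurable_ohp R; have ms := measurable_strip T.
have T1 : 0 < T + 1 by rewrite ltr_wpDl.
pose phi (t : R) := ramp2 (T + 1 - t).
pose dphi (t : R) := - dramp2 (T + 1 - t).
have cdphi : continuous dphi.
  move=> t; apply: cvgN.
  apply: (@continuous_comp _ _ _ (fun t => T + 1 - t) dramp2); last exact: continuous_dramp2.
  by apply: cvgB; [exact: cvg_cst|exact: cvg_id].
have phi_end (t : R) : T + 1 <= t -> phi t = 0 /\ dphi t = 0.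
  by move=> Tt; rewrite /phi /dphi /ramp2 /dramp2 ramp_eq0 ?subr_le0// expr0n/= mulr0 oppr0.
have phi_ge0 (t : R) : 0 <= t -> 0 <= phi t by move=> _; exact: sqr_ge0.
have W := weighted_energy_ineq T1 (final_time_decay T) cdphi phi_end phi_ge0.
have X := weighted_xi_le (final_time_decay T) phi_end.
pose w m := weight (1 + sval (cid2 (control (T + 1)))) m.
pose B := phi 0 * \int[leb R]_y eta0 y + \int[leb2 R]_(x in ohp) `|phi x.1 * xi x|.
have mse : measurable_fun (strip T : set R2) eta.
  by apply: measurable_funS meta => //; exact: strip_ohp.
have mw m : measurable_fun (setT : set R2) (w m).
  apply: continuous_at_measurable => [|x _]; first exact: openT.
  by case: (C1_at_weight (1 + sval (cid2 (control (T + 1)))) m x).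
have w0 m x : 0 <= w m x by case/andP: (weight_itv (1 + sval (cid2 (control (T + 1)))) m x).
have en0 x : ohp x -> 0 <= energy alpha eta K phi dphi x.
  move=> ox; rewrite /energy /dphi opprK /phi /dramp2 addr_ge0 ?mulr_ge0 ?ramp_ge0 ?eta_ge0 ?sqr_ge0//.
  by rewrite addr_ge0// mulr_ge0 ?eta_ge0 ?K_ge0.
have men : measurable_fun (ohp : set R2) (energy alpha eta K phi dphi).
  have mt (k : R -> R) : continuous k -> measurable_fun (ohp : set R2) (fun x : R * R => k x.1).
    move=> ck; apply: measurable_funTS; apply: continuous_at_measurable => [|x _].
      exact: openT.
    by apply: (@continuous_comp _ _ _ fst k); [exact: cvg_fst|exact: ck].
  have cphi : continuous phi.
    move=> t; apply: differentiable_continuous; apply/derivable1_diffP.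
    by case: (final_time_decay T t).
  apply: measurable_funD; apply: measurable_funM => //.
  - by apply: (mt (fun t => - dphi t)) => t; apply: cvgN; exact: cdphi.
  - exact: mt.
  - by apply: measurable_funD; apply: measurable_funM.
have bound m : (\int[leb2 R]_(x in strip T) (w m x * eta x)%:E <= B%:E)%E.
  have iw := weighted_energy_integrable (final_time_decay T) cdphi phi_end m.
  apply: (@le_trans _ _ (\int[leb2 R]_(x in strip T) (w m x * energy alpha eta K phi dphi x)%:E)%E).
    apply: ge0_le_integral => //.
    - by move=> x sx; rewrite lee_fin; apply: mulr_ge0; [exact: w0|exact/eta_ge0/(strip_ohp sx)].
    - apply/measurable_EFinP; apply: measurable_funM => //; exact: (measurable_funTS (mw m)).
    - apply/measurable_EFinP; apply: measurable_funM; first exact: (measurable_funTS (mw m)).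
      by apply: measurable_funS men => //; exact: strip_ohp.
    - move=> x sx; rewrite lee_fin ler_wpM2l//.
      have ox := strip_ohp sx; have e0 := eta_ge0 ox; have k0 := K_ge0 ox.
      have /andP[_ xT] := sx.
      rewrite /energy /dphi opprK /phi /dramp2 ramp_id; last by lra.
      have P : 0 <= ramp2 (T + 1 - x.1) * (2^-1 * eta x + alpha * K x).
        by rewrite mulr_ge0 ?sqr_ge0// addr_ge0// mulr_ge0.
      have xT0 : 0 <= T - x.1 by rewrite subr_ge0.
      have := mulr_ge0 e0 xT0; nra.
  apply: (@le_trans _ _ (\int[leb2 R]_(x in ohp) (w m x * energy alpha eta K phi dphi x)%:E)%E).
    apply: ge0_subset_integral => //.
    - by apply/measurable_EFinP; apply: measurable_funM => //; exact: (measurable_funTS (mw m)).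
    - by move=> x ox; rewrite lee_fin; apply: mulr_ge0; [exact: w0|exact: en0].
    - exact: strip_ohp.
  rewrite -[leLHS]fineK; last exact: integrable_fin_num.
  rewrite lee_fin; apply: le_trans (W m) _; rewrite lerD2l; exact: X.
have ie : (leb2 R).-integrable (strip T) (EFin \o eta).
  apply/integrableP; split; first exact/measurable_EFinP.
  apply: (@le_lt_trans _ _ B%:E); last exact: ltry.
  have -> : (\int[leb2 R]_(x in strip T) `|(EFin \o eta) x| =
      \int[leb2 R]_(x in strip T) (eta x)%:E)%E.
    by apply: eq_integral => x; rewrite inE => /strip_ohp ox /=; rewrite ger0_norm// eta_ge0.
  have L : (\int[leb2 R]_(x in strip T) (w m x * eta x)%:E @[m --> \oo] -->
      \int[leb2 R]_(x in strip T) (eta x)%:E)%E.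
    have -> : (\int[leb2 R]_(x in strip T) (eta x)%:E = \int[leb2 R]_(x in strip T)
        limn (fun m => (w m x * eta x)%:E))%E.
      apply: eq_integral => x _; apply/esym/cvg_lim => //; apply: cvg_EFin.
        by near=> m.
      by rewrite -[X in _ --> X]mul1r; apply: cvgM; [exact: weight_cvg|exact: cvg_cst].
    apply: cvg_monotone_convergence => //.
    - by move=> m; apply/measurable_EFinP; apply: measurable_funM => //; exact: (measurable_funTS (mw m)).
    - by move=> m x sx; rewrite lee_fin; apply: mulr_ge0; [exact: w0|exact/eta_ge0/(strip_ohp sx)].
    - move=> x sx m k mk; rewrite lee_fin ler_wpM2r//; first exact/eta_ge0/(strip_ohp sx).
      exact: weight_nondecreasing.
  rewrite -(cvg_lim _ L)//; apply: lime_le; first by apply/cvg_ex; eexists; exact: L.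
  by near=> m; exact: bound.
split=> //.
have [C C0 CP] := control T.
apply: (le_integrable ms _ _ (integrableZl ms C ie)).
  by apply/measurable_EFinP; apply: measurable_funS mK => //; exact: strip_ohp.
move=> x sx /=; rewrite lee_fin.
have [KC _] := CP x sx; have ox := strip_ohp sx.
by rewrite ger0_norm ?K_ge0// ger0_norm// mulr_ge0// eta_ge0.
Unshelve. all: by end_near. Qed.

Lemma localization : energy_estimate alpha eta K xi eta0.
Proof.
split=> [T|phi dphi T T0 D c e g]; first exact: strip_integrable.
have [ie iK'] := strip_integrable (ltW T0).
exact: (@energy_ineq_integrable phi dphi T).
Qed.

End Localization.

(** * Pressure and potential *)

Section Pressure.
Context {R : realType}.
Variables p h : R -> R.
Hypotheses (p_cont : {within `[0, +oo[, continuous p})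
  (p_C1 : C1_pos p)
  (p_incr : forall z : R, 0 < z -> 0 < derive1 p z)
  (h_cont : {within `[0, +oo[, continuous h})
  (h_C2 : C2_pos h)
  (h_potential : forall z : R, 0 < z -> p z = z * derive1 h z - h z).

Let h1 := derive1 h.
Let h2 := derive1n 2 h.

Lemma is_derive_potential (z : R) : 0 < z -> is_derive z 1 h (h1 z).
Proof. by move=> z0; have [d _] := h_C2.1 z z0; rewrite /h1 derive1E; exact/derivableP. Qed.

Lemma is_derive_potential2 (z : R) : 0 < z -> is_derive z 1 h1 (h2 z).
Proof.
by move=> z0; have [d _] := h_C2.2 z z0; rewrite /h2 /derive1n /= derive1E; exact/derivableP.
Qed.

Lemma is_derive_pressure (z : R) : 0 < z -> is_derive z 1 p (derive1 p z).
Proof. by move=> z0; have [d _] := p_C1 z0; rewrite derive1E; exact/derivableP. Qed.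

Lemma pressure_derivative (z : R) : 0 < z -> derive1 p z = z * h2 z.
Proof.
move=> z0; have D := is_deriveB (is_derive_mul (is_derive_id z 1) (is_derive_potential2 z0))
  (is_derive_potential z0).
have E : \forall x \near z, x * h1 x - h x = p x.
  by near=> x; rewrite h_potential//; near: x; exact: lt_nbhsr.
have := @derive_val _ _ _ _ _ _ _ (near_eq_is_derive E D).
by rewrite derive1E => ->; rewrite mul1r addrAC subrr add0r.
Unshelve. all: by end_near. Qed.

Lemma potential2_gt0 (z : R) : 0 < z -> 0 < h2 z.
Proof. by move=> z0; have := p_incr z0; rewrite pressure_derivative// pmulr_rgt0. Qed.

Lemma continuous_pressure_derivative (z : R) : 0 < z -> {for z, continuous (derive1 p)}.
Proof. by move=> z0; have [] := p_C1 z0. Qed.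

Lemma continuous_potential1 (z : R) : 0 < z -> {for z, continuous h1}.
Proof. by move=> z0; have [] := h_C2.1 z z0. Qed.

Lemma continuous_potential2 (z : R) : 0 < z -> {for z, continuous h2}.
Proof. by move=> z0; have [] := h_C2.2 z z0. Qed.

Lemma mean_value_ge0 (f df : R -> R) (x y : R) : {within `[0, +oo[, continuous f} ->
  (forall z : R, 0 < z -> is_derive z 1 f (df z)) -> 0 <= x -> x < y ->
  exists2 s : R, x < s < y & f y - f x = df s * (y - x).
Proof.
move=> cf D x0 xy; have [||s sI E] := @MVT _ f df x y xy.
- by move=> z; rewrite in_itv/= => /andP[xz _]; apply: D; exact: le_lt_trans xz.
- apply: continuous_subspaceW cf => z /=; rewrite !in_itv/= andbT => /andP[xz _].
  exact: le_trans xz.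
- by exists s => //; move: sI; rewrite in_itv.
Qed.

Lemma mean_value_gt0 (f df : R -> R) (x y : R) :
  (forall z : R, 0 < z -> is_derive z 1 f (df z)) -> 0 < x -> x < y ->
  exists2 s : R, x < s < y & f y - f x = df s * (y - x).
Proof.
move=> D x0 xy; apply: mean_value => // z /andP[xz _]; apply: D; exact: lt_le_trans xz.
Qed.

Lemma potential1_lt (x y : R) : 0 < x -> x < y -> h1 x < h1 y.
Proof.
move=> x0 xy; have [s /andP[xs sy] E] := mean_value_gt0 is_derive_potential2 x0 xy.
rewrite -subr_gt0 E mulr_gt0 ?subr_gt0// potential2_gt0//; exact: lt_trans xs.
Qed.

Lemma deriv_ge0_gt0 (f : R -> R) (z : R) : 0 < z -> deriv_ge0 f z = derive1 f z.
Proof. by rewrite /deriv_ge0 => ->. Qed.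

Lemma relative_potential_ge0 (z zb : R) : 0 <= z -> 0 < zb -> 0 <= relative h z zb.
Proof.
move=> z0 zb0; rewrite /relative deriv_ge0_gt0// -/h1.
have [zz|zz|->] := ltgtP z zb; last by rewrite !subrr mulr0 subr0.
- have [s /andP[zs sb] E] := mean_value_ge0 h_cont is_derive_potential z0 zz.
  have := potential1_lt (le_lt_trans z0 zs) sb; nra.
- have [s /andP[zs sb] ->] := mean_value_ge0 h_cont is_derive_potential (ltW zb0) zz.
  have := potential1_lt zb0 zs; nra.
Qed.

Lemma continuous_segment_bounded (f : R -> R) (a b : R) :
  {within `[a, b], continuous f} -> exists2 M : R, 0 <= M & forall z, a <= z <= b -> `|f z| <= M.
Proof.
move=> cf; have [M [_ HM]] : bounded_set (f @` `[a, b]%classic).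
  by apply: compact_bounded; apply: continuous_compact => //; exact: segment_compact.
exists (Num.max 0 (M + 1)); first by rewrite le_max lexx.
move=> z zI; apply: (HM (Num.max 0 (M + 1))); last by exists z => //=; rewrite in_itv.
by rewrite lt_max ltrDl ltr01 orbT.
Qed.

Lemma pos_segment_bounded (f : R -> R) (a b : R) : 0 < a ->
  (forall z : R, 0 < z -> {for z, continuous f}) ->
  exists2 M : R, 0 <= M & forall z, a <= z <= b -> `|f z| <= M.
Proof.
move=> a0 cf; apply: continuous_segment_bounded.
apply: continuous_in_subspaceT => z; rewrite inE /= in_itv/= => /andP[az _].
by apply: cf; exact: lt_le_trans az.
Qed.

Lemma pos_segment_lower_bound (f : R -> R) (a b : R) : 0 < a -> a <= b ->
  (forall z : R, 0 < z -> {for z, continuous f} /\ 0 < f z) ->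
  exists2 m : R, 0 < m & forall z, a <= z <= b -> m <= f z.
Proof.
move=> a0 ab cf; have cw : {within `[a, b], continuous f}.
  apply: continuous_in_subspaceT => z; rewrite inE /= in_itv/= => /andP[az _].
  by apply: (cf _ _).1; exact: lt_le_trans az.
have [c cI cP] := EVT_min ab cw.
exists (f c).
  by apply: (cf _ _).2; move: cI; rewrite in_itv/= => /andP[ac _]; exact: lt_le_trans ac.
by move=> z zI; apply: cP; rewrite in_itv.
Qed.

(* Strict convexity of the potential on [a, M] controls the relative potential from
   below; densities below a stay at a positive distance from the reference. *)
Lemma relative_potential_quadratic (a M kap z zb : R) : 0 < a -> 0 < kap ->
  (forall s, a <= s <= M -> kap <= h2 s) -> a <= z <= M -> a <= zb <= M ->
  kap / 2 * (z - zb) ^+ 2 <= relative h z zb.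
Proof.
move=> a0 kap0 hk /andP[az zM] /andP[ab bM].
have z0 := lt_le_trans a0 az; have b0 := lt_le_trans a0 ab.
rewrite /relative deriv_ge0_gt0// -/h1.
have D1 (s : R) : is_derive s 1 (fun s : R => (s - zb) ^+ 2) (2 * (s - zb)).
  have Ds : is_derive s 1 (fun s : R => s - zb) 1.
    exact: (is_derive_eq (is_deriveB (is_derive_id s 1) (is_derive_cst zb s 1)) (subr0 _)).
  rewrite (_ : (fun s : R => _) = (fun s : R => (s - zb) * (s - zb))); last first.
    by apply/funext => x; rewrite expr2.
  by apply: is_derive_eq (is_derive_mul Ds Ds) _; ring.
pose k s := h s - h1 zb * s - kap / 2 * (s - zb) ^+ 2.
have Dk (s : R) : 0 < s -> is_derive s 1 k (h1 s - h1 zb - kap * (s - zb)).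
  move=> s0.
  have D2 := is_deriveB (is_deriveB (is_derive_potential s0)
    (is_derive_mul (is_derive_cst (h1 zb) s 1) (is_derive_id s 1)))
    (is_derive_mul (is_derive_cst (kap / 2) s 1) (D1 s)).
  by apply: is_derive_eq D2 _; rewrite !mul0r !add0r mulr1; congr (_ - _); rewrite [LHS](_ : _ = kap / 2 * (2 * (s - zb)))//; field.
have step (x y : R) : a <= x -> x < y -> y <= M -> kap * (y - x) <= h1 y - h1 x.
  move=> ax xy yM.
  have [s /andP[xs sy] ->] := mean_value_gt0 is_derive_potential2 (lt_le_trans a0 ax) xy.
  rewrite ler_wpM2r ?subr_ge0 ?(ltW xy)// hk// (le_trans ax (ltW xs))/=.
  exact: le_trans (ltW sy) yM.
suff : k zb <= k z by rewrite /k subrr expr0n/= mulr0 subr0; lra.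
have [zz|zz|->//] := ltgtP z zb.
- have [s /andP[zs sb] E] := mean_value_gt0 Dk z0 zz.
  have := step _ _ (le_trans az (ltW zs)) sb bM; nra.
- have [s /andP[bs sz] E] := mean_value_gt0 Dk b0 zz.
  have := step _ _ ab bs (le_trans (ltW sz) zM); nra.
Qed.

(** The derivative of h(. | zb) is h'(s) - h'(zb), negative below [zb]. *)
Lemma relative_potential_decreasing (a z zb : R) : 0 <= z -> z <= a -> 0 < a -> a <= zb ->
  relative h a zb <= relative h z zb.
Proof.
move=> z0 za a0 ab; have b0 := lt_le_trans a0 ab.
rewrite /relative deriv_ge0_gt0// -/h1.
move: za; rewrite le_eqVlt => /predU1P[->//|za].
have [s /andP[zs sa] E] := mean_value_ge0 h_cont is_derive_potential z0 za.
have := potential1_lt (le_lt_trans z0 zs) (lt_le_trans sa ab); nra.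
Qed.

(** The densities are split at a = m / 2. Above [a], Young's inequality and the Lipschitz bound on
    [p] meet the quadratic lower bound, and the kinetic term has the weight z >= a. Below [a] the
    left-hand side is merely bounded, but the relative potential stays away from 0. *)
Lemma flux_control (m M U : R) : 0 < m -> m <= M -> 0 <= U ->
  exists2 C : R, 0 <= C & forall z zb u ub : R, 0 <= z <= M -> m <= zb <= M ->
    `|u| <= U -> `|ub| <= U ->
    `|(u - ub) * (p z - p zb)| <= C * (z * (u - ub) ^+ 2 + relative h z zb).
Proof.
move=> m0 mM U0; pose a := m / 2.
have a0 : 0 < a by rewrite divr_gt0.
have am : a <= m by rewrite /a; lra.
have aM : a <= M by exact: le_trans mM.
have [kap kap0 hk] := pos_segment_lower_bound a0 aM
  (fun z z0 => conj (continuous_potential2 z0) (potential2_gt0 z0)).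
have [P P0 HP] := pos_segment_bounded M a0 continuous_pressure_derivative.
have [B B0 HB] : exists2 B : R, 0 <= B & forall z, 0 <= z <= M -> `|p z| <= B.
  apply: continuous_segment_bounded; apply: continuous_subspaceW p_cont => z /=.
  by rewrite !in_itv/= andbT => /andP[].
(* Quadratic lower bound at the density [a], whose distance to the reference is at least m / 2. *)
pose r := kap / 2 * (m / 2) ^+ 2.
have r0 : 0 < r by rewrite mulr_gt0 ?divr_gt0// exprn_gt0// divr_gt0.
have c1 : 0 <= (2 * a)^-1 by rewrite invr_ge0 mulr_ge0// ltW.
have c2 : 0 <= P ^+ 2 / kap by rewrite divr_ge0 ?sqr_ge0 ?ltW.
have c3 : 0 <= 4 * U * B / r by rewrite divr_ge0 ?mulr_ge0// ltW.
(* In this order: division of the kinetic term by [a], Lipschitz constant [P] against convexity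
   [kap], and the crude bound 2 U times 2 B against [r]. *)
exists ((2 * a)^-1 + P ^+ 2 / kap + 4 * U * B / r).
  by apply: addr_ge0 => //; exact: addr_ge0.
move=> z zb u ub /andP[z0 zM] /andP[mb bM] uU ubU.
have b0 : 0 < zb by exact: lt_le_trans mb.
have rel0 := relative_potential_ge0 z0 b0.
have v0 : 0 <= z * (u - ub) ^+ 2 by rewrite mulr_ge0// sqr_ge0.
set rel := relative h z zb in rel0 *; set v := z * _ in v0 *.
have [az|za] := leP a z.
- have Q := relative_potential_quadratic a0 kap0 hk (z := z) (zb := zb).
  rewrite az zM bM (le_trans am mb) -/rel in Q; have {}Q := Q isT isT.
  have Lp : `|p z - p zb| <= P * `|z - zb|.
    have Lip (x y : R) : a <= x -> x < y -> y <= M -> `|p y - p x| <= P * `|y - x|.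
      move=> ax xy yM.
      have [s /andP[xs sy] ->] := mean_value_gt0 is_derive_pressure (lt_le_trans a0 ax) xy.
      rewrite normrM ler_wpM2r// HP// (le_trans ax (ltW xs))/=.
      exact: le_trans (ltW sy) yM.
    have [zz|zz|->] := ltgtP z zb; last by rewrite !subrr normr0 mulr0.
    + by rewrite distrC [`|z - zb|]distrC; exact: Lip.
    + by apply: Lip => //; exact: le_trans mb.
  have young (x y : R) : `|x * y| <= (x ^+ 2 + y ^+ 2) / 2.
    have s1 := sqr_ge0 (x - y); have s2 := sqr_ge0 (x + y).
    by rewrite ler_norml; apply/andP; split; nra.
  apply: le_trans (young _ _) _.
  have p2 : (p z - p zb) ^+ 2 <= P ^+ 2 * (z - zb) ^+ 2.
    rewrite -[leLHS](real_normK (num_real _)) -[(z - zb) ^+ 2](real_normK (num_real _)).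
    by rewrite -exprMn lerXn2r ?nnegrE ?mulr_ge0.
  have p3 : P ^+ 2 * (z - zb) ^+ 2 / 2 <= P ^+ 2 / kap * rel.
    have := ler_wpM2l c2 Q; apply: le_trans.
    by rewrite le_eqVlt; apply/orP; left; apply/eqP; field; rewrite gt_eqF.
  have p4 : (u - ub) ^+ 2 / 2 <= (2 * a)^-1 * v.
    rewrite [leRHS]mulrC ler_pdivlMr ?mulr_gt0// /v.
    rewrite (_ : _ / 2 * (2 * a) = a * (u - ub) ^+ 2); last by field.
    by rewrite ler_wpM2r// sqr_ge0.
  have := mulr_ge0 c1 rel0; have := mulr_ge0 c2 v0.
  have := mulr_ge0 c3 (addr_ge0 v0 rel0); nra.
- have Q : r <= rel.
    apply: le_trans (relative_potential_decreasing z0 (ltW za) a0 (le_trans am mb)).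
    apply: le_trans (relative_potential_quadratic a0 kap0 hk _ _); last 2 first.
    + by rewrite lexx aM.
    + by rewrite (le_trans am mb) bM.
    rewrite /r ler_wpM2l ?divr_ge0 ?(ltW kap0)//.
    have d1 : m / 2 <= zb - a by rewrite /a; lra.
    have d2 : 0 <= m / 2 by exact: ltW.
    by move: d1 d2; move: (m / 2) => y d1 d2; nra.
  have n1 : `|(u - ub) * (p z - p zb)| <= (U + U) * (B + B).
    rewrite normrM ler_pM//; apply: le_trans (ler_normB _ _) _; apply: lerD => //.
    + by apply: HB; rewrite z0 zM.
    + by apply: HB; rewrite (ltW b0) bM.
  apply: le_trans n1 _.
  have := ler_wpM2l c3 Q; rewrite divfK ?gt_eqF// => n2.
  have := mulr_ge0 c1 (addr_ge0 v0 rel0); have := mulr_ge0 c2 (addr_ge0 v0 rel0).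
  have := mulr_ge0 c3 v0; nra.
Qed.

End Pressure.

(** * Pressure and potential near the vacuum *)

Section VacuumPressure.
Context {R : realType}.
Variables p h : R -> R.
Hypotheses (p_cont : {within `[0, +oo[, continuous p})
  (p_C1 : C1_pos p)
  (p_incr : forall z : R, 0 < z -> 0 < derive1 p z)
  (h_cont : {within `[0, +oo[, continuous h})
  (h_C2 : C2_pos h)
  (h_potential : forall z : R, 0 < z -> p z = z * derive1 h z - h z).

Lemma continuous_pressure (z : R) : 0 < z -> {for z, continuous p}.
Proof.
by move=> z0; apply: differentiable_continuous; apply/derivable1_diffP; have [] := p_C1 z0.
Qed.

Lemma pressure_increasing (x y : R) : 0 <= x -> x <= y -> p x <= p y.
Proof.
move=> x0; rewrite le_eqVlt => /predU1P[->//|xy].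
have [s /andP[xs _] E] := mean_value_ge0 p_cont (is_derive_pressure p_C1) x0 xy.
rewrite -subr_ge0 E mulr_ge0 ?subr_ge0 ?(ltW xy)//; apply/ltW/p_incr.
exact: le_lt_trans xs.
Qed.

(** This is the relation p = z h' - h divided by z^2. The shift [a] takes the values 0 and p(0). *)
Lemma is_derive_potential_ratio (a z : R) : 0 < z ->
  is_derive z 1 (fun z : R => (h z + a) / z) ((p z - a) / z ^+ 2).
Proof.
move=> z0; have DV : is_derive z 1 (fun z : R => z^-1) (- z ^- 2).
  by have := @is_deriveV _ id z 1 1 (lt0r_neq0 z0) _; rewrite [_ *: _]mulr1; apply.
have Da : is_derive z 1 (fun z : R => h z + a) (derive1 h z).
  exact: (is_derive_eq (is_derive_add (is_derive_potential h_C2 z0) (is_derive_cst a z 1)) (addr0 _)).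
apply: is_derive_eq (is_derive_mul Da DV) _.
by rewrite h_potential//; field; rewrite gt_eqF.
Qed.

Hypothesis vacuum : vacuum_pressure_condition p.

Lemma pressure_gt0 (z : R) : 0 < z -> 0 < p z.
Proof.
move=> z0; have [[c c0 cP] _] := vacuum.
have := lt_le_trans (p_incr z0) (cP z z0).
by rewrite pmulr_rgt0// pmulr_lgt0// invr_gt0.
Qed.

Let ratio (z : R) : R := h z / z.

Let Dratio (z : R) : 0 < z -> is_derive z 1 ratio (p z / z ^+ 2).
Proof.
move=> z0; have := is_derive_potential_ratio 0 z0; rewrite subr0.
by rewrite (_ : (fun z => _) = ratio)//; apply/funext => x; rewrite addr0.
Qed.

Let ratio_nondecreasing (x y : R) : 0 < x -> x <= y -> ratio x <= ratio y.
Proof.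
move=> x0; rewrite le_eqVlt => /predU1P[->//|xy].
have [s /andP[xs _] E] := mean_value_gt0 Dratio x0 xy.
have s0 := lt_trans x0 xs.
by rewrite -subr_ge0 E mulr_ge0 ?subr_ge0 ?(ltW xy)// divr_ge0 ?sqr_ge0// ltW ?pressure_gt0.
Qed.

Let cratio (z : R) : 0 < z -> {for z, continuous (fun z => p z / z ^+ 2)}.
Proof.
move=> z0; apply: cvgM; first exact: continuous_pressure.
by apply: cvgV; [rewrite expf_neq0// gt_eqF|exact: exprn_continuous].
Qed.

(** The increments of [ratio] are integrals of p / z^2, which converge at 0 by the vacuum
    condition. *)
Let ratio_bounded : exists b : R, forall z, 0 < z -> b <= ratio z.
Proof.
have [_ I] := vacuum; set J := (\int[leb R]_(z in _) _)%E in I.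
have J0 : (0 <= J)%E.
  apply: integral_ge0 => z; rewrite /= in_itv/= => /andP[z0 _].
  by rewrite lee_fin divr_ge0 ?sqr_ge0// ltW ?pressure_gt0.
exists (ratio 1 - fine J) => z z0.
have [z1|z1] := leP 1 z.
  apply: le_trans (ratio_nondecreasing ltr01 z1).
  by rewrite gerBl fine_ge0.
have E : (\int[leb R]_(x in `[z, 1%R]) (p x / x ^+ 2)%:E = (ratio 1 - ratio z)%:E)%E.
  apply: FTC_segment => //.
  - by move=> x /andP[zx _]; apply: Dratio; exact: lt_le_trans zx.
  - apply: continuous_in_subspaceT => x; rewrite inE/= in_itv/= => /andP[zx _].
    by apply: cratio; exact: lt_le_trans zx.
have : ((ratio 1 - ratio z)%:E <= J)%E.
  rewrite -E; apply: ge0_subset_integral.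
  - exact: measurable_itv.
  - exact: measurable_itv.
  - apply/measurable_EFinP.
    have M : measurable_fun (`]0%R, +oo[%classic : set (measurableTypeR R)) (fun z => p z / z ^+ 2).
      apply: open_continuous_measurable_fun; first exact: interval_open.
      by move=> x; rewrite inE/= in_itv/= andbT; exact: cratio.
    apply: measurable_funS M; first exact: measurable_itv.
    by move=> x; rewrite /= !in_itv/= andbT => /andP[].
  - move=> x; rewrite /= in_itv/= => /andP[x0 _].
    by rewrite lee_fin divr_ge0 ?sqr_ge0// ltW ?pressure_gt0.
  - by move=> x; rewrite /= !in_itv/= => /andP[zx ->]; rewrite (lt_le_trans z0 zx).
rewrite -[J]fineK ?ge0_fin_numE// lee_fin; lra.
Qed.

Let h_right : h x @[x --> 0^'+] --> h 0.
Proof. by have /continuous_within_itvcyP[] := h_cont. Qed.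

(** h(z) is z times [ratio], which is bounded near 0; let z tend to 0. *)
Lemma vacuum_potential0 : h 0 = 0.
Proof.
have [b bP] := ratio_bounded.
have L (c : R) : z * c @[z --> 0^'+] --> (0 : R).
  rewrite -[X in _ --> X](mul0r c); apply: cvgM; last exact: cvg_cst.
  by apply: cvg_at_right_filter; exact: cvg_id.
apply/eqP; rewrite eq_le; apply/andP; split.
  apply: (ler_cvg_to h_right (L (ratio 1))); near=> z.
  have z0 : 0 < z by near: z; exact: nbhs_right_gt.
  have z1 : z <= 1 by near: z; exact: nbhs_right_le.
  by rewrite mulrC -ler_pdivrMr//; exact: ratio_nondecreasing.
apply: (ler_cvg_to (L b) h_right); near=> z.
have z0 : 0 < z by near: z; exact: nbhs_right_gt.
by rewrite mulrC -ler_pdivlMr//; exact: bP.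
Unshelve. all: by end_near. Qed.

Let slope := deriv_ge0 h 0.

(** [ratio] is nondecreasing and bounded below, so its limit at 0 exists and is its infimum. As h(0)
    = 0, this limit is h'(0): the value [deriv_ge0 h 0] is a genuine derivative. *)
Let slope_le (z : R) : 0 < z -> slope <= ratio z.
Proof.
move=> z0; have [b bP] := ratio_bounded.
rewrite /slope /deriv_ge0 ltxx vacuum_potential0.
have -> : (fun e : R => (h e - 0) / e) = ratio by apply/funext => e; rewrite subr0.
have C : cvg (ratio x @[x --> 0^'+]).
  apply: nondecreasing_at_right_is_cvgr.
    near=> y => u v; rewrite !in_itv/= => /andP[u0 _] _ uv; exact: ratio_nondecreasing.
  near=> y; exists b => _ [u /= + <-]; rewrite in_itv/= => /andP[u0 _]; exact: bP.
apply: limr_le => //; near=> e.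
have e0 : 0 < e by near: e; exact: nbhs_right_gt.
apply: ratio_nondecreasing => //; near: e; exact: nbhs_right_le.
Unshelve. all: by end_near. Qed.

Lemma vacuum_relative_ge0 (z : R) : 0 <= z -> 0 <= relative h z 0.
Proof.
rewrite le_eqVlt => /predU1P[<-|z0]; first by rewrite /relative !subrr mulr0 subr0.
rewrite /relative vacuum_potential0 !subr0 subr_ge0 -ler_pdivlMr//.
exact: slope_le.
Qed.

(** Since p >= p(0), the quotient (h + p(0)) / z is nondecreasing, so near 0 the numerator is at
    most a multiple of z; let z tend to 0. *)
Lemma vacuum_pressure0 : p 0 <= 0.
Proof.
have mono (z : R) : 0 < z -> z < 1 -> h z + p 0 <= z * (h 1 + p 0).
  move=> z0 z1.
  have [s /andP[zs _] E] := mean_value_gt0 (is_derive_potential_ratio (p 0)) z0 z1.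
  have s0 := lt_trans z0 zs.
  have : (h z + p 0) / z <= (h 1 + p 0) / 1.
    rewrite -subr_ge0 E mulr_ge0 ?subr_ge0 ?(ltW z1)// divr_ge0 ?sqr_ge0//.
    by rewrite subr_ge0 pressure_increasing// ltW.
  by rewrite divr1 ler_pdivrMr// mulrC.
have A : h z + p 0 @[z --> 0^'+] --> p 0.
  have H : h z + p 0 @[z --> 0^'+] --> h 0 + p 0 by apply: cvgD => //; exact: cvg_cst.
  by rewrite vacuum_potential0 add0r in H.
have B : z * (h 1 + p 0) @[z --> 0^'+] --> (0 : R).
  rewrite -[X in _ --> X](mul0r (h 1 + p 0)); apply: cvgM; last exact: cvg_cst.
  by apply: cvg_at_right_filter; exact: cvg_id.
apply: (ler_cvg_to A B); near=> z.
by apply: mono; near: z; [exact: nbhs_right_gt|apply: nbhs_right_lt].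
Unshelve. all: by end_near. Qed.

(** The function p - c h(. | 0) is at most 0 at 0 and nonincreasing, as p' <= c p / z = c (h' - h /
    z) <= c (h' - h'(0)). *)
Lemma vacuum_pressure_control : exists2 c : R, 0 <= c &
  forall z : R, 0 < z -> `|p z| <= c * relative h z 0.
Proof.
have [[c c0 cP] _] := vacuum; exists c; first exact: ltW.
move=> z z0; rewrite ger0_norm ?(ltW (pressure_gt0 z0))//.
rewrite /relative vacuum_potential0 !subr0 -/slope.
pose k x := p x - c * (h x - slope * x).
have ck : {within `[0, +oo[, continuous k}.
  move=> x; apply: cvgB; first exact: p_cont.
  apply: cvgM; first exact: cvg_cst.
  apply: cvgB; first exact: h_cont.
  apply: cvgM; first exact: cvg_cst.
  by apply: continuous_subspaceT => y; exact: cvg_id.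
have Dk (x : R) : 0 < x -> is_derive x 1 k (derive1 p x - c * (derive1 h x - slope)).
  move=> x0.
  have D1 := is_derive_mul (is_derive_cst slope x 1) (is_derive_id x 1).
  have D2 := is_deriveB (is_derive_potential h_C2 x0) D1.
  have D3 := is_derive_mul (is_derive_cst c x 1) D2.
  have D4 := is_deriveB (is_derive_pressure p_C1 x0) D3.
  by apply: is_derive_eq D4 _; rewrite !mul0r !add0r mulr1.
have [s /andP[s0 _] E] := mean_value_ge0 ck Dk (lexx 0) z0.
have dk : derive1 p s - c * (derive1 h s - slope) <= 0.
  rewrite subr_le0; apply: le_trans (cP s s0) _; rewrite ler_wpM2l ?(ltW c0)//.
  have -> : p s / s = derive1 h s - ratio s.
    by rewrite h_potential// /ratio; field; rewrite gt_eqF.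
  by rewrite lerB// slope_le.
have : k z <= k 0.
  by rewrite -subr_le0 E subr0; apply: mulr_le0_ge0 => //; exact: ltW.
rewrite /k vacuum_potential0 mulr0 !subr0 mulr0 subr0 => H.
by rewrite -subr_le0; apply: le_trans H vacuum_pressure0.
Qed.

End VacuumPressure.

(** * Superposition of balance laws *)

Section Multipliers.
Context {R : realType}.
Local Notation R2 := (measurableTypeR R * measurableTypeR R)%type.
Local Notation ohp := (@open_half_plane R).

Let eps (n : nat) : R := n.+1%:R^-1.
Let eps0 n : 0 < eps n. Proof. by rewrite /eps invr_gt0. Qed.
Let eps1 n : eps n <= 1. Proof. by rewrite /eps invf_le1// ler1n. Qed.

Lemma C1_test_integrable a b c f f1 f2 (T Y : R) : L1box a -> L1box b -> L1box c ->
  C1_test f f1 f2 T Y -> (leb2 R).-integrable ohp (EFin \o balance_integrand a b c f f1 f2).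
Proof.
move=> ia ib ic [CC Z]; apply: (@integrable_pbox _ _ T Y).
  move=> x _ H; have [|z0 z1 z2] := Z x; first by case: H => /ltW; [left|right].
  by rewrite /balance_integrand z0 z1 z2 !mul0r !addr0.
by apply: L1box_add; first apply: L1box_add; apply: L1box_continuous_mul => // x; case: (CC x).
Qed.

Lemma continuous_cutoff n (x : R * R) : {for x, continuous (fun x : R * R => cutoff (eps n) x.1)}.
Proof.
apply: (@continuous_comp _ _ _ fst (cutoff (eps n))); first exact: cvg_fst.
apply: differentiable_continuous; apply/derivable1_diffP.
by case: (is_derive_cutoff (eps n) x.1).
Qed.

Lemma continuous_dcutoff2 n (x : R * R) : {for x, continuous (fun x : R * R => dcutoff (eps n) x.1)}.
Proof.
apply: (@continuous_comp _ _ _ fst (dcutoff (eps n))); first exact: cvg_fst.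
exact: continuous_dcutoff.
Qed.

(* G need not be differentiable at t = 0: the cut-off vanishes there. *)
Lemma C1_test_cutoff_mul n f f1 f2 (T Y : R) (G Gt Gy : R * R -> R) :
  C1_test f f1 f2 T Y -> (forall x, ohp x -> C1_at G Gt Gy x) ->
  C1_test (fun x => cutoff (eps n) x.1 * (f x * G x))
    (fun x => dcutoff (eps n) x.1 * (f x * G x) + cutoff (eps n) x.1 * (f1 x * G x + f x * Gt x))
    (fun x => cutoff (eps n) x.1 * (f2 x * G x + f x * Gy x)) T Y.
Proof.
move=> [CC Z] CG; split=> [x|x /Z[z0 z1 z2]]; last by rewrite z0 z1 z2; split; ring.
have [x0|x0] := ltP 0 x.1.
  have C0 := C1_at_time (is_derive_cutoff (eps n) x.1) (@continuous_dcutoff R (eps n)).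
  have := C1_at_mul C0 (C1_at_mul (CC x) (CG x x0)).
  by apply: near_eq_C1_at; near=> z; rewrite mul0r add0r.
apply: near_eq_C1_at (C1_at_cst 0 x).
have c : {for x, continuous (fst : R * R -> R)} by exact: cvg_fst.
near=> z.
have ze : z.1 < eps n.
  near: z; apply: (c [set t | t < eps n] _); apply: lt_nbhsl.
  exact: (le_lt_trans x0 (eps0 n)).
by have [-> ->] := cutoff_small (eps0 n) (ltW ze); rewrite !mul0r addr0.
Unshelve. all: by end_near. Qed.

(** Cut-off, test function and multiplier together form an admissible test function, and the initial
    term vanishes with the cut-off. The terms of [J] are sorted so that the one with [dcutoff] can
    be sent to its trace. *)
Lemma cutoff_multiplier n a b c r0 f f1 f2 (T Y : R) (G Gt Gy : R * R -> R) :
  0 < T -> 0 < Y -> L1box a -> L1box b -> L1box c -> weak_balance a b c r0 ->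
  C1_test f f1 f2 T Y -> (forall x, ohp x -> C1_at G Gt Gy x) ->
  let J x := cutoff (eps n) x.1 * balance_integrand (fun x => G x * a x) (fun x => G x * b x)
      (fun x => G x * c x + Gt x * a x + Gy x * b x) f f1 f2 x +
    dcutoff (eps n) x.1 * (f x * G x) * a x in
  (leb2 R).-integrable ohp (EFin \o J) /\ \int[leb2 R]_(x in ohp) J x = 0.
Proof.
move=> T0 Y0 ia ib ic W tf CG J; have tF := C1_test_cutoff_mul n tf CG.
have E : J = balance_integrand a b c (fun x => cutoff (eps n) x.1 * (f x * G x))
    (fun x => dcutoff (eps n) x.1 * (f x * G x) + cutoff (eps n) x.1 * (f1 x * G x + f x * Gt x))
    (fun x => cutoff (eps n) x.1 * (f2 x * G x + f x * Gy x)).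
  by apply/funext => x; rewrite /J /balance_integrand; ring.
split; first by rewrite E; exact: C1_test_integrable tF.
rewrite E (W _ _ _ _ _ T0 Y0 tF) /Rintegral integral0_eq ?oppr0// => y _.
by rewrite /= (cutoff_small (eps0 n) (ltW (eps0 n))).1 !mul0r.
Qed.

Lemma L1seg_one : L1seg (fun=> 1 : R).
Proof.
move=> Y; apply: measurable_bounded_integrable; first exact: measurable_itv.
- have [Y0|Y0] := leP 0 Y; first by rewrite leb_seg// ltry.
  by rewrite set_itv_ge ?measure0// bnd_simp -ltNge; lra.
- exact: measurable_cst.
- by exists 1; split; [exact: num_real|move=> z z1 x _ /=; rewrite normr1 ltW].
Qed.

Section Superposition.
Variables (a1 b1 c1 a2 b2 c2 : R * R -> R) (r1 r2 : R -> R).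
Hypotheses (ia1 : L1box a1) (ib1 : L1box b1) (ic1 : L1box c1) (ir1 : L1seg r1)
  (ia2 : L1box a2) (ib2 : L1box b2) (ic2 : L1box c2) (ir2 : L1seg r2)
  (W1 : weak_balance a1 b1 c1 r1) (W2 : weak_balance a2 b2 c2 r2)
  (ba1 : forall T Y, exists M, forall x, pbox T Y x -> `|a1 x| <= M)
  (ba2 : forall T Y, exists M, forall x, pbox T Y x -> `|a2 x| <= M).
Variables (G1 G1t G1y G2 G2t G2y P Pt Py Q Qt Qy : R * R -> R).
Hypotheses (CG1 : forall x, ohp x -> C1_at G1 G1t G1y x)
  (CG2 : forall x, ohp x -> C1_at G2 G2t G2y x)
  (CP : forall x, ohp x -> C1_at P Pt Py x)
  (CQ : forall x, ohp x -> C1_at Q Qt Qy x)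
  (cG1 : forall x : R * R, {for x, continuous G1}) (cG2 : forall x : R * R, {for x, continuous G2})
  (cP : forall x : R * R, {for x, continuous P}) (cQ : forall x : R * R, {for x, continuous Q}).

(** [G1] and [G2] multiply the two given balances, while - P and Q are added through the trivial
    ones. In [super_c] the product rule leaves derivatives of all four. *)
Definition super_a (x : R * R) : R := G1 x * a1 x + G2 x * a2 x - P x.
Definition super_b (x : R * R) : R := G1 x * b1 x + G2 x * b2 x + Q x.
Definition super_c (x : R * R) : R :=
  G1 x * c1 x + G1t x * a1 x + G1y x * b1 x + (G2 x * c2 x + G2t x * a2 x + G2y x * b2 x)
  - Pt x + Qy x.

Hypothesis isc : L1box super_c.

Let L1cst (k : R) : L1box (fun=> k).
Proof.
apply: L1box_bounded; first exact: measurable_cst.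
by move=> T Y; exists `|k|.
Qed.

Let L1P (g : R * R -> R) : (forall x : R * R, {for x, continuous g}) -> L1box g.
Proof.
move=> cg; have := L1box_continuous_mul cg (L1cst 1).
by rewrite (_ : (fun x => _) = g)//; apply/funext => x; rewrite mulr1.
Qed.

Lemma L1box_super_a : L1box super_a.
Proof.
apply: L1box_add; last by apply: L1box_opp; exact: L1P.
by apply: L1box_add; exact: L1box_continuous_mul.
Qed.

Lemma L1box_super_b : L1box super_b.
Proof.
apply: L1box_add; last exact: L1P.
by apply: L1box_add; exact: L1box_continuous_mul.
Qed.

(** Derivatives of the multipliers may blow up at tau = 0, where integrability is assumed for
    [super_c] as a whole. So the four balances are added under the cut-off, which makes each of them
    integrable; then dominated convergence treats the sum, and [initial_trace] treats the boundary
    terms. *)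
Lemma super_balance :
  weak_balance super_a super_b super_c
    (fun y => G1 (0, y) * r1 y + G2 (0, y) * r2 y - P (0, y)).
Proof.
move=> f f1 f2 T Y T0 Y0 tf; have mo := @measurable_ohp R; have [CC Z] := tf.
have cf (x : R * R) : {for x, continuous f} by case: (CC x).
(* The trivial balances, to be multiplied by [P] and by [Q]. *)
have W3 := @weak_balance_time R; have W4 := @weak_balance_space R.
pose S := balance_integrand super_a super_b super_c f f1 f2.
have iS : (leb2 R).-integrable ohp (EFin \o S).
  by apply: C1_test_integrable tf => //; [exact: L1box_super_a|exact: L1box_super_b].
pose tr n (G a : R * R -> R) (x : R * R) := dcutoff (eps n) x.1 * (f x * G x) * a x.
have itr n (G a : R * R -> R) : (forall x : R * R, {for x, continuous G}) -> L1box a ->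
    (leb2 R).-integrable ohp (EFin \o tr n G a).
  move=> cG ia; apply: (@integrable_pbox _ _ T Y).
    move=> x _ H; have [|z0 _ _] := Z x; first by case: H => /ltW; [left|right].
    by rewrite /tr z0 mul0r mulr0 mul0r.
  apply: (L1box_continuous_mul (G := fun x => dcutoff (eps n) x.1 * (f x * G x))) => // x.
  apply: cvgM; first exact: continuous_dcutoff2.
  by apply: cvgM; [exact: cf|exact: cG].
have ltr (G Gt Gy a b c : R * R -> R) (r0 : R -> R) :
    (forall x : R * R, {for x, continuous G}) -> (forall x, ohp x -> C1_at G Gt Gy x) ->
    L1box a -> L1box b -> L1box c -> L1seg r0 -> weak_balance a b c r0 ->
    (forall T Y, exists M, forall x, pbox T Y x -> `|a x| <= M) ->
    \int[leb2 R]_(x in ohp) tr n G a x @[n --> \oo] --> \int[leb R]_y (f (0, y) * G (0, y) * r0 y).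
  move=> cG CG ia ib ic ir W ba; have [M HM] := ba 2 Y.
  apply: (initial_trace (gy := fun x => f2 x * G x + f x * Gy x) Y0 ia ib ic ir W HM).
  - by move=> x; apply: cvgM; [exact: cf|exact: cG].
  - move=> s y s0; have [_ d2 _ _ cd2] := C1_at_mul (CC (s, y)) (CG (s, y) s0).
    by split; [exact/is_derive_section2|exact: continuous_section2 cd2].
  - move=> s y _ Yy; have [|z0 _ z2] := Z (s, y); first by right.
    by rewrite z0 z2 !mul0r addr0.
have L1 := ltr _ _ _ _ _ _ _ cG1 CG1 ia1 ib1 ic1 ir1 W1 ba1.
have L2 := ltr _ _ _ _ _ _ _ cG2 CG2 ia2 ib2 ic2 ir2 W2 ba2.
have b1' : forall T Y : R, exists M, forall x, pbox T Y x -> `|(1 : R)| <= M.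
  by move=> ? ?; exists 1 => x _; rewrite normr1.
have iseg1 := L1seg_one.
have L3 := ltr _ _ _ _ _ _ _ cP CP (L1cst 1) (L1cst 0) (L1cst 0) iseg1 W3 b1'.
have icS n : (leb2 R).-integrable ohp (EFin \o (fun x => cutoff (eps n) x.1 * S x)).
  apply: (integrable_mulb mo (M := 1)) => //.
    apply: measurable_funTS; apply: continuous_at_measurable => [|x _]; first exact: openT.
    exact: continuous_cutoff.
  move=> x _; have /andP[a b] := cutoff_itv (eps n) x.1.
  by rewrite ger0_norm.
have zero n : \int[leb2 R]_(x in ohp) (cutoff (eps n) x.1 * S x) +
    (\int[leb2 R]_(x in ohp) tr n G1 a1 x + \int[leb2 R]_(x in ohp) tr n G2 a2 x
     - \int[leb2 R]_(x in ohp) tr n P (fun=> 1) x) = 0.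
  have [j1 e1] := cutoff_multiplier n T0 Y0 ia1 ib1 ic1 W1 tf CG1.
  have [j2 e2] := cutoff_multiplier n T0 Y0 ia2 ib2 ic2 W2 tf CG2.
  have [j3 e3] := cutoff_multiplier n T0 Y0 (L1cst 1) (L1cst 0) (L1cst 0) W3 tf CP.
  have [j4 e4] := cutoff_multiplier n T0 Y0 (L1cst 0) (L1cst 1) (L1cst 0) W4 tf CQ.
  have t1 := itr n _ _ cG1 ia1; have t2 := itr n _ _ cG2 ia2.
  have t3 := itr n _ _ cP (L1cst 1).
  have j12 := integrable_add mo j1 j2; have j123 := integrable_sub mo j12 j3.
  have t12 := integrable_add mo t1 t2; have t123 := integrable_sub mo t12 t3.
  rewrite -(RintegralD mo t1 t2) -(RintegralB mo t12 t3) -(RintegralD mo (icS n) t123).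
  have := RintegralD mo j123 j4; rewrite (RintegralB mo j12 j3) (RintegralD mo j1 j2).
  rewrite e1 e2 e3 e4 !addr0 subrr => <-; apply: eq_Rintegral => x _.
  rewrite /tr /S /balance_integrand /super_a /super_b /super_c.
  by ring.
have L4 : \int[leb2 R]_(x in ohp) (cutoff (eps n) x.1 * S x) @[n --> \oo] -->
    \int[leb2 R]_(x in ohp) S x.
  have [||||//] := @Rdominated_cvg _ _ _ (leb2 R) ohp mo
    (fun n x => cutoff (eps n) x.1 * S x) S (fun x => `|S x|).
  - by move=> n; have /measurable_int/measurable_EFinP := icS n.
  - move=> x ox; rewrite -[X in _ --> X]mul1r; apply: cvgM; last exact: cvg_cst.
    exact: cutoff_cvg.
  - exact: integrable_norm.
  - move=> n x _; rewrite normrM; have /andP[a b] := cutoff_itv (eps n) x.1.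
    by rewrite ger0_norm// ler_piMl.
have iseg (k : R * R -> R) (r : R -> R) : (forall x : R * R, {for x, continuous k}) ->
    L1seg r -> (leb R).-integrable setT (EFin \o (fun y => f (0, y) * k (0, y) * r y)).
  move=> ck ir; apply: (@integrable_seg _ _ Y).
    by move=> y Yy; have [|-> _ _] := Z (0, y); [right; exact: ltW|rewrite !mul0r].
  have cfk (x : R * R) : {for x, continuous (fun x => f x * k x)}.
    by apply: cvgM; [exact: cf|exact: ck].
  have [M _ HM] := continuous_at_compact_bounded (@box_compact R 1 Y) (fun x _ => cfk x).
  apply: (@integrable_mulb _ _ R (leb R) `[- Y, Y]%classic (measurable_itv _) r
    (fun y => f (0, y) * k (0, y)) M).
  - apply: measurable_funTS; apply: continuous_measurable_fun => y.
    exact: (continuous_section2 (cfk (0, y))).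
  - move=> y; rewrite /= in_itv/= => yY; apply: (HM (0, y)).
    by apply/boxP; rewrite /= lexx ler01.
  - exact: ir.
have i1 := iseg _ _ cG1 ir1; have i2 := iseg _ _ cG2 ir2; have i3 := iseg _ _ cP iseg1.
have mT : measurable (setT : set (measurableTypeR R)) by [].
have i12 := integrable_add mT i1 i2.
rewrite (_ : \int[leb R]_y _ = \int[leb R]_y (f (0, y) * G1 (0, y) * r1 y) +
  \int[leb R]_y (f (0, y) * G2 (0, y) * r2 y) - \int[leb R]_y (f (0, y) * P (0, y) * 1)).
  pose F n := \int[leb2 R]_(x in ohp) (cutoff (eps n) x.1 * S x) +
      (\int[leb2 R]_(x in ohp) tr n G1 a1 x + \int[leb2 R]_(x in ohp) tr n G2 a2 x
       - \int[leb2 R]_(x in ohp) tr n P (fun=> 1) x).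
  have L0 : F @ \oo -->
      \int[leb2 R]_(x in ohp) S x + (\int[leb R]_y (f (0, y) * G1 (0, y) * r1 y) +
        \int[leb R]_y (f (0, y) * G2 (0, y) * r2 y) - \int[leb R]_y (f (0, y) * P (0, y) * 1)).
    by apply: cvgD => //; apply: cvgB => //; exact: cvgD.
  have F0 : F = cst 0 by apply/funext => n; exact: zero.
  rewrite F0 in L0.
  apply/eqP; rewrite -addr_eq0; apply/eqP.
  by apply: cvg_unique L0 (cvg_cst _).
rewrite -(RintegralD mT i1 i2) -(RintegralB mT i12 i3).
by apply: eq_Rintegral => y _; ring.
Qed.

End Superposition.
End Multipliers.

(** * The weak solution *)

Section BoundedMeasurable.
Context {R : realType}.
Local Notation R2 := (measurableTypeR R * measurableTypeR R)%type.
Local Notation ohp := (@open_half_plane R).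
Implicit Types f g : R * R -> R.

(** Unlike [L1box], this class is closed under products. *)
Definition bounded_mfun f : Prop := measurable_fun (ohp : set R2) f /\
  forall T Y, exists M, forall x, pbox T Y x -> `|f x| <= M.

Lemma bounded_mfun_L1box f : bounded_mfun f -> L1box f.
Proof. by case=> mf bf; exact: L1box_bounded. Qed.

Lemma bounded_mfun_cst c : bounded_mfun (fun=> c).
Proof. by split; [exact: measurable_cst|move=> T Y; exists `|c|]. Qed.

Lemma bounded_mfun_add f g : bounded_mfun f -> bounded_mfun g ->
  bounded_mfun (fun x => f x + g x).
Proof.
move=> [mf bf] [mg bg]; split; first exact: measurable_funD.
move=> T Y; have [A HA] := bf T Y; have [B HB] := bg T Y.
by exists (A + B) => x px; apply: le_trans (ler_normD _ _) _; rewrite lerD ?HA ?HB.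
Qed.

Lemma bounded_mfun_mul f g : bounded_mfun f -> bounded_mfun g ->
  bounded_mfun (fun x => f x * g x).
Proof.
move=> [mf bf] [mg bg]; split; first exact: measurable_funM.
move=> T Y; have [A HA] := bf T Y; have [B HB] := bg T Y.
by exists (A * B) => x px; rewrite normrM ler_pM ?HA ?HB.
Qed.

Lemma bounded_mfun_opp f : bounded_mfun f -> bounded_mfun (fun x => - f x).
Proof.
move=> bf; have := bounded_mfun_mul (bounded_mfun_cst (- 1)) bf.
by rewrite (_ : (fun x => _) = (fun x => - f x))//; apply/funext => x; rewrite mulN1r.
Qed.

Lemma bounded_mfun_continuous f : (forall x : R * R, {for x, continuous f}) -> bounded_mfun f.
Proof.
move=> cf; split; last exact: continuous_box_bounded.
by apply: measurable_funTS; apply: continuous_at_measurable => //; exact: openT.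
Qed.

(** [p] and [h] are continuous on [0, oo) only. Composition with [ramp] makes them continuous, hence
    Borel, on the line and keeps their values at nonnegative densities. *)
Lemma continuous_ramp_comp (f : R -> R) : {within `[0, +oo[, continuous f} ->
  continuous (fun t => f (ramp t)).
Proof.
move=> /continuous_within_itvcyP[cf f0] t.
have [t0|t0|->] := ltgtP t 0.
- have E : \forall s \near t, f 0 = f (ramp s).
    by near=> s; rewrite ramp_eq0//; apply/ltW; near: s; exact: lt_nbhsl.
  rewrite /continuous_at -(nbhs_singleton E).
  exact: cvg_trans (near_eq_cvg E) (cvg_cst _).
- apply: (@continuous_comp _ _ _ ramp f); first exact: continuous_ramp.
  by apply: cf; rewrite ramp_id ?ltW// in_itv/= t0.
- rewrite /continuous_at ramp_eq0//; apply/cvgrPdist_lt => e e0.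
  move/cvgrPdist_lt : f0 => /(_ e e0) [d /= d0 dP].
  near=> s; have [s0|s0] := leP s 0; first by rewrite ramp_eq0// subrr normr0.
  have sd : `|0 - s| < d.
    rewrite distrC subr0 gtr0_norm//; near: s; exact: lt_nbhsl.
  by rewrite ramp_id ?ltW//; exact: dP sd s0.
Unshelve. all: by end_near. Qed.

Lemma bounded_mfun_comp_ge0 (k : R -> R) f : {within `[0, +oo[, continuous k} ->
  bounded_mfun f -> (forall x, ohp x -> 0 <= f x) -> bounded_mfun (fun x => k (f x)).
Proof.
move=> ck [mf bf] f0; split.
  have m : measurable_fun (ohp : set R2) ((fun t => k (ramp t)) \o f).
    apply: measurableT_comp => //; apply: continuous_measurable_fun.
    exact: continuous_ramp_comp.
  apply: eq_measurable_fun m => x; rewrite inE => ox /=.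
  by rewrite ramp_id// f0.
move=> T Y; have [A HA] := bf T Y.
have [M _ HM] : exists2 M : R, 0 <= M & forall z, 0 <= z <= A -> `|k z| <= M.
  apply: continuous_segment_bounded; apply: continuous_subspaceW ck => z /=.
  by rewrite !in_itv/= andbT => /andP[].
exists M => x px; apply: HM; rewrite f0/=; last exact: pbox_ohp px.
exact: le_trans (ler_norm _) (HA x px).
Qed.

Lemma bounded_mfun_time (k : R -> R) : continuous k -> bounded_mfun (fun x => k x.1).
Proof.
move=> ck; apply: bounded_mfun_continuous => x.
by apply: (@continuous_comp _ _ _ fst k); [exact: cvg_fst|exact: ck].
Qed.

Lemma bounded_mfun_snd : bounded_mfun snd.
Proof. by apply: bounded_mfun_continuous => x; exact: cvg_snd. Qed.

End BoundedMeasurable.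

(** * Balance laws in terms of density and velocity *)

Section Fluxes.
Context {R : realType}.
Local Notation ohp := (@open_half_plane R).
Variables (alpha : R) (p h : R -> R) (r u : R * R -> R).

(** With the velocity in place of the momentum no quotient occurs, so boundedness of [r] and [u]
    passes to all densities and fluxes. *)
Definition mass_a : R * R -> R := r.
Definition mass_b (x : R * R) : R := - (x.2 / 2) * r x + r x * u x.
Definition mass_c (x : R * R) : R := - 2^-1 * r x.
Definition mom_a (x : R * R) : R := r x * u x.
Definition mom_b (x : R * R) : R :=
  - (x.2 / 2) * (r x * u x) + r x * (u x * u x) + expR x.1 * p (r x).
Definition mom_c (x : R * R) : R := - (expR x.1) * (alpha * (r x * u x)).
Definition ent (x : R * R) : R :=
  expR (- x.1) * (2^-1 * (r x * (u x * u x))) + h (r x).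
(** The term n h'(rho) is written u (p + h), by z h' = p + h. In this form it is continuous up to
    the vacuum, where h' may be unbounded. *)
Definition flux (x : R * R) : R :=
  expR (- x.1) * (2^-1 * (r x * (u x * (u x * u x)))) +
  u x * (p (r x) + h (r x)).
Definition ent_a (x : R * R) : R := - ent x.
Definition ent_b (x : R * R) : R := x.2 / 2 * ent x + - flux x.
Definition ent_c (x : R * R) : R := 2^-1 * ent x + alpha * (r x * (u x * u x)).

Hypotheses (p_cont : {within `[0, +oo[, continuous p})
  (h_cont : {within `[0, +oo[, continuous h})
  (br : bounded_mfun r) (bu : bounded_mfun u) (r_ge0 : forall x, ohp x -> 0 <= r x).

Let bp : bounded_mfun (fun x => p (r x)).
Proof. exact: bounded_mfun_comp_ge0 p_cont br r_ge0. Qed.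

Let bh : bounded_mfun (fun x => h (r x)).
Proof. exact: bounded_mfun_comp_ge0 h_cont br r_ge0. Qed.

Let half : bounded_mfun (fun x : R * R => x.2 / 2).
Proof. exact: bounded_mfun_mul bounded_mfun_snd (bounded_mfun_cst _). Qed.

Let ePos : bounded_mfun (fun x : R * R => expR x.1).
Proof. by apply: bounded_mfun_time; exact: continuous_expR. Qed.

Let eNeg : bounded_mfun (fun x : R * R => expR (- x.1)).
Proof.
apply: (bounded_mfun_time (k := fun t => expR (- t))) => t.
by apply: (@continuous_comp _ _ _ -%R expR); [apply: cvgN; exact: cvg_id|exact: continuous_expR].
Qed.

Let bru : bounded_mfun (fun x => r x * u x).
Proof. exact: bounded_mfun_mul. Qed.
Let bruu : bounded_mfun (fun x => r x * (u x * u x)).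
Proof. by apply: bounded_mfun_mul => //; exact: bounded_mfun_mul. Qed.

Lemma bounded_mfun_mass : [/\ bounded_mfun mass_a, bounded_mfun mass_b & bounded_mfun mass_c].
Proof.
split=> //.
  by apply: bounded_mfun_add => //; apply: bounded_mfun_mul => //; exact: bounded_mfun_opp.
by apply: bounded_mfun_mul => //; exact: bounded_mfun_cst.
Qed.

Lemma bounded_mfun_mom : [/\ bounded_mfun mom_a, bounded_mfun mom_b & bounded_mfun mom_c].
Proof.
split=> //.
  apply: bounded_mfun_add; last exact: bounded_mfun_mul.
  by apply: bounded_mfun_add => //; apply: bounded_mfun_mul => //; exact: bounded_mfun_opp.
apply: bounded_mfun_mul; first exact: bounded_mfun_opp.
by apply: bounded_mfun_mul => //; exact: bounded_mfun_cst.
Qed.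

Lemma bounded_mfun_ent_flux : bounded_mfun ent /\ bounded_mfun flux.
Proof.
split; apply: bounded_mfun_add => //.
- apply: bounded_mfun_mul => //; apply: bounded_mfun_mul => //; exact: bounded_mfun_cst.
- apply: bounded_mfun_mul => //; apply: bounded_mfun_mul; first exact: bounded_mfun_cst.
  by do 3! (apply: bounded_mfun_mul => //).
- by apply: bounded_mfun_mul => //; exact: bounded_mfun_add.
Qed.

Lemma bounded_mfun_entropy :
  [/\ bounded_mfun ent_a, bounded_mfun ent_b & bounded_mfun ent_c].
Proof.
have [be bf] := bounded_mfun_ent_flux; split.
- exact: bounded_mfun_opp.
- by apply: bounded_mfun_add; [exact: bounded_mfun_mul|exact: bounded_mfun_opp].
- by apply: bounded_mfun_add; apply: bounded_mfun_mul => //; exact: bounded_mfun_cst.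
Qed.

End Fluxes.

(** * Resetting the state on null sets *)

Section CleanState.
Context {R : realType}.
Local Notation R2 := (measurableTypeR R * measurableTypeR R)%type.
Local Notation ohp := (@open_half_plane R).
Variables (alpha : R) (p h : R -> R) (rho n : R * R -> R) (rho0 n0 : R -> R).
Variables (N : set R2) (N0 : set (measurableTypeR R)) (M : nat -> R).
Hypotheses (mN : measurable N) (muN : leb2 R N = 0)
  (mN0 : measurable N0) (muN0 : leb R N0 = 0)
  (mrho : measurable_fun (ohp : set R2) rho)
  (mvel : measurable_fun (ohp : set R2) (fun x => n x / rho x))
  (good : forall x : R * R, ohp x -> ~ N x ->
    [/\ 0 <= rho x, rho x = 0 -> n x = 0 &
        forall k : nat, x.1 <= k%:R -> `|rho x| <= M k /\ `|n x / rho x| <= M k])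
  (good0 : forall y : R, ~ N0 y -> 0 <= rho0 y /\ (rho0 y = 0 -> n0 y = 0))
  (irho0 : L1seg rho0) (in0 : L1seg n0).
Hypotheses (p_cont : {within `[0, +oo[, continuous p})
  (h_cont : {within `[0, +oo[, continuous h})
  (h_potential : forall z : R, 0 < z -> p z = z * derive1 h z - h z).

(* After resetting to 0 on null sets, the bounds and the sign of the density hold
   everywhere, and p and h are only evaluated at nonnegative numbers. *)
Definition dens (x : R * R) : R := \1_(~` N) x * rho x.
Definition vel (x : R * R) : R := \1_(~` N) x * (n x / rho x).
Definition dens0 (y : R) : R := \1_(~` N0) y * rho0 y.
Definition mom0 (y : R) : R := \1_(~` N0) y * n0 y.

Lemma dens_off x : ~ N x -> dens x = rho x /\ vel x = n x / rho x.
Proof. by move=> Nx; rewrite /dens /vel indicE mem_set// !mul1r. Qed.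

Lemma dens_on x : N x -> dens x = 0 /\ vel x = 0.
Proof. by move=> Nx; rewrite /dens /vel indicE memNset ?mul0r//; exact. Qed.

Lemma dens0_off y : ~ N0 y -> dens0 y = rho0 y /\ mom0 y = n0 y.
Proof. by move=> Nx; rewrite /dens0 /mom0 indicE mem_set// !mul1r. Qed.

Lemma dens0_on y : N0 y -> dens0 y = 0 /\ mom0 y = 0.
Proof. by move=> Nx; rewrite /dens0 /mom0 indicE memNset ?mul0r//; exact. Qed.

Lemma dens_ge0 x : ohp x -> 0 <= dens x.
Proof.
by move=> ox; have [/dens_on[-> //]|Nx] := pselect (N x); have [-> _] := dens_off Nx;
  case: (good ox Nx).
Qed.

Lemma vel_vacuum x : dens x = 0 -> vel x = 0.
Proof.
have [/dens_on[_ -> //]|/dens_off[-> ->] ->] := pselect (N x).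
by rewrite invr0 mulr0.
Qed.

Lemma momentum_off x : ohp x -> ~ N x -> dens x * vel x = n x.
Proof.
move=> ox Nx; have [-> ->] := dens_off Nx; have [_ vac _] := good ox Nx.
by have [r0|r0] := eqVneq (rho x) 0; [rewrite r0 mul0r vac|rewrite mulrC divfK].
Qed.

Lemma dens0_ge0 y : 0 <= dens0 y.
Proof.
have [/dens0_on[-> //]|Ny] := pselect (N0 y).
by have [-> _] := dens0_off Ny; case: (good0 Ny).
Qed.

Lemma mom0_vacuum y : dens0 y = 0 -> mom0 y = 0.
Proof.
have [/dens0_on[_ -> //]|Ny] := pselect (N0 y).
by have [-> ->] := dens0_off Ny; case: (good0 Ny).
Qed.

Lemma dens_vel_bound T : exists2 B : R, 0 <= B &
  forall x, ohp x -> x.1 <= T -> dens x <= B /\ `|vel x| <= B.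
Proof.
(* The bounds [M] are indexed by integers; one above |T| is taken. *)
pose k := Num.bound `|T|.
have Tk : T <= k%:R by apply: le_trans (ler_norm _) _; rewrite ltW// archi_boundP.
exists (Num.max 0 (M k)); first by rewrite le_max lexx.
move=> x ox xT; have [/dens_on[-> ->]|Nx] := pselect (N x).
  by rewrite normr0 le_max lexx.
have [-> ->] := dens_off Nx; have [_ _ /(_ k (le_trans xT Tk))[a b]] := good ox Nx.
by rewrite !le_max b (le_trans (ler_norm _) a) !orbT.
Qed.

Lemma bounded_mfun_dens : bounded_mfun dens.
Proof.
split; first by apply: measurable_funM => //; apply: measurable_funTS; exact/measurable_indicP/measurableC.
move=> T Y; have [B _ HB] := dens_vel_bound T; exists B => x px.
have ox := pbox_ohp px; have /pboxP[/andP[_ xT] _] := px.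
by rewrite ger0_norm ?dens_ge0//; case: (HB x ox xT).
Qed.

Lemma bounded_mfun_vel : bounded_mfun vel.
Proof.
split; first by apply: measurable_funM => //; apply: measurable_funTS; exact/measurable_indicP/measurableC.
move=> T Y; have [B _ HB] := dens_vel_bound T; exists B => x px.
have ox := pbox_ohp px; have /pboxP[/andP[_ xT] _] := px.
by case: (HB x ox xT).
Qed.

Lemma L1seg_dens0 : L1seg dens0.
Proof.
move=> Y; apply: (@integrable_mulb _ _ R (leb R) `[- Y, Y]%classic (measurable_itv _)
  rho0 (fun y => \1_(~` N0) y) 1).
- by apply: measurable_funTS; exact/measurable_indicP/measurableC.
- by move=> y _; rewrite indicE; case: (_ \in _); rewrite ?normr1 ?normr0.
- exact: irho0.
Qed.

Lemma L1seg_mom0 : L1seg mom0.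
Proof.
move=> Y; apply: (@integrable_mulb _ _ R (leb R) `[- Y, Y]%classic (measurable_itv _)
  n0 (fun y => \1_(~` N0) y) 1).
- by apply: measurable_funTS; exact/measurable_indicP/measurableC.
- by move=> y _; rewrite indicE; case: (_ \in _); rewrite ?normr1 ?normr0.
- exact: in0.
Qed.

Lemma clean_mass : weak_mass_eq rho n rho0 -> weak_balance (mass_a dens) (mass_b dens vel) (mass_c dens) dens0.
Proof.
move=> W; have [ba bb bc] := bounded_mfun_mass bounded_mfun_dens bounded_mfun_vel.
apply: weak_balance_test_fun; try exact: bounded_mfun_L1box; first exact: L1seg_dens0.
move=> F tF _ _; have := W F tF; rewrite /Rintegral.
rewrite [X in (- X)%E](@eq_integral_off_null _ _ _ (leb2 R) ohp N _
  (fun x => (balance_integrand (mass_a dens) (mass_b dens vel) (mass_c dens) F (d_tau F) (d_y F) x)%:E) mN muN).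
  rewrite (@eq_integral_off_null _ _ _ (leb R) setT N0 (fun y => (F (0, y) * rho0 y)%:E)
    (fun y => (F (0, y) * dens0 y)%:E) mN0 muN0).
    by move=> <-; rewrite fineN opprK.
  by move=> y _ Ny; have [-> _] := dens0_off Ny.
move=> x ox Nx; congr EFin; have H := momentum_off ox Nx.
rewrite /balance_integrand /mass_b /mass_c /mass_a H; have [-> _] := dens_off Nx.
by ring.
Qed.

Lemma clean_momentum : weak_momentum_eq alpha p rho n n0 -> weak_balance (mom_a dens vel) (mom_b p dens vel) (mom_c alpha dens vel) mom0.
Proof.
move=> W; have [ba bb bc] := bounded_mfun_mom alpha p_cont bounded_mfun_dens bounded_mfun_vel dens_ge0.
apply: weak_balance_test_fun; try exact: bounded_mfun_L1box; first exact: L1seg_mom0.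
move=> F tF _ _; have := W F tF; rewrite /Rintegral.
rewrite [X in (- X)%E](@eq_integral_off_null _ _ _ (leb2 R) ohp N _
  (fun x => (balance_integrand (mom_a dens vel) (mom_b p dens vel) (mom_c alpha dens vel) F (d_tau F) (d_y F) x)%:E) mN muN).
  rewrite (@eq_integral_off_null _ _ _ (leb R) setT N0 (fun y => (F (0, y) * n0 y)%:E)
    (fun y => (F (0, y) * mom0 y)%:E) mN0 muN0).
    by move=> <-; rewrite fineN opprK.
  by move=> y _ Ny; have [_ ->] := dens0_off Ny.
move=> x ox Nx; congr EFin; have H := momentum_off ox Nx.
have K : dens x * (vel x * vel x) = n x ^+ 2 / rho x.
  by rewrite mulrA H; have [_ ->] := dens_off Nx; rewrite expr2 mulrA.
rewrite /balance_integrand /mom_b /mom_c /mom_a K H; have [-> _] := dens_off Nx.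
by ring.
Qed.

Definition ent0 (y : R) : R := entropy h 0 (dens0 y) (mom0 y).

(** Off [N], entropy and flux are rewritten in density and velocity. The inequality between extended
    reals becomes one between reals because both integrals are finite for the reset state. *)
Lemma clean_entropy : L1seg ent0 ->
  (forall chi : R * R -> R, test_fun chi -> (forall x, half_plane x -> 0 <= chi x) ->
    (\int[leb2 R]_(x in @open_half_plane R)
       (- d_tau chi x * entropy h x.1 (rho x) (n x)
        + d_y chi x * (x.2 / 2 * entropy h x.1 (rho x) (n x)
                       - entropy_flux h x.1 (rho x) (n x))
        + chi x * (2^-1 * entropy h x.1 (rho x) (n x)
                   + alpha * (n x ^+ 2 / rho x)))%:E
     <= \int[leb R]_y (chi (0, y) * entropy h 0%R (rho0 y) (n0 y))%:E)%E) ->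
  forall f f1 f2 (T Y : R), 0 < T -> 0 < Y -> C1_test f f1 f2 T Y ->
    (forall x : R * R, 0 <= x.1 -> 0 <= f x) ->
    \int[leb2 R]_(x in ohp) balance_integrand (ent_a h dens vel) (ent_b p h dens vel) (ent_c alpha h dens vel) f f1 f2 x <=
    \int[leb R]_y (f (0, y) * ent0 y).
Proof.
move=> ie0 W; have [ba bb bc] := bounded_mfun_entropy alpha p_cont h_cont bounded_mfun_dens bounded_mfun_vel dens_ge0.
apply: weak_ineq_test_fun; try exact: bounded_mfun_L1box; first exact: ie0.
move=> F tF F0 i1 i2; have := W F tF F0; rewrite /Rintegral.
rewrite [X in (X <= _)%E](@eq_integral_off_null _ _ _ (leb2 R) ohp N _
  (fun x => (balance_integrand (ent_a h dens vel) (ent_b p h dens vel) (ent_c alpha h dens vel) F (d_tau F) (d_y F) x)%:E) mN muN).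
  rewrite (@eq_integral_off_null _ _ _ (leb R) setT N0
    (fun y => (F (0, y) * entropy h 0 (rho0 y) (n0 y))%:E)
    (fun y => (F (0, y) * ent0 y)%:E) mN0 muN0).
    move=> H; apply: fine_le H.
      exact: (integrable_fin_num (@measurable_ohp R) i1).
    exact: (integrable_fin_num measurableT i2).
  by move=> y _ Ny; rewrite /ent0; have [-> ->] := dens0_off Ny.
move=> x ox Nx; congr EFin; have H := momentum_off ox Nx.
have [Er Eu] := dens_off Nx.
have K : dens x * (vel x * vel x) = n x ^+ 2 / rho x.
  by rewrite mulrA H Eu expr2 mulrA.
have K3 : dens x * (vel x * (vel x * vel x)) = n x ^+ 3 / rho x ^+ 2.
  by rewrite mulrA H Eu -exprVn; ring.
have Ee : entropy h x.1 (rho x) (n x) = ent h dens vel x.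
  by rewrite /entropy /ent K Er invfM [2^-1 * _]mulrC -!mulrA [_ * 2^-1]mulrC.
have Eq : entropy_flux h x.1 (rho x) (n x) = flux p h dens vel x.
  rewrite /entropy_flux /flux K3 Er invfM; congr (_ + _); first by ring.
  (* At the vacuum both sides vanish with the momentum and the velocity; elsewhere z h' = p + h
     applies. *)
  have [r0|r0] := eqVneq (rho x) 0.
    have [_ vac _] := good ox Nx; rewrite vac// mul0r.
    by rewrite vel_vacuum ?mul0r// Er.
  have rp : 0 < rho x by rewrite lt_neqAle eq_sym r0; case: (good ox Nx).
  by rewrite deriv_ge0_gt0// h_potential// Eu; field.
by rewrite Ee Eq -K /balance_integrand /ent_a /ent_b /ent_c; ring.
Qed.

End CleanState.

Section Identity.
Context {R : realType}.

(* The left-hand side is the source of the local relative entropy inequality: that of the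
   entropy inequality minus those of the balances of mass and momentum multiplied by the
   derivatives of the entropy at the reference state.  The right-hand side is xi. *)
Lemma relative_balance_identity (E y a r u k pr rb nb rt ry nt ny hb h1b h2b : R) :
  E != 0 -> rb != 0 ->
  let ub := nb / rb in
  let ubt := nt / rb - nb * rt / rb ^+ 2 in
  let uby := ny / rb - nb * ry / rb ^+ 2 in
  let pb := rb * h1b - hb in
  let G1 := h1b - 2^-1 * (E * ub ^+ 2) in
  let G1t := h2b * rt + 2^-1 * (E * ub ^+ 2) - E * ub * ubt in
  let G1y := h2b * ry - E * ub * uby in
  let G2t := - (E * ub) + E * ubt in
  let G2y := E * uby in
  let R1 := rt - y / 2 * ry + ny in
  let R2 := nt - y / 2 * ny - 2^-1 * nb + (2 * nb * ny / rb - nb ^+ 2 * ry / rb ^+ 2)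
    + E^-1 * (rb * h2b * ry + a * nb) in
  2^-1 * (2^-1 * E * (r * (u - ub) ^+ 2) + (k - hb - h1b * (r - rb)))
    + a * (r * (u - ub) ^+ 2)
    - (2^-1 * (E * (2^-1 * (r * (u * u))) + k) + a * (r * (u * u)))
    - (G1 * (- 2^-1 * r) + G1t * r + G1y * (- (y / 2) * r + r * u)
       + (E * ub * (- E^-1 * (a * (r * u))) + G2t * (r * u)
          + G2y * (- (y / 2) * (r * u) + r * (u * u) + E^-1 * pr))
       - rb * h2b * rt + (2^-1 * pb + y / 2 * (rb * h2b * ry) - uby * pb - ub * (rb * h2b * ry))) =
  - uby * (E * (r * (u - ub) ^+ 2) + (pr - pb - rb * h2b * (r - rb)))
  + E * (ub * R1 - R2) * (r / rb) * (u - ub)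
  + - (r - rb) * h2b * R1.
Proof. by move=> E0 r0 /=; field; rewrite E0 r0. Qed.

End Identity.

Section EntropySum.
Context {R : realType}.
Local Notation R2 := (measurableTypeR R * measurableTypeR R)%type.
Local Notation ohp := (@open_half_plane R).

Lemma L1seg_continuous_mul (k : R * R -> R) (f : R -> R) :
  (forall x : R * R, {for x, continuous k}) -> L1seg f -> L1seg (fun y => k (0, y) * f y).
Proof.
move=> ck fi Y.
have [M _ HM] := continuous_at_compact_bounded (@box_compact R 1 Y) (fun x _ => ck x).
apply: (@integrable_mulb _ _ R (leb R) `[- Y, Y]%classic (measurable_itv _) f
  (fun y => k (0, y)) M); last exact: fi.
  by apply: measurable_funTS; apply: continuous_measurable_fun => y; exact: continuous_section2.
move=> y; rewrite /= in_itv/= => yY; apply: (HM (0, y)).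
by apply/boxP; rewrite /= lexx ler01.
Qed.

Lemma L1seg_add (f g : R -> R) : L1seg f -> L1seg g -> L1seg (fun y => f y + g y).
Proof. by move=> fi gi Y; apply: integrable_add => //; exact: measurable_itv. Qed.

Lemma L1seg_opp (f : R -> R) : L1seg f -> L1seg (fun y => - f y).
Proof. by move=> fi Y; apply: integrable_opp => //; exact: measurable_itv. Qed.

Lemma C1_test_seg_integrable (r : R -> R) f f1 f2 (T Y : R) : C1_test f f1 f2 T Y ->
  L1seg r -> (leb R).-integrable setT (EFin \o (fun y => f (0, y) * r y)).
Proof.
move=> [CC Z] ir; apply: (@integrable_seg _ _ Y).
  by move=> y Yy; have [|-> _ _] := Z (0, y); [right; exact: ltW|rewrite mul0r].
by apply: L1seg_continuous_mul => // x; case: (CC x).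
Qed.

Lemma entropy_balance_add (a b c ea eb ec : R * R -> R) (s0 e0 : R -> R) f f1 f2 (T Y : R) :
  L1box a -> L1box b -> L1box c -> L1seg s0 ->
  L1box ea -> L1box eb -> L1box ec -> L1seg e0 ->
  weak_balance a b c s0 -> 0 < T -> 0 < Y -> C1_test f f1 f2 T Y ->
  \int[leb2 R]_(x in ohp) balance_integrand ea eb ec f f1 f2 x <=
    \int[leb R]_y (f (0, y) * e0 y) ->
  \int[leb2 R]_(x in ohp) balance_integrand (fun x => ea x + a x) (fun x => eb x + b x)
     (fun x => ec x + c x) f f1 f2 x <=
    \int[leb R]_y (f (0, y) * (e0 y - s0 y)).
Proof.
move=> ia ib ic is0 iea ieb iec ie0 W T0 Y0 tf L; have mo := @measurable_ohp R.
have I1 := C1_test_integrable ia ib ic tf; have I2 := C1_test_integrable iea ieb iec tf.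
have J1 := C1_test_seg_integrable tf is0; have J2 := C1_test_seg_integrable tf ie0.
rewrite (_ : \int[leb R]_y _ = \int[leb R]_y (f (0, y) * e0 y) - \int[leb R]_y (f (0, y) * s0 y)).
  rewrite -(W _ _ _ _ _ T0 Y0 tf).
  rewrite (_ : \int[leb2 R]_(x in _) _ = \int[leb2 R]_(x in ohp) balance_integrand ea eb ec f f1 f2 x
    + \int[leb2 R]_(x in ohp) balance_integrand a b c f f1 f2 x); first by rewrite lerD2r.
  rewrite -(RintegralD mo I2 I1).
  by apply: eq_Rintegral => x _; rewrite /balance_integrand; ring.
rewrite -(RintegralB (@measurableT _ (measurableTypeR R)) J2 J1).
by apply: eq_Rintegral => y _; ring.
Qed.

Lemma integrable_off_null (D N : set R2) (f g : R * R -> R) :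
  measurable D -> measurable N -> leb2 R N = 0%E ->
  (forall x, D x -> ~ N x -> f x = g x) -> measurable_fun D f ->
  (leb2 R).-integrable D (EFin \o g) -> (leb2 R).-integrable D (EFin \o f).
Proof.
move=> mD mN N0 fg mf /integrableP[_ gi]; apply/integrableP; split; first exact/measurable_EFinP.
rewrite (@eq_integral_off_null _ _ _ (leb2 R) D N _ (fun x => `|(EFin \o g) x|)%E mN N0)//.
by move=> x Dx Nx /=; rewrite fg.
Qed.

Lemma C1_at_ext f f1 f2 g g1 g2 (x : R * R) : C1_at f f1 f2 x ->
  f =1 g -> f1 =1 g1 -> f2 =1 g2 -> C1_at g g1 g2 x.
Proof. by move=> C fg fg1 fg2; apply: near_eq_C1_at C; near=> z; split. Unshelve. all: by end_near. Qed.

Lemma C1_at_inv f f1 f2 (x : R * R) : f x != 0 -> C1_at f f1 f2 x ->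
  C1_at (fun z => (f z)^-1) (fun z => - (f z) ^- 2 * f1 z) (fun z => - (f z) ^- 2 * f2 z) x.
Proof.
move=> fx C; apply: (@C1_at_comp _ GRing.inv (fun s => - s ^- 2) f f1 f2 x C).
  by have := @is_deriveV _ id (f x) 1 1 fx _; rewrite [_ *: _]mulr1; apply.
by apply: cvgN; apply: cvgV; [rewrite expf_neq0|exact: exprn_continuous].
Qed.

End EntropySum.

(** * The relative entropy inequality *)

Section RelativeRegular.
Context {R : realType}.
Local Notation R2 := (measurableTypeR R * measurableTypeR R)%type.
Local Notation ohp := (@open_half_plane R).
Variables (alpha : R) (p h : R -> R) (r u : R * R -> R) (r0 m0 : R -> R).
Hypotheses (alpha0 : 0 <= alpha)
  (p_cont : {within `[0, +oo[, continuous p})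
  (p_C1 : C1_pos p)
  (p_incr : forall z : R, 0 < z -> 0 < derive1 p z)
  (h_cont : {within `[0, +oo[, continuous h})
  (h_C2 : C2_pos h)
  (h_potential : forall z : R, 0 < z -> p z = z * derive1 h z - h z).
Hypotheses (br : bounded_mfun r) (bu : bounded_mfun u) (r_ge0 : forall x, ohp x -> 0 <= r x)
  (state_bound : forall T, exists2 B : R, 0 <= B &
     forall x, ohp x -> x.1 <= T -> r x <= B /\ `|u x| <= B)
  (r0_ge0 : forall y, 0 <= r0 y) (m0_vac : forall y, r0 y = 0 -> m0 y = 0)
  (ir0 : L1seg r0) (im0 : L1seg m0)
  (W1 : weak_balance (mass_a r) (mass_b r u) (mass_c r) r0)
  (W2 : weak_balance (mom_a r u) (mom_b p r u) (mom_c alpha r u) m0)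
  (W3 : L1seg (fun y => entropy h 0 (r0 y) (m0 y)) ->
    forall f f1 f2 (T Y : R), 0 < T -> 0 < Y -> C1_test f f1 f2 T Y ->
    (forall x : R * R, 0 <= x.1 -> 0 <= f x) ->
    \int[leb2 R]_(x in ohp) balance_integrand (ent_a h r u) (ent_b p h r u) (ent_c alpha h r u)
      f f1 f2 x <=
    \int[leb R]_y (f (0, y) * entropy h 0 (r0 y) (m0 y))).
Variables (rb nb rt ry nt ny : R * R -> R) (mb Mb : R).
Hypotheses (mb0 : 0 < mb) (rb_itv : forall x, mb <= rb x <= Mb) (nb_bound : forall x, `|nb x| <= Mb)
  (crb : forall x : R * R, {for x, continuous rb}) (cnb : forall x : R * R, {for x, continuous nb})
  (Crb : forall x, ohp x -> C1_at rb rt ry x) (Cnb : forall x, ohp x -> C1_at nb nt ny x).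

Let h1 := derive1 h.
Let h2 := derive1n 2 h.

Let rb0 x : 0 < rb x. Proof. by case/andP: (rb_itv x) => /(lt_le_trans mb0). Qed.
Let rbn0 x : rb x != 0. Proof. exact: lt0r_neq0. Qed.

Definition ref_vel (x : R * R) : R := nb x / rb x.
Definition ref_vel_t (x : R * R) : R := nt x / rb x - nb x * rt x / rb x ^+ 2.
Definition ref_vel_y (x : R * R) : R := ny x / rb x - nb x * ry x / rb x ^+ 2.

Local Notation ub := ref_vel.
Local Notation ubt := ref_vel_t.
Local Notation uby := ref_vel_y.
Local Notation Et x := (expR (- x.1)).

Lemma C1_at_ref_vel x : ohp x -> C1_at ub ubt uby x.
Proof.
move=> ox; have := C1_at_mul (Cnb ox) (C1_at_inv (rbn0 x) (Crb ox)).
move=> H; apply: (C1_at_ext H) => z //; rewrite /ubt /uby; field; exact: rbn0.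
Qed.

Let C1_E (x : R * R) : C1_at (fun x : R * R => Et x) (fun x : R * R => - Et x) (fun=> 0) x.
Proof.
have D (t : R) : is_derive t 1 (fun t => expR (- t)) (- expR (- t)).
  have DN : is_derive t 1 (fun t : R => - t) (- 1) by exact: is_deriveN (is_derive_id t 1).
  by apply: is_derive_eq (@is_derive_chain _ R expR _ t 1 _ _ (is_derive_expR _) DN) _; rewrite mulrN1.
apply: (@C1_at_time _ (fun t => expR (- t)) (fun t => - expR (- t)) x (D x.1)) => t; apply: cvgN.
by apply: (@continuous_comp _ _ _ -%R expR); [apply: cvgN; exact: cvg_id|exact: continuous_expR].
Qed.

Let cub (x : R * R) : {for x, continuous ub}.
Proof. by apply: cvgM; [exact: cnb|apply: cvgV; [exact: rbn0|exact: crb]]. Qed.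

Let cE (x : R * R) : {for x, continuous (fun x : R * R => Et x)}.
Proof. by case: (C1_E x). Qed.

(** Legendre transform of the entropy at the reference state, G1 rb + G2 nb minus the entropy there.
    By [pbE] it is p(rb). *)
Let pb (x : R * R) : R := rb x * h1 (rb x) - h (rb x).
(** [G1] and [G2] are the partial derivatives of the entropy in density and momentum, taken at the
    reference state. *)
Let G1 (x : R * R) : R := h1 (rb x) - 2^-1 * (Et x * ub x ^+ 2).
Let G1t (x : R * R) : R := h2 (rb x) * rt x + 2^-1 * (Et x * ub x ^+ 2) - Et x * ub x * ubt x.
Let G1y (x : R * R) : R := h2 (rb x) * ry x - Et x * ub x * uby x.
Let G2 (x : R * R) : R := Et x * ub x.
Let G2t (x : R * R) : R := - (Et x * ub x) + Et x * ubt x.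
Let G2y (x : R * R) : R := Et x * uby x.
Let Pt (x : R * R) : R := rb x * h2 (rb x) * rt x.
Let Py (x : R * R) : R := rb x * h2 (rb x) * ry x.
(** Chosen so that the flux terms assemble to [rel_flux]; see [rel_fluxE]. *)
Let Q (x : R * R) : R := x.2 / 2 * pb x - ub x * pb x.
Let Qt (x : R * R) : R := x.2 / 2 * Pt x - ubt x * pb x - ub x * Pt x.
Let Qy (x : R * R) : R := 2^-1 * pb x + x.2 / 2 * Py x - uby x * pb x - ub x * Py x.

Let pbE x : pb x = p (rb x). Proof. by rewrite h_potential. Qed.

Let C1_h1 x : ohp x -> C1_at (fun x => h1 (rb x)) (fun x => h2 (rb x) * rt x)
  (fun x => h2 (rb x) * ry x) x.
Proof.
by move=> ox; apply: C1_at_comp (Crb ox) (is_derive_potential2 h_C2 (rb0 x))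
  (continuous_potential2 h_C2 (rb0 x)).
Qed.

Let C1_h x : ohp x -> C1_at (fun x => h (rb x)) (fun x => h1 (rb x) * rt x)
  (fun x => h1 (rb x) * ry x) x.
Proof.
by move=> ox; apply: C1_at_comp (Crb ox) (is_derive_potential h_C2 (rb0 x))
  (continuous_potential1 h_C2 (rb0 x)).
Qed.

Let CG1 x : ohp x -> C1_at G1 G1t G1y x.
Proof.
move=> ox; have Cu := C1_at_ref_vel ox.
have H := C1_at_add (C1_h1 ox) (C1_at_mul (C1_at_cst (- 2^-1) x)
  (C1_at_mul (C1_E x) (C1_at_mul Cu Cu))).
by apply: (C1_at_ext H) => z; rewrite /G1 /G1t /G1y; field.
Qed.

Let CG2 x : ohp x -> C1_at G2 G2t G2y x.
Proof.
move=> ox; have H := C1_at_mul (C1_E x) (C1_at_ref_vel ox).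
by apply: (C1_at_ext H) => z; rewrite /G2 /G2t /G2y; ring.
Qed.

Let CP x : ohp x -> C1_at pb Pt Py x.
Proof.
move=> ox; have H := C1_at_add (C1_at_mul (Crb ox) (C1_h1 ox))
  (C1_at_mul (C1_at_cst (- 1) x) (C1_h ox)).
by apply: (C1_at_ext H) => z; rewrite /pb /Pt /Py; ring.
Qed.

Let CQ x : ohp x -> C1_at Q Qt Qy x.
Proof.
move=> ox; have H := C1_at_add
  (C1_at_mul (C1_at_mul (C1_at_snd x) (C1_at_cst 2^-1 x)) (CP ox))
  (C1_at_mul (C1_at_cst (- 1) x) (C1_at_mul (C1_at_ref_vel ox) (CP ox))).
by apply: (C1_at_ext H) => z; rewrite /Q /Qt /Qy; ring.
Qed.

Let ch1 (x : R * R) : {for x, continuous (fun x => h1 (rb x))}.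
Proof. by apply: (@continuous_comp _ _ _ rb h1); [exact: crb|exact: (continuous_potential1 h_C2 (rb0 x))]. Qed.

Let ch (x : R * R) : {for x, continuous (fun x => h (rb x))}.
Proof.
apply: (@continuous_comp _ _ _ rb h); first exact: crb.
apply: differentiable_continuous; apply/derivable1_diffP.
by case: (is_derive_potential h_C2 (rb0 x)).
Qed.

Let cG2 (x : R * R) : {for x, continuous G2}.
Proof. by apply: cvgM; [exact: cE|exact: cub]. Qed.

Let cG1 (x : R * R) : {for x, continuous G1}.
Proof.
apply: cvgB; first exact: ch1.
apply: cvgM; first exact: cvg_cst.
apply: cvgM; first exact: cE.
by apply: (@continuous_comp _ _ _ ub (fun z => z ^+ 2)); [exact: cub|exact: exprn_continuous].
Qed.

Let cP (x : R * R) : {for x, continuous pb}.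
Proof. by apply: cvgB; [apply: cvgM; [exact: crb|exact: ch1]|exact: ch]. Qed.

Let cQ (x : R * R) : {for x, continuous Q}.
Proof.
apply: cvgB; (apply: cvgM; last exact: cP); last exact: cub.
by apply: cvgM; [exact: cvg_snd|exact: cvg_cst].
Qed.

Definition rel_eta (x : R * R) : R :=
  2^-1 * Et x * (r x * (u x - ub x) ^+ 2) + relative h (r x) (rb x).
Definition rel_K (x : R * R) : R := r x * (u x - ub x) ^+ 2.
(** Beyond the transport of [rel_eta] by [u] there remains a product of two differences, of second
    order near the reference state. [flux_control] compares it with [rel_eta]. *)
Definition rel_flux (x : R * R) : R :=
  u x * rel_eta x + (u x - ub x) * (p (r x) - p (rb x)).
Definition ref_res1 (x : R * R) : R := rt x - x.2 / 2 * ry x + ny x.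
Definition ref_res2 (x : R * R) : R :=
  nt x - x.2 / 2 * ny x - 2^-1 * nb x + (2 * nb x * ny x / rb x - nb x ^+ 2 * ry x / rb x ^+ 2)
  + expR x.1 * (derive1 p (rb x) * ry x + alpha * nb x).
(** The error term in terms of velocities, with the derivatives of the quotients and of p(rb)
    expanded. *)
Definition rel_xi (x : R * R) : R :=
  - uby x * (Et x * (r x * (u x - ub x) ^+ 2) + relative p (r x) (rb x))
  + Et x * (ub x * ref_res1 x - ref_res2 x) * (r x / rb x) * (u x - ub x)
  + - (r x - rb x) * h2 (rb x) * ref_res1 x.

Local Notation a' := (super_a (mass_a r) (mom_a r u) G1 G2 pb).
Local Notation b' := (super_b (mass_b r u) (mom_b p r u) G1 G2 Q).
Local Notation c' := (super_c (mass_a r) (mass_b r u) (mass_c r) (mom_a r u) (mom_b p r u)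
  (mom_c alpha r u) G1 G1t G1y G2 G2t G2y Pt Qy).

Let rel_relative x : relative h (r x) (rb x) = h (r x) - h (rb x) - h1 (rb x) * (r x - rb x).
Proof. by rewrite /relative deriv_ge0_gt0. Qed.

Let rel_etaE x : rel_eta x = ent h r u x - a' x.
Proof.
rewrite /rel_eta rel_relative /super_a /mass_a /mom_a /ent /G1 /G2 /pb; by field.
Qed.

Let rel_fluxE x : x.2 / 2 * rel_eta x - rel_flux x = ent_b p h r u x + b' x.
Proof.
rewrite /rel_flux /rel_eta rel_relative -pbE /super_b /mass_b /mom_b /ent_b /flux /ent /G1 /G2 /Q /pb.
have -> : expR x.1 = (Et x)^-1 by rewrite expRN invrK.
have E0 : Et x != 0 by rewrite gt_eqF// expR_gt0.
by field.
Qed.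

Let rel_xiE x : 2^-1 * rel_eta x + alpha * rel_K x - (ent_c alpha h r u x + c' x) = rel_xi x.
Proof.
have E0 : Et x != 0 by rewrite gt_eqF// expR_gt0.
have := relative_balance_identity x.2 alpha (r x) (u x) (h (r x)) (p (r x)) (nb x) (rt x) (ry x)
  (nt x) (ny x) (h (rb x)) (h1 (rb x)) (h2 (rb x)) E0 (rbn0 x).
rewrite /rel_xi /rel_eta rel_relative /relative (deriv_ge0_gt0 _ (rb0 x)) /ref_res2.
rewrite (pressure_derivative h_C2 h_potential (rb0 x)) -pbE.
have -> : expR x.1 = (Et x)^-1 by rewrite expRN invrK.
move=> /= <-.
rewrite /super_c /mass_a /mass_b /mass_c /mom_a /mom_b /mom_c /ent_c /ent.
have -> : expR x.1 = (Et x)^-1 by rewrite expRN invrK.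
rewrite /rel_K /G1 /G1t /G1y /G2 /G2t /G2y /Pt /Qy /Py /pb /ubt /uby /ub.
by ring.
Qed.

Variables (N : set R2) (X : R * R -> R) (eta0 : R -> R).
Hypotheses (mN : measurable N) (muN : leb2 R N = 0%E)
  (X_off : forall x, ohp x -> ~ N x -> X x = rel_xi x)
  (iX : forall T, (leb2 R).-integrable (strip T) (EFin \o X))
  (eta0E : forall y, eta0 y = rel_entropy h 0 (r0 y) (m0 y) (rb (0, y)) (nb (0, y)))
  (ieta0 : (leb R).-integrable setT (EFin \o eta0)).

Let rel_K_ge0 x : ohp x -> 0 <= rel_K x.
Proof. by move=> ox; rewrite /rel_K mulr_ge0 ?sqr_ge0// r_ge0. Qed.

Let relative_ge0 x : ohp x -> 0 <= relative h (r x) (rb x).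
Proof. by move=> ox; exact: (relative_potential_ge0 p_incr h_cont h_C2 h_potential (r_ge0 ox) (rb0 x)). Qed.

Let rel_eta_ge0 x : ohp x -> 0 <= rel_eta x.
Proof.
move=> ox; rewrite /rel_eta addr_ge0 ?relative_ge0//.
by rewrite mulr_ge0 ?rel_K_ge0// mulr_ge0// expR_ge0.
Qed.

Let brb : bounded_mfun rb. Proof. exact: bounded_mfun_continuous. Qed.
Let bub : bounded_mfun ub. Proof. exact: bounded_mfun_continuous. Qed.
Let bdu : bounded_mfun (fun x => u x - ub x).
Proof. by apply: bounded_mfun_add => //; exact: bounded_mfun_opp. Qed.

Let bK : bounded_mfun rel_K.
Proof. by apply: bounded_mfun_mul => //; exact: (bounded_mfun_mul bdu bdu). Qed.

Let beta : bounded_mfun rel_eta.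
Proof.
apply: bounded_mfun_add.
  apply: bounded_mfun_mul => //; apply: bounded_mfun_mul; first exact: bounded_mfun_cst.
  exact: bounded_mfun_continuous.
rewrite (_ : (fun x => _) = fun x => h (r x) + - (h (rb x)) + - (h1 (rb x) * (r x + - rb x))).
  apply: bounded_mfun_add; first apply: bounded_mfun_add.
  - exact: bounded_mfun_comp_ge0.
  - by apply: bounded_mfun_opp; exact: bounded_mfun_continuous.
  - apply: bounded_mfun_opp; apply: bounded_mfun_mul; first exact: bounded_mfun_continuous.
    by apply: bounded_mfun_add => //; exact: bounded_mfun_opp.
by apply/funext => x; rewrite rel_relative.
Qed.

Let bflux : bounded_mfun rel_flux.
Proof.
apply: bounded_mfun_add; first exact: bounded_mfun_mul.
apply: bounded_mfun_mul => //; apply: bounded_mfun_add; first exact: bounded_mfun_comp_ge0.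
apply: bounded_mfun_opp; apply: bounded_mfun_comp_ge0 => // x _; exact: ltW.
Qed.

Let control (T : R) : exists2 C : R, 0 <= C & forall x, strip T x ->
  rel_K x <= C * rel_eta x /\ `|rel_flux x| <= C * rel_eta x.
Proof.
have [B B0 HB] := state_bound T.
have M0 : 0 <= Mb := le_trans (normr_ge0 _) (nb_bound 0).
have mM : mb <= Num.max Mb B by case/andP: (rb_itv 0) => a b; rewrite le_max (le_trans a b).
have U0 : 0 <= Num.max B (Mb / mb) by rewrite le_max B0.
have [C C0 HC] := flux_control p_cont p_C1 p_incr h_cont h_C2 h_potential mb0 mM U0.
(* The kinetic part of [rel_eta] carries the factor exp(- t) / 2, which is at least 1 / D up to time
   [T]. *)
pose D := 2 * expR T; have D0 : 0 <= D by rewrite mulr_ge0// expR_ge0.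
have KD x : strip T x -> rel_K x <= D * rel_eta x.
  move=> /andP[x0 xT]; rewrite /rel_eta /D.
  have k0 := rel_K_ge0 x0; have f0 := relative_ge0 x0.
  have e1 : 1 <= expR T * Et x by rewrite -expRD -[leLHS]expR0 ler_expR subr_ge0.
  have e2 : rel_K x <= expR T * Et x * rel_K x by rewrite ler_peMl.
  have e3 : 0 <= 2 * expR T * relative h (r x) (rb x) by rewrite mulr_ge0.
  apply: (le_trans e2); rewrite mulrDr -[leLHS]addr0 lerD//.
  by rewrite le_eqVlt /rel_K; apply/orP; left; apply/eqP; field.
(* [B] bounds the transport velocity. [flux_control] gives [C] times the sum of [rel_K] and the
   relative potential, which is at most D + 1 times [rel_eta]. *)
exists (Num.max D (B + C * (D + 1))); first by rewrite le_max D0.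
move=> x sx; have /andP[x0 xT] := sx; have e0 := rel_eta_ge0 x0.
split; first by apply: le_trans (KD x sx) _; rewrite ler_wpM2r// le_max lexx.
apply: (@le_trans _ _ ((B + C * (D + 1)) * rel_eta x)); last first.
  by rewrite ler_wpM2r// le_max lexx orbT.
have [rB uB] := HB x x0 xT.
rewrite [leRHS]mulrDl /rel_flux; apply: le_trans (ler_normD _ _) _; apply: lerD.
  by rewrite normrM (ger0_norm e0) ler_wpM2r.
have /andP[rbm rbM] := rb_itv x.
have := HC (r x) (rb x) (u x) (ub x).
rewrite r_ge0// rbm !le_max rB rbM uB orbT => /(_ isT isT isT) H.
apply: le_trans (H _) _.
  rewrite /ub normrM normfV (gtr0_norm (rb0 x)).
  apply/orP; right; apply: ler_pM => //; first by rewrite invr_ge0 ltW.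
  by rewrite lef_pV2// posrE.
rewrite -mulrA ler_wpM2l// mulrDl mul1r lerD ?KD//.
by rewrite /rel_eta lerDr mulr_ge0 ?rel_K_ge0// mulr_ge0// expR_ge0.
Qed.

(** Read in this direction, the algebraic identity gives what the product rule cannot: up to bounded
    terms [c'] is - [rel_xi], hence integrable up to tau = 0 by the assumption on xi. *)
Let c'E x : c' x = 2^-1 * rel_eta x + alpha * rel_K x + - ent_c alpha h r u x + - rel_xi x.
Proof. by rewrite -rel_xiE; ring. Qed.

(** Multipliers and their derivatives are continuous on the open half plane, hence measurable there.
    [rel_xi] inherits measurability from [c'] through the identity. *)
Let mc : measurable_fun (ohp : set R2) c'.
Proof.
have mC (f f1 f2 : R * R -> R) : (forall x, ohp x -> C1_at f f1 f2 x) ->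
    [/\ measurable_fun (ohp : set R2) f, measurable_fun (ohp : set R2) f1
      & measurable_fun (ohp : set R2) f2].
  by move=> C; split; apply: continuous_at_measurable => [|x ox]; try exact: open_ohp;
    have [] := C x ox.
have [a0 a1 a2] := mC _ _ _ CG1; have [b0 b1 b2] := mC _ _ _ CG2.
have [_ q1 q2] := mC _ _ _ CQ; have [_ p1 _] := mC _ _ _ CP.
have [[ma _] [mb' _] [mc _]] := bounded_mfun_mass br bu.
have [[ma2 _] [mb2 _] [mc2 _]] := bounded_mfun_mom alpha p_cont br bu r_ge0.
apply: measurable_funD => //; apply: measurable_funB => //; apply: measurable_funD.
  by apply: measurable_funD; [apply: measurable_funD|]; exact: measurable_funM.
by apply: measurable_funD; [apply: measurable_funD|]; exact: measurable_funM.
Qed.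

Let mxi : measurable_fun (ohp : set R2) rel_xi.
Proof.
have -> : rel_xi = fun x => 2^-1 * rel_eta x + alpha * rel_K x - (ent_c alpha h r u x + c' x).
  by apply/funext => x; rewrite rel_xiE.
have [_ _ [me _]] := bounded_mfun_entropy alpha p_cont h_cont br bu r_ge0.
have [m1 _] := beta; have [m2 _] := bK.
apply: measurable_funB; last exact: measurable_funD.
by apply: measurable_funD; exact: measurable_funM.
Qed.

Let ixi T : (leb2 R).-integrable (strip T) (EFin \o rel_xi).
Proof.
apply: (integrable_off_null (measurable_strip T) mN muN _ _ (iX T)).
  by move=> x /strip_ohp ox Nx; rewrite X_off.
by apply: measurable_funS mxi => //; [exact: measurable_ohp|exact: strip_ohp].
Qed.

Let L1mul (k : R) f : bounded_mfun f -> L1box (fun x => k * f x).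
Proof. by move=> bf; apply: bounded_mfun_L1box; apply: bounded_mfun_mul => //; exact: bounded_mfun_cst. Qed.

Let ic' : L1box c'.
Proof.
have [_ _ be] := bounded_mfun_entropy alpha p_cont h_cont br bu r_ge0.
rewrite (_ : c' = fun x => 2^-1 * rel_eta x + alpha * rel_K x + - ent_c alpha h r u x + - rel_xi x).
  apply: L1box_add; first apply: L1box_add; first apply: L1box_add; try exact: L1mul.
    by apply: L1box_opp; exact: bounded_mfun_L1box.
  apply: L1box_opp => T Y; apply: integrableS (ixi T); [exact: measurable_strip|exact: measurable_pbox|].
  exact: pbox_strip.
by apply/funext => x; exact: c'E.
Qed.

Let s0 y := G1 (0, y) * r0 y + G2 (0, y) * m0 y - pb (0, y).

Let W : weak_balance a' b' c' s0.
Proof.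
have [A B C] := bounded_mfun_mass br bu.
have [A2 B2 C2] := bounded_mfun_mom alpha p_cont br bu r_ge0.
have L (g : R * R -> R) : bounded_mfun g -> L1box g by exact: bounded_mfun_L1box.
exact: (super_balance (L _ A) (L _ B) (L _ C) ir0 (L _ A2) (L _ B2) (L _ C2) im0 W1 W2
  A.2 A2.2 CG1 CG2 CP CQ cG1 cG2 cP cQ ic').
Qed.

Let eta0E_sum y : eta0 y = entropy h 0 (r0 y) (m0 y) - s0 y.
Proof.
rewrite eta0E /rel_entropy /rel_kinetic /relative (deriv_ge0_gt0 _ (rb0 _)) /entropy /s0 /G1 /G2 /pb.
rewrite /= oppr0 expR0 -/h1 real_normK ?num_real// /ub; have b0 := rbn0 (0, y).
(* At density 0 the quotients are 0 by the field convention, and the momentum vanishes as well. *)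
have [r00|r00] := eqVneq (r0 y) 0; last by field; rewrite ?b0 ?r00.
by rewrite (m0_vac r00) r00 !(mulr0, mul0r, invr0, expr0n)/=; field; rewrite ?b0.
Qed.

Let eta0_ge0 y : 0 <= eta0 y.
Proof.
rewrite eta0E /rel_entropy addr_ge0//.
  rewrite mulr_ge0 ?mulr_ge0 ?expR_ge0//.
exact: (relative_potential_ge0 p_incr h_cont h_C2 h_potential (r0_ge0 y) (rb0 _)).
Qed.

Let is0 : L1seg s0.
Proof.
have L1cst := @L1seg_one R.
apply: L1seg_add; last first.
  have H := L1seg_opp (L1seg_continuous_mul cP L1cst).
  by move: H; rewrite (_ : (fun y => - (pb (0, y) * 1)) = fun y => - pb (0, y))//;
    apply/funext => y; rewrite mulr1.
by apply: L1seg_add; exact: L1seg_continuous_mul.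
Qed.

(** The initial entropy differs from the initial relative entropy, which is integrable, by the data
    times continuous functions plus a continuous function. This makes the entropy inequality [W3]
    available. *)
Let ie0 : L1seg (fun y => entropy h 0 (r0 y) (m0 y)).
Proof.
rewrite (_ : (fun y => _) = fun y => eta0 y + s0 y).
  apply: L1seg_add is0 => Y; apply: integrableS ieta0 => //; exact: measurable_itv.
by apply/funext => y; rewrite eta0E_sum subrK.
Qed.

Let local_ineq f f1 f2 (T Y : R) : 0 < T -> 0 < Y ->
  C1_test f f1 f2 T Y -> (forall x : R * R, 0 <= x.1 -> 0 <= f x) ->
  \int[leb2 R]_(x in ohp) balance_integrand (fun x => - rel_eta x)
    (fun x => x.2 / 2 * rel_eta x - rel_flux x)
    (fun x => 2^-1 * rel_eta x + alpha * rel_K x - rel_xi x) f f1 f2 x <=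
  \int[leb R]_y (f (0, y) * eta0 y).
Proof.
move=> T0 Y0 tf f0.
have [A B C] := bounded_mfun_mass br bu.
have [A2 B2 C2] := bounded_mfun_mom alpha p_cont br bu r_ge0.
have [ea eb ec] := bounded_mfun_entropy alpha p_cont h_cont br bu r_ge0.
have L (g : R * R -> R) : bounded_mfun g -> L1box g by exact: bounded_mfun_L1box.
have ia : L1box a' by apply: L1box_super_a => //; exact: L.
have ib : L1box b' by apply: L1box_super_b => //; exact: L.
have := entropy_balance_add ia ib ic' is0 (L _ ea) (L _ eb) (L _ ec) ie0 W T0 Y0 tf
  (W3 ie0 T0 Y0 tf f0).
rewrite (_ : (fun x => ent_a h r u x + a' x) = fun x => - rel_eta x); last first.
  by apply/funext => x; rewrite rel_etaE /ent_a opprB addrC.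
rewrite (_ : (fun x => ent_b p h r u x + b' x) = fun x => x.2 / 2 * rel_eta x - rel_flux x); last first.
  by apply/funext => x; rewrite rel_fluxE.
rewrite (_ : (fun x => ent_c alpha h r u x + c' x) =
    fun x => 2^-1 * rel_eta x + alpha * rel_K x - rel_xi x); last first.
  by apply/funext => x; rewrite -rel_xiE; ring.
by rewrite (_ : (fun y => f (0, y) * eta0 y) = fun y => f (0, y) * (entropy h 0 (r0 y) (m0 y) - s0 y))//;
  apply/funext => y; rewrite eta0E_sum.
Qed.

Theorem regular_energy_estimate : energy_estimate alpha rel_eta rel_K X eta0.
Proof.
have [m1 _] := beta; have [m2 _] := bK.
have [H1 H2] : energy_estimate alpha rel_eta rel_K rel_xi eta0.
  apply: (localization (q := rel_flux)) => //; exact: bounded_mfun_L1box.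
split=> // phi dphi T T0 D c e g; have [I1 I2] := H2 _ _ _ T0 D c e g; split=> //.
rewrite (_ : \int[leb2 R]_(x in ohp) (phi x.1 * X x) = \int[leb2 R]_(x in ohp) (phi x.1 * rel_xi x))//.
congr fine; apply: (@eq_integral_off_null _ _ _ (leb2 R) ohp N _ _ mN muN).
by move=> x ox Nx; rewrite X_off.
Qed.

End RelativeRegular.

(** * The vacuum as reference state *)

Section RelativeVacuum.
Context {R : realType}.
Local Notation R2 := (measurableTypeR R * measurableTypeR R)%type.
Local Notation ohp := (@open_half_plane R).
Variables (alpha : R) (p h : R -> R) (r u : R * R -> R) (r0 m0 : R -> R).
Hypotheses (alpha0 : 0 <= alpha)
  (p_cont : {within `[0, +oo[, continuous p})
  (p_C1 : C1_pos p)
  (p_incr : forall z : R, 0 < z -> 0 < derive1 p z)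
  (h_cont : {within `[0, +oo[, continuous h})
  (h_C2 : C2_pos h)
  (h_potential : forall z : R, 0 < z -> p z = z * derive1 h z - h z)
  (vacuum : vacuum_pressure_condition p).
Hypotheses (br : bounded_mfun r) (bu : bounded_mfun u) (r_ge0 : forall x, ohp x -> 0 <= r x)
  (u_vac : forall x, r x = 0 -> u x = 0)
  (state_bound : forall T, exists2 B : R, 0 <= B &
     forall x, ohp x -> x.1 <= T -> r x <= B /\ `|u x| <= B)
  (r0_ge0 : forall y, 0 <= r0 y) (m0_vac : forall y, r0 y = 0 -> m0 y = 0)
  (ir0 : L1seg r0)
  (W1 : weak_balance (mass_a r) (mass_b r u) (mass_c r) r0)
  (W3 : L1seg (fun y => entropy h 0 (r0 y) (m0 y)) ->
    forall f f1 f2 (T Y : R), 0 < T -> 0 < Y -> C1_test f f1 f2 T Y ->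
    (forall x : R * R, 0 <= x.1 -> 0 <= f x) ->
    \int[leb2 R]_(x in ohp) balance_integrand (ent_a h r u) (ent_b p h r u) (ent_c alpha h r u)
      f f1 f2 x <=
    \int[leb R]_y (f (0, y) * entropy h 0 (r0 y) (m0 y))).
Variable eta0 : R -> R.
Hypotheses (eta0E : forall y, eta0 y = rel_entropy h 0 (r0 y) (m0 y) 0 0)
  (ieta0 : (leb R).-integrable setT (EFin \o eta0)).

(** The multipliers reduce to the constants h'(0) for mass and 0 for momentum. So only the mass
    balance, times [L], is subtracted, and no source term arises. *)
Let L := deriv_ge0 h 0.

Definition vac_eta (x : R * R) : R :=
  2^-1 * expR (- x.1) * (r x * u x ^+ 2) + relative h (r x) 0.
Definition vac_K (x : R * R) : R := r x * u x ^+ 2.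
Definition vac_flux (x : R * R) : R := u x * vac_eta x + u x * p (r x).

Let h00 : h 0 = 0. Proof. exact: (vacuum_potential0 p_C1 p_incr h_cont h_C2 h_potential vacuum). Qed.

Let relE z : relative h z 0 = h z - L * z.
Proof. by rewrite /relative h00 !subr0. Qed.

Let K_ge0 x : ohp x -> 0 <= vac_K x.
Proof. by move=> ox; rewrite /vac_K mulr_ge0 ?sqr_ge0// r_ge0. Qed.

Let rel_ge0 x : ohp x -> 0 <= relative h (r x) 0.
Proof. by move=> ox; exact: (vacuum_relative_ge0 p_C1 p_incr h_cont h_C2 h_potential vacuum (r_ge0 ox)). Qed.

Let eta_ge0 x : ohp x -> 0 <= vac_eta x.
Proof.
move=> ox; rewrite /vac_eta addr_ge0 ?rel_ge0//.
by rewrite mulr_ge0 ?K_ge0// mulr_ge0// expR_ge0.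
Qed.

Let bK : bounded_mfun vac_K.
Proof. by apply: bounded_mfun_mul => //; exact: (bounded_mfun_mul bu bu). Qed.

Let bscale (k : R) f : bounded_mfun f -> bounded_mfun (fun x => k * f x).
Proof. by move=> bf; apply: bounded_mfun_mul => //; exact: bounded_mfun_cst. Qed.

Let vac_etaE x : vac_eta x = ent h r u x - L * r x.
Proof. by rewrite /vac_eta relE /ent; field. Qed.

Let vac_fluxE x : x.2 / 2 * vac_eta x - vac_flux x =
  ent_b p h r u x + L * mass_b r u x.
Proof. by rewrite /vac_flux vac_etaE /ent_b /mass_b /flux /ent; field. Qed.

Let vac_sourceE x : 2^-1 * vac_eta x + alpha * vac_K x - 0 =
  ent_c alpha h r u x + L * mass_c r x.
Proof. by rewrite vac_etaE /ent_c /mass_c /ent /vac_K; field. Qed.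

Let beta : bounded_mfun vac_eta.
Proof.
have [be _] := bounded_mfun_ent_flux p_cont h_cont br bu r_ge0.
rewrite (_ : vac_eta = fun x => ent h r u x + - L * r x).
  by apply: bounded_mfun_add => //; exact: bscale.
by apply/funext => x; rewrite vac_etaE mulNr.
Qed.

Let bflux : bounded_mfun vac_flux.
Proof.
apply: bounded_mfun_add; first exact: bounded_mfun_mul.
by apply: bounded_mfun_mul => //; exact: bounded_mfun_comp_ge0.
Qed.

Let control (T : R) : exists2 C : R, 0 <= C & forall x, strip T x ->
  vac_K x <= C * vac_eta x /\ `|vac_flux x| <= C * vac_eta x.
Proof.
have [B B0 HB] := state_bound T.
have [c c0 HC] := vacuum_pressure_control p_cont p_C1 p_incr h_cont h_C2 h_potential vacuum.
pose D := 2 * expR T; have D0 : 0 <= D by rewrite mulr_ge0// expR_ge0.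
have KD x : strip T x -> vac_K x <= D * vac_eta x.
  move=> /andP[x0 xT]; rewrite /vac_eta /D.
  have k0 := K_ge0 x0; have f0 := rel_ge0 x0.
  have e1 : 1 <= expR T * expR (- x.1) by rewrite -expRD -[leLHS]expR0 ler_expR subr_ge0.
  have e2 : vac_K x <= expR T * expR (- x.1) * vac_K x by rewrite ler_peMl.
  have e3 : 0 <= 2 * expR T * relative h (r x) 0 by rewrite mulr_ge0.
  apply: (le_trans e2); rewrite mulrDr -[leLHS]addr0 lerD//.
  by rewrite le_eqVlt /vac_K; apply/orP; left; apply/eqP; field.
exists (Num.max D (B + B * c)); first by rewrite le_max D0.
move=> x sx; have /andP[x0 xT] := sx; have e0 := eta_ge0 x0.
split; first by apply: le_trans (KD x sx) _; rewrite ler_wpM2r// le_max lexx.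
apply: (@le_trans _ _ ((B + B * c) * vac_eta x)); last first.
  by rewrite ler_wpM2r// le_max lexx orbT.
have [rB uB] := HB x x0 xT.
rewrite [leRHS]mulrDl /vac_flux; apply: le_trans (ler_normD _ _) _; apply: lerD.
  by rewrite normrM (ger0_norm e0) ler_wpM2r.
(* [vacuum_pressure_control] speaks of positive densities; at density 0 the velocity is 0. *)
have [r00|r00] := eqVneq (r x) 0.
  by rewrite (u_vac r00) mul0r normr0 mulr_ge0// mulr_ge0.
have rp : 0 < r x by rewrite lt_neqAle eq_sym r00 r_ge0.
rewrite normrM -mulrA; apply: ler_pM => //.
apply: le_trans (HC _ rp) _; rewrite ler_wpM2l//.
by rewrite /vac_eta lerDr mulr_ge0 ?K_ge0// mulr_ge0// expR_ge0.
Qed.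

Let W : weak_balance (fun x => L * mass_a r x) (fun x => L * mass_b r u x)
  (fun x => L * mass_c r x) (fun y => L * r0 y).
Proof.
have [A B C] := bounded_mfun_mass br bu.
have Lb (g : R * R -> R) : bounded_mfun g -> L1box g by exact: bounded_mfun_L1box.
move=> f f1 f2 T Y T0 Y0 tf; have mo := @measurable_ohp R.
have I1 := C1_test_integrable (Lb _ A) (Lb _ B) (Lb _ C) tf.
have J1 := C1_test_seg_integrable tf ir0.
rewrite (_ : \int[leb R]_y _ = L * \int[leb R]_y (f (0, y) * r0 y)).
  rewrite (_ : \int[leb2 R]_(x in ohp) _ =
      L * \int[leb2 R]_(x in ohp) balance_integrand (mass_a r) (mass_b r u) (mass_c r) f f1 f2 x).
    by rewrite (W1 T0 Y0 tf) mulrN.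
  rewrite -(RintegralZl _ mo I1); apply: eq_Rintegral => x _; rewrite /balance_integrand; ring.
rewrite -(RintegralZl _ (@measurableT _ (measurableTypeR R)) J1).
by apply: eq_Rintegral => y _; ring.
Qed.

Let eta0E_sum y : eta0 y = entropy h 0 (r0 y) (m0 y) - L * r0 y.
Proof.
rewrite eta0E /rel_entropy /rel_kinetic relE /entropy oppr0 expR0 !mul0r subr0 real_normK ?num_real//.
have [r00|r00] := eqVneq (r0 y) 0; last by field.
by rewrite (m0_vac r00) r00 !(mulr0, mul0r, invr0, expr0n)/=; ring.
Qed.

Let eta0_ge0 y : 0 <= eta0 y.
Proof.
rewrite eta0E /rel_entropy addr_ge0//.
  by rewrite mulr_ge0 ?mulr_ge0 ?expR_ge0.
exact: (vacuum_relative_ge0 p_C1 p_incr h_cont h_C2 h_potential vacuum (r0_ge0 y)).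
Qed.

Let is0 : L1seg (fun y => L * r0 y).
Proof.
by apply: (@L1seg_continuous_mul R (fun=> L)) => // x; exact: cvg_cst.
Qed.

Let ie0 : L1seg (fun y => entropy h 0 (r0 y) (m0 y)).
Proof.
rewrite (_ : (fun y => _) = fun y => eta0 y + L * r0 y).
  apply: (L1seg_add _ is0) => Y; apply: integrableS ieta0 => //; exact: measurable_itv.
by apply/funext => y; rewrite eta0E_sum; ring.
Qed.

Theorem vacuum_energy_estimate : energy_estimate alpha vac_eta vac_K (fun=> 0) eta0.
Proof.
have [A B C] := bounded_mfun_mass br bu.
have [ea eb ec] := bounded_mfun_entropy alpha p_cont h_cont br bu r_ge0.
have Lb (g : R * R -> R) : bounded_mfun g -> L1box g by exact: bounded_mfun_L1box.
have [m1 _] := beta; have [m2 _] := bK.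
apply: (localization (q := vac_flux)) => //; try exact: Lb.
  by move=> T; apply: integrable0.
move=> f f1 f2 T Y T0 Y0 tf f0.
have := entropy_balance_add (Lb _ (bscale L A)) (Lb _ (bscale L B)) (Lb _ (bscale L C))
  is0 (Lb _ ea) (Lb _ eb) (Lb _ ec) ie0 W T0 Y0 tf (W3 ie0 T0 Y0 tf f0).
rewrite (_ : (fun x => ent_a h r u x + L * mass_a r x) = fun x => - vac_eta x); last first.
  by apply/funext => x; rewrite vac_etaE /ent_a /mass_a; ring.
rewrite (_ : (fun x => ent_b p h r u x + L * mass_b r u x) =
    fun x => x.2 / 2 * vac_eta x - vac_flux x); last first.
  by apply/funext => x; rewrite vac_fluxE.
rewrite (_ : (fun x => ent_c alpha h r u x + L * mass_c r x) =
    fun x => 2^-1 * vac_eta x + alpha * vac_K x - 0); last first.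
  by apply/funext => x; rewrite vac_sourceE.
by rewrite (_ : (fun y => f (0, y) * eta0 y) = fun y => f (0, y) * (entropy h 0 (r0 y) (m0 y) - L * r0 y))//;
  apply/funext => y; rewrite eta0E_sum.
Qed.

End RelativeVacuum.

(** * Iterated integrals *)

Section SpaceTime.
Context {R : realType}.
Local Notation R2 := (measurableTypeR R * measurableTypeR R)%type.
Local Notation R1 := (measurableTypeR R).
Local Notation ohp := (@open_half_plane R).

Let mpos : measurable (`]0, +oo[%classic : set R1). Proof. exact: measurable_itv. Qed.

(** The slices of [g] may have infinite integrals, so Tonelli is applied to the positive and
    negative parts separately. *)
Lemma measurable_slice_integral (g : R * R -> R) : measurable_fun (ohp : set R2) g ->
  measurable_fun (`]0, +oo[%classic : set R1) (fun t : R => \int[leb R]_y (g (t, y))%:E)%E.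
Proof.
move=> mg; have mo := @measurable_ohp R.
pose G := (EFin \o g) \_ ohp.
have mG : measurable_fun (setT : set R2) G by apply/(measurable_restrictT _ mo); exact/measurable_EFinP.
have mF : measurable_fun (setT : set R1) (fun t => \int[leb R]_y G (t, y))%E.
  have mp := measurable_fun_fubini_tonelli_F (m2 := @lebesgue_measure R) _
    (measurable_funepos mG) (fun x => funepos_ge0 _ _).
  have mn := measurable_fun_fubini_tonelli_F (m2 := @lebesgue_measure R) _
    (measurable_funeneg mG) (fun x => funeneg_ge0 _ _).
  apply: eq_measurable_fun (emeasurable_funB mp mn) => t _.
  rewrite [RHS]integralE /fubini_F; congr (_ - _)%E; apply: eq_integral => y _.
    by rewrite funepos_comp.
  by rewrite funeneg_comp.
apply: eq_measurable_fun (measurable_funTS mF) => t; rewrite inE/= in_itv/= andbT => t0.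
by apply: eq_integral => y _; rewrite /G patchE mem_set.
Qed.

(** By Tonelli the measures of the slices integrate to that of [N]. *)
Lemma null_slices (N : set R2) : measurable N -> leb2 R N = 0%E ->
  exists Z : set R1, [/\ measurable Z, leb R Z = 0%E &
    forall t, ~ Z t -> leb R (xsection N t) = 0%E].
Proof.
move=> mN N0.
have mx : measurable_fun (setT : set R1) (@lebesgue_measure R \o xsection N).
  exact: measurable_fun_xsection.
have I0 : (\int[leb R]_t `|(@lebesgue_measure R \o xsection N) t| = 0)%E.
  by rewrite -[RHS]N0; apply: eq_integral => t _; rewrite gee0_abs.
have /(ae_eq_integral_abs (leb R) measurableT mx)[Z [mZ Z0 HZ]] := I0.
exists Z; split=> // t Zt; apply: contrapT => H; apply: Zt; apply: HZ => /(_ I) /= H'.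
by apply: H.
Qed.

Lemma strip_fubini (g : R * R -> R) (T : R) :
  (leb2 R).-integrable (strip T) (EFin \o g) ->
  let S x := \1_(strip T) x * g x in
  [/\ (leb R).-integrable setT (fun t => \int[leb R]_y (S (t, y))%:E)%E,
      (\int[leb2 R]_(x in strip T) (g x)%:E =
       \int[leb R]_(t in `]0%R, +oo[) \int[leb R]_y (S (t, y))%:E)%E &
      exists Z : set R1, [/\ measurable Z, leb R Z = 0%E &
        forall t, ~ Z t -> (leb R).-integrable setT (EFin \o (fun y => S (t, y)))]].
Proof.
move=> ig S; have ms := measurable_strip T.
have SE : EFin \o S = (EFin \o g) \_ (strip T).
  apply/funext => x; rewrite patchE /= /S indicE; case: ifPn => _; first by rewrite mul1r.
  by rewrite mul0r.
have iS : (leb2 R).-integrable setT (EFin \o S).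
  by rewrite SE; exact: (integrable_mkcond (mu := leb2 R) (EFin \o g) ms).1.
split.
- exact: (@integrable_fubini_F _ _ _ _ R (@lebesgue_measure R) (@lebesgue_measure R) _ iS).
- rewrite integral_mkcond -SE.
  transitivity (\int[leb R]_t \int[leb R]_y (S (t, y))%:E)%E.
    by rewrite -(@integral12_prod_meas1 _ _ _ _ R (@lebesgue_measure R) (@lebesgue_measure R) _ iS).
  apply: integral_support => // t _; rewrite /= in_itv/= andbT => /negP t0.
  rewrite integral0_eq// => y _; rewrite /S indicE memNset; last first.
  by move=> /andP[t1 _]; move: t0; rewrite /= t1.
  by rewrite mul0r.
- have [Z [mZ Z0 HZ]] := @ae_integrable1 _ _ _ _ R (@lebesgue_measure R) (@lebesgue_measure R) _ iS.
  exists Z; split=> // t Zt; apply: contrapT => H; apply: Zt; apply: HZ => /= H'; exact: H.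
Qed.

End SpaceTime.

(** * From the half plane to iterated integrals *)

Section Iterated.
Context {R : realType}.
Local Notation R2 := (measurableTypeR R * measurableTypeR R)%type.
Local Notation R1 := (measurableTypeR R).
Local Notation ohp := (@open_half_plane R).

Let mpos : measurable (`]0, +oo[%classic : set R1). Proof. exact: measurable_itv. Qed.

Lemma integral_EFin d (T : measurableType d) (mu : {measure set T -> \bar R}) (D : set T)
  (f : T -> R) : measurable D -> mu.-integrable D (EFin \o f) ->
  (\int[mu]_(x in D) (f x)%:E = (\int[mu]_(x in D) f x)%:E)%E.
Proof. by move=> mD fi; rewrite /Rintegral fineK//; exact: integrable_fin_num. Qed.

Variables (alpha : R) (eta K X e k : R * R -> R) (eta0 : R -> R) (N : set R2).
Hypotheses (mN : measurable N) (muN : leb2 R N = 0%E)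
  (me : measurable_fun (ohp : set R2) e) (mk : measurable_fun (ohp : set R2) k)
  (e_off : forall x, ohp x -> ~ N x -> e x = eta x)
  (k_off : forall x, ohp x -> ~ N x -> k x = K x)
  (est : energy_estimate alpha eta K X eta0)
  (iX : forall T, (leb2 R).-integrable (strip T) (EFin \o X)).
Variables (phi dphi : R -> R) (T : R).
Hypotheses (T0 : 0 < T) (Dphi : forall t : R, is_derive t 1 phi (dphi t))
  (cdphi : continuous dphi)
  (phi_end : forall t : R, T <= t -> phi t = 0 /\ dphi t = 0)
  (phi_ge0 : forall t : R, 0 <= t -> 0 <= phi t).

(** Formed with the original [e] and [k]. The values are extended reals because the slices are known
    to be finite for almost every time only. *)
Definition energy_rate (t : R) : \bar R :=
  (- (dphi t)%:E * (\int[leb R]_y (e (t, y))%:E)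
   + (phi t)%:E * ((2^-1)%:E * (\int[leb R]_y (e (t, y))%:E)
     + alpha%:E * (\int[leb R]_y (k (t, y))%:E)))%E.

Let restr (g : R * R -> R) (x : R * R) : R := \1_(strip T) x * g x.

Let restr_in g (t y : R) : 0 < t -> t <= T -> restr g (t, y) = g (t, y).
Proof. by move=> t0 tT; rewrite /restr indicE mem_set ?mul1r//; apply/andP. Qed.

Let restr_out g (t y : R) : T < t -> restr g (t, y) = 0.
Proof.
move=> tT; rewrite /restr indicE memNset ?mul0r//; move=> /andP[_ /=].
by rewrite leNgt tT.
Qed.

Let slice_section t y : ~ N (t, y) <-> ~ xsection N t y.
Proof. by rewrite /xsection/= inE. Qed.

(** Up to [T] and off a null set of times, the slices of [eta], [K] and [X] are integrable, and
    those of [e] and [k] agree with the first two almost everywhere. There the extended arithmetic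
    of [energy_rate] is that of the reals. *)
Lemma iterated_energy_ineq :
  (leb R).-integrable (`]0, +oo[%classic : set R1) energy_rate /\
  (\int[leb R]_(t in `]0%R, +oo[) energy_rate t <=
   (phi 0 * \int[leb R]_y eta0 y)%:E +
   \int[leb R]_(t in `]0%R, +oo[) ((phi t)%:E * \int[leb R]_y (X (t, y))%:E))%E.
Proof.
have mo := @measurable_ohp R; have mT : measurable (setT : set R1) by [].
have [/(_ T (ltW T0))[ie iK] /(_ phi dphi T T0 Dphi cdphi phi_end phi_ge0)[ien ineq]] := est.
pose en := energy alpha eta K phi dphi.
pose pX (x : R * R) := phi x.1 * X x.
have ipX : (leb2 R).-integrable ohp (EFin \o pX) := iphi_xi iX Dphi phi_end.
have en0 (x : R * R) : T < x.1 -> en x = 0.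
  by move=> /ltW/phi_end[p0 p1]; rewrite /en /energy p0 p1 oppr0 !mul0r addr0.
have pX0 (x : R * R) : T < x.1 -> pX x = 0 by move=> /ltW/phi_end[p0 _]; rewrite /pX p0 mul0r.
have so := @strip_ohp R T; have ms := measurable_strip T.
have ienT : (leb2 R).-integrable (strip T) (EFin \o en) := integrableS mo ms so ien.
have ipXT : (leb2 R).-integrable (strip T) (EFin \o pX) := integrableS mo ms so ipX.
have [_ _ [Z1 [mZ1 Z10 HZ1]]] := strip_fubini ie.
have [_ _ [Z2 [mZ2 Z20 HZ2]]] := strip_fubini iK.
have [_ _ [Z3 [mZ3 Z30 HZ3]]] := strip_fubini (iX T).
have [iF FE _] := strip_fubini ienT.
have [iG GE _] := strip_fubini ipXT.
have [Z4 [mZ4 Z40 HZ4]] := null_slices mN muN.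
pose Z := Z1 `|` Z2 `|` Z3 `|` Z4.
have mZ : measurable Z by do 3! apply: measurableU => //.
have Z0 : leb R Z = 0%E.
  have mZ12 : measurable (Z1 `|` Z2) by exact: measurableU.
  by rewrite /Z !null_set_setU//; exact: measurableU.
have ZP t : ~ Z t -> [/\ ~ Z1 t, ~ Z2 t, ~ Z3 t & ~ Z4 t].
  move=> H; split=> H'; apply: H; [by do 3! left|by left; left; right|by left; right|by right].
have sl (f g : R * R -> R) t : (forall x, ohp x -> ~ N x -> f x = g x) -> 0 < t -> t <= T ->
    ~ Z4 t -> (\int[leb R]_y (f (t, y))%:E = \int[leb R]_y (restr g (t, y))%:E)%E.
  move=> fg t0 tT Zt; apply: (@eq_integral_off_null _ _ _ (leb R) setT (xsection N t)).
  - exact: measurable_xsection.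
  - exact: HZ4.
  - by move=> y _ /slice_section Ny; rewrite restr_in// fg.
have rateE t : `]0, +oo[%classic t -> ~ Z t ->
    energy_rate t = (\int[leb R]_y (restr en (t, y))%:E)%E.
  rewrite /= in_itv/= andbT => t0 /ZP[nZ1 nZ2 _ nZ4].
  (* After [T] the slices may be infinite, but [phi] and [dphi] vanish, and 0 times infinity is
     0. *)
  have [tT|Tt] := leP t T; last first.
    rewrite integral0_eq => [|y _]; last by rewrite restr_out.
    by rewrite /energy_rate; have [-> ->] := phi_end (ltW Tt); rewrite oppe0 !mul0e adde0.
  have I1 := HZ1 t nZ1; have I2 := HZ2 t nZ2.
  have Ien : (leb R).-integrable setT (EFin \o (fun y => restr en (t, y))).
    have J1 := integrableZl mT (- dphi t) I1.
    have J2 := integrableZl mT 2^-1 I1; have J3 := integrableZl mT alpha I2.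
    have H : (leb R).-integrable setT (EFin \o (fun y => - dphi t * restr eta (t, y) + phi t *
        (2^-1 * restr eta (t, y) + alpha * restr K (t, y)))).
      exact: (integrable_add mT J1 (integrableZl mT (phi t) (integrable_add mT J2 J3))).
    by apply: eq_integrable H => // y _; congr EFin; rewrite !restr_in.
  rewrite /energy_rate (sl e eta)// (sl k K)// !(integral_EFin mT)//.
  transitivity (- dphi t * (\int[leb R]_y restr eta (t, y)) + phi t *
    (2^-1 * (\int[leb R]_y restr eta (t, y)) + alpha * (\int[leb R]_y restr K (t, y))))%:E => //.
  transitivity (\int[leb R]_y (- dphi t * restr eta (t, y) + phi t *
      (2^-1 * restr eta (t, y) + alpha * restr K (t, y))))%:E.
    congr EFin.
    have J1 := integrableZl mT (- dphi t) I1.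
    have J2 := integrableZl mT 2^-1 I1; have J3 := integrableZl mT alpha I2.
    have J4 := integrable_add mT J2 J3; have J5 := integrableZl mT (phi t) J4.
    rewrite (RintegralD mT J1 J5) (RintegralZl _ mT I1) (RintegralZl _ mT J4).
    by rewrite (RintegralD mT J2 J3) (RintegralZl _ mT I1) (RintegralZl _ mT I2).
  by congr EFin; apply: eq_Rintegral => y _; rewrite !restr_in.
have ctime (f : R -> R) : continuous f -> measurable_fun (`]0, +oo[%classic : set R1) (EFin \o f).
  by move=> cf; apply/measurable_EFinP; apply: measurable_funTS; exact: continuous_measurable_fun.
have cphi : continuous phi.
  by move=> t; apply: differentiable_continuous; apply/derivable1_diffP; case: (Dphi t).
have mrate : measurable_fun (`]0, +oo[%classic : set R1) energy_rate.
  have m1 := measurable_slice_integral me; have m2 := measurable_slice_integral mk.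
  apply: emeasurable_funD.
    apply: emeasurable_funM m1.
    by apply: (ctime (fun t => - dphi t)) => t; apply: cvgN; exact: cdphi.
  apply: emeasurable_funM; first exact: ctime.
  apply: emeasurable_funD; apply: emeasurable_funM => //.
have iFp := integrableS mT mpos (@subsetT _ _) iF.
split.
  apply/integrableP; split=> //; have /integrableP[_] := iFp.
  rewrite (@eq_integral_off_null _ _ _ (leb R) _ Z (fun t => `|energy_rate t|)%E
    (fun t => `|\int[leb R]_y (restr en (t, y))%:E|)%E mZ Z0)//.
  by move=> t tp nZ; rewrite rateE.
rewrite (eq_integral_off_null mZ Z0 rateE).
rewrite (@eq_integral_off_null _ _ _ (leb R) _ Z
    (fun t => (phi t)%:E * \int[leb R]_y (X (t, y))%:E)%E
    (fun t => \int[leb R]_y (restr pX (t, y))%:E)%E mZ Z0); last first.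
  rewrite /= => t; rewrite in_itv/= andbT => t0 /ZP[_ _ nZ3 _].
  have [tT|Tt] := leP t T; last first.
    rewrite [RHS]integral0_eq => [|y _]; last by rewrite restr_out.
    by have [-> _] := phi_end (ltW Tt); rewrite mul0e.
  have I3 := HZ3 t nZ3.
  rewrite (_ : (\int[leb R]_y (X (t, y))%:E)%E = (\int[leb R]_y (restr X (t, y))%:E)%E); last first.
    by apply: eq_integral => y _; rewrite restr_in.
  rewrite -(integralZl mT I3).
  by apply: eq_integral => y _; rewrite -[((EFin \o _) y)]/((restr X (t, y))%:E) !restr_in.
rewrite [X in (X <= _)%E](esym FE) [X in (_ <= _ + X)%E](esym GE).
rewrite !(integral_EFin ms)// -EFinD lee_fin.
by rewrite -(integral_strip en0) -(integral_strip pX0).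
Qed.

End Iterated.

(** * The theorem *)

Section Reference.
Context {R : realType}.
Local Notation R2 := (measurableTypeR R * measurableTypeR R)%type.
Local Notation R1 := (measurableTypeR R).
Local Notation ohp := (@open_half_plane R).
Implicit Types f g : R * R -> R.

Lemma ae_off_null d (T : measurableType d) (mu : {measure set T -> \bar R}) (P : T -> Prop) :
  {ae mu, forall x, P x} ->
  exists N : set T, [/\ measurable N, mu N = 0%E & forall x, ~ N x -> P x].
Proof.
by move=> [N [mN N0 H]]; exists N; split=> // x Nx; apply: contrapT => /H.
Qed.

Lemma ohp_half_plane : ohp `<=` @half_plane R.
Proof. by move=> x /ltW. Qed.

Lemma measurable_half_plane : measurable (@half_plane R : set R2).
Proof.
have -> : @half_plane R = `[0, +oo[%classic `*` setT.
  apply/seteqP; split=> [x|x [/=]]; first by rewrite /half_plane /setX/= in_itv/= andbT.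
  by rewrite /half_plane/= in_itv/= andbT.
by apply: measurableX => //; exact: measurable_itv.
Qed.

(** Constant continuation to negative times. It carries the continuity and the bounds of the
    reference state over to the whole plane, where the multipliers are defined. *)
Definition extend f (x : R * R) : R := f (ramp x.1, x.2).

Lemma extend_half_plane f x : half_plane x -> extend f x = f x.
Proof. by case: x => t y t0; rewrite /extend ramp_id. Qed.

Lemma continuous_extend f : {within @half_plane R, continuous f} ->
  forall x : R * R, {for x, continuous (extend f)}.
Proof.
move=> cf x; pose s (x : R * R) : R * R := (ramp x.1, x.2).
have hs z : half_plane (s z) by exact: ramp_ge0.
have cs : s z @[z --> x] --> s x.
  have c1 : ramp z.1 @[z --> x] --> ramp x.1.
    by apply: (@continuous_comp _ _ _ fst ramp); [exact: cvg_fst|exact: continuous_ramp].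
  have c2 : z.2 @[z --> x] --> x.2 by exact: cvg_snd.
  exact: (@cvg_pair (R * R)%type R R (nbhs x) (nbhs (ramp x.1)) (nbhs x.2) _ _ _
    (fun z => ramp z.1) snd c1 c2).
have fx : f @ within (@half_plane R) (nbhs (s x)) --> f (s x).
  by move/subspace_continuousP : cf => /(_ _ (hs x)).
move=> U /fx /= H; have H' := cs _ H.
by apply: (@filterS _ (nbhs x) _ _ _ _ H') => z Hz; exact: Hz (hs z).
Qed.

Lemma C1_at_extend f x : C1_open_half_plane f -> {within @half_plane R, continuous f} ->
  ohp x -> C1_at f (d_tau f) (d_y f) x /\ C1_at (extend f) (d_tau f) (d_y f) x.
Proof.
move=> Cf cf ox; have [d1 d2 c1 c2] := Cf x ox.
have E : \forall z \near x, ohp z by apply: open_nbhs_nbhs; split=> //; exact: open_ohp.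
have cfx : {for x, continuous f}.
  have := continuous_extend cf (x := x).
  have E' : \forall z \near x, extend f z = f z.
    by apply: filterS E => z /ohp_half_plane; exact: extend_half_plane.
  rewrite /prop_for /continuous_at (nbhs_singleton E').
  exact: (cvg_trans (near_eq_cvg E')).
have H : C1_at f (d_tau f) (d_y f) x by split=> //; exact/derivableP.
split=> //; apply: near_eq_C1_at H; apply: filterS E => z /ohp_half_plane hz.
by rewrite extend_half_plane.
Qed.

Lemma measurable_rel_entropy0 (h : R -> R) (r m b c : R -> R) :
  (forall y, 0 <= r y) -> measurable_fun (setT : set R1) r -> measurable_fun (setT : set R1) m ->
  {within `[0, +oo[, continuous h} ->
  measurable_fun (setT : set R1) (fun y => c y / b y) ->
  measurable_fun (setT : set R1) (fun y => h (b y)) ->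
  measurable_fun (setT : set R1) (fun y => deriv_ge0 h (b y)) ->
  measurable_fun (setT : set R1) b ->
  measurable_fun (setT : set R1) (fun y => rel_entropy h 0 (r y) (m y) (b y) (c y)).
Proof.
move=> r0 mr mm ch mcb mhb mdb mb; rewrite /rel_entropy /rel_kinetic /relative.
apply: measurable_funD.
  apply: measurable_funM => //; apply: measurable_funM => //.
  (* For a nonnegative density the inverse is the power with exponent - 1, a measurable function. *)
  rewrite (_ : (fun y => _) = fun y => (m y * powR (r y) (- 1) - c y / b y) ^+ 2); last first.
    by apply/funext => y; rewrite real_normK ?num_real// powR_inv1.
  apply: measurable_funX; apply: measurable_funB => //; apply: measurable_funM => //.
  exact: (measurableT_comp (measurable_powR (- 1))).
apply: measurable_funB.
  apply: measurable_funB => //.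
  rewrite (_ : (fun y => h (r y)) = (fun t => h (ramp t)) \o r).
    apply: measurableT_comp => //; apply: continuous_measurable_fun.
    exact: continuous_ramp_comp.
  by apply/funext => y /=; rewrite ramp_id.
by apply: measurable_funM => //; exact: measurable_funB.
Qed.

Lemma C1_test_fun_end (phi : R -> R) : C1_test_fun phi ->
  exists2 T : R, 0 < T & forall t : R, T <= t -> phi t = 0 /\ derive1 phi t = 0.
Proof.
move=> [_ _ cs]; have [M [_ HM]] := compact_bounded cs.
pose B := Num.max 0 (M + 1).
have out (t : R) : B < t -> phi t = 0.
  move=> Bt; apply: contrapT => /eqP pt.
  have M1 : M < M + 1 by rewrite ltrDl.
  have ct : closure [set x | phi x != 0] t by apply: subset_closure.
  have tM : `|t| <= M + 1 := HM _ M1 t ct.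
  move: tM; rewrite leNgt => /negP; apply.
  apply: lt_le_trans (ler_norm t); apply: le_lt_trans Bt; by rewrite le_max lexx orbT.
(* One beyond the bound: then [phi] vanishes on a neighbourhood, and its derivative with it. *)
exists (B + 1); first by rewrite ltr_wpDl// le_max lexx.
move=> t Tt; have Bt : B < t by apply: lt_le_trans Tt; rewrite ltrDl.
split; first exact: out.
have E : \forall s \near t, 0 = phi s.
  by near=> s; rewrite out//; near: s; exact: lt_nbhsr.
have := near_eq_is_derive E (is_derive_cst (0 : R) t 1).
by rewrite derive1E => H; rewrite (@derive_val _ _ _ _ _ _ _ H).
Unshelve. all: by end_near. Qed.

End Reference.

(** * Application to the weak solution *)

Section MainEstimate.
Context {R : realType}.
Local Notation R2 := (measurableTypeR R * measurableTypeR R)%type.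
Local Notation R1 := (measurableTypeR R).
Local Notation ohp := (@open_half_plane R).
Variables (alpha : R) (p h : R -> R)
    (rho n : R * R -> R) (rho0 n0 : R -> R) (rhobar nbar : R * R -> R)
    (alpha_ge0 : 0 <= alpha)
    (p_cont : {within `[0, +oo[, continuous p})
    (p_C1 : C1_pos p)
    (p_incr : forall z : R, 0 < z -> 0 < derive1 p z)
    (h_cont : {within `[0, +oo[, continuous h})
    (h_C2 : C2_pos h)
    (h_potential : forall z : R, 0 < z -> p z = z * derive1 h z - h z)
    (data0 : initial_data rho0 n0)
    (sol : weak_solution alpha p rho n rho0 n0)
    (entropic : local_entropy_condition alpha h rho n rho0 n0)
    (E0_finite : (total_rel_entropy h 0%R rho0 n0
                    (fun y => rhobar (0%R, y)) (fun y => nbar (0%R, y)) < +oo)%E)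
    (xi_L1 : L1_loc_L1 (xi alpha p h rho n rhobar nbar)).

Let e (x : R * R) : R := rel_entropy h x.1 (rho x) (n x) (rhobar x) (nbar x).
Let k (x : R * R) : R := rel_kinetic (rho x) (n x) (rhobar x) (nbar x).
Let X := xi alpha p h rho n rhobar nbar.

(** The bounds on the time intervals [0, k] with integer k are countably many statements almost
    everywhere, so one null set serves them all. *)
Lemma clean_null_sets : exists (N : set R2) (N0 : set R1) (M : nat -> R),
  [/\ measurable N, leb2 R N = 0%E, measurable N0, leb R N0 = 0%E &
   (forall x : R * R, ohp x -> ~ N x ->
     [/\ 0 <= rho x, rho x = 0 -> n x = 0 &
      forall k : nat, x.1 <= k%:R -> `|rho x| <= M k /\ `|n x / rho x| <= M k]) /\
   (forall y : R, ~ N0 y -> 0 <= rho0 y /\ (rho0 y = 0 -> n0 y = 0))].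
Proof.
have [_ _ r0_ge0 vac0] := data0; have [[_ _ _ vac _] r_ge0 _ _] := sol.
have [[_ br] [_ bv] _ _] := entropic.
have [M1 HM1] := choice (fun k : nat => br k%:R).
have [M2 HM2] := choice (fun k : nat => bv k%:R).
have A1 := ae_foralln HM1; have A2 := ae_foralln HM2.
have [N [mN muN HN]] := ae_off_null (filterI (filterI A1 A2) (filterI vac r_ge0)).
have [Na [mNa muNa HNa]] := ae_off_null r0_ge0.
have [Nb [mNb muNb HNb]] := ae_off_null vac0.
exists N, (Na `|` Nb), (fun k => Num.max (M1 k) (M2 k)); split;
  [exact: mN|exact: muN|exact: measurableU|by rewrite null_set_setU|split].
  move=> x ox /HN[[b1 b2] [v g]]; have hx := ohp_half_plane ox.
  split; [exact: g|exact: v|move=> i xi'].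
  have xI : 0 <= x.1 <= i%:R by rewrite xi' andbT.
  by rewrite !le_max (b1 i xI) (b2 i xI) orbT.
by move=> y /not_orP[/HNa g /HNb v]; split=> [|y0]; [exact: g|exact: v].
Qed.

Let mhp := @measurable_half_plane R.
Let on_ohp (f : R * R -> R) : measurable_fun (@half_plane R : set R2) f ->
  measurable_fun (ohp : set R2) f.
Proof. by apply: measurable_funS => //; exact: ohp_half_plane. Qed.

Let mrho : measurable_fun (ohp : set R2) rho.
Proof. by have [[m _] _ _ _] := entropic; exact: on_ohp. Qed.
Let mvel : measurable_fun (ohp : set R2) (fun x => n x / rho x).
Proof. by have [_ [m _] _ _] := entropic; exact: on_ohp. Qed.
Let mhrho : measurable_fun (ohp : set R2) (fun x => h (rho x)).
Proof. by have [_ _ [m _] _] := entropic; exact: on_ohp. Qed.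

Lemma L1seg_locally_integrable (f : R -> R) :
  locally_integrable setT f -> L1seg f /\ measurable_fun (setT : set R1) f.
Proof.
move=> [mf _ If]; split=> // Y; apply/integrableP; split.
  by apply/measurable_EFinP; exact: measurable_funTS.
exact: (If `[- Y, Y]%classic (@subsetT _ _) (@segment_compact _ _ _)).
Qed.

Let ir0 : L1seg rho0 /\ measurable_fun (setT : set R1) rho0.
Proof. by have [i _ _ _] := data0; exact: L1seg_locally_integrable. Qed.
Let in0 : L1seg n0 /\ measurable_fun (setT : set R1) n0.
Proof. by have [_ i _ _] := data0; exact: L1seg_locally_integrable. Qed.

Lemma measurable_rel_density (ub : R * R -> R) :
  (forall x, ohp x -> nbar x / rhobar x = ub x) ->
  measurable_fun (ohp : set R2) ub -> measurable_fun (ohp : set R2) rhobar ->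
  measurable_fun (ohp : set R2) (fun x => h (rhobar x)) ->
  measurable_fun (ohp : set R2) (fun x => deriv_ge0 h (rhobar x)) ->
  measurable_fun (ohp : set R2) e /\ measurable_fun (ohp : set R2) k.
Proof.
move=> ubE mub mb mhb mdb.
have mK : measurable_fun (ohp : set R2) k.
  apply: (@eq_measurable_fun _ _ _ _ _ (fun x => rho x * (n x / rho x - ub x) ^+ 2)).
    by move=> x; rewrite inE => ox; rewrite /k /rel_kinetic real_normK ?num_real// ubE.
  by apply: measurable_funM => //; apply: measurable_funX; exact: measurable_funB.
split=> //; apply: measurable_funD.
  apply: measurable_funM => //; apply: measurable_funM => //.
  have [m _] : bounded_mfun (fun x : R * R => expR (- x.1)); last exact: m.
  apply: (bounded_mfun_time (k := fun t => expR (- t))) => t.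
  apply: (@continuous_comp _ _ _ -%R expR); last exact: continuous_expR.
  by apply: cvgN; exact: cvg_id.
apply: measurable_funB; first exact: measurable_funB.
by apply: measurable_funM => //; exact: measurable_funB.
Qed.

Section Clean.
Variables (N : set R2) (N0 : set R1) (M : nat -> R).
Hypotheses (mN : measurable N) (muN : leb2 R N = 0%E)
  (mN0 : measurable N0) (muN0 : leb R N0 = 0%E)
  (good : forall x : R * R, ohp x -> ~ N x ->
    [/\ 0 <= rho x, rho x = 0 -> n x = 0 &
        forall k : nat, x.1 <= k%:R -> `|rho x| <= M k /\ `|n x / rho x| <= M k])
  (good0 : forall y : R, ~ N0 y -> 0 <= rho0 y /\ (rho0 y = 0 -> n0 y = 0)).

Local Notation r := (dens rho N).
Local Notation u := (vel rho n N).
Local Notation r0 := (dens0 rho0 N0).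
Local Notation m0 := (mom0 n0 N0).

Let eta0 (y : R) : R := rel_entropy h 0 (r0 y) (m0 y) (rhobar (0, y)) (nbar (0, y)).

(** Here the finiteness of the initial relative entropy enters: it makes the reset initial density
    integrable. *)
Let eta0_int : (forall y, 0 <= eta0 y) -> measurable_fun (setT : set R1) eta0 ->
  (leb R).-integrable setT (EFin \o eta0) /\
  ((\int[leb R]_y eta0 y)%:E = total_rel_entropy h 0%R rho0 n0
                    (fun y => rhobar (0%R, y)) (fun y => nbar (0%R, y)))%E.
Proof.
move=> eta0_ge0 meta0.
have E : (\int[leb R]_y (eta0 y)%:E = total_rel_entropy h 0%R rho0 n0
                    (fun y => rhobar (0%R, y)) (fun y => nbar (0%R, y)))%E.
  apply: (@eq_integral_off_null _ _ _ (leb R) setT N0 _ _ mN0 muN0) => y _ Ny.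
  by rewrite /eta0; have [-> ->] := dens0_off rho0 n0 Ny.
have I : (leb R).-integrable setT (EFin \o eta0).
  apply/integrableP; split; first exact/measurable_EFinP.
  rewrite (_ : (\int[leb R]_y `|(EFin \o eta0) y|)%E = (\int[leb R]_y (eta0 y)%:E)%E).
    by rewrite E.
  by apply: eq_integral => y _ /=; rewrite ger0_norm.
by split=> //; rewrite -E integral_EFin.
Qed.

Let mr0 : measurable_fun (setT : set R1) r0.
Proof.
apply: measurable_funM; last by case: ir0.
exact/measurable_indicP/measurableC.
Qed.

Let mm0 : measurable_fun (setT : set R1) m0.
Proof.
apply: measurable_funM; last by case: in0.
exact/measurable_indicP/measurableC.
Qed.

Let W1 : weak_balance (mass_a r) (mass_b r u) (mass_c r) r0.
Proof. by have [_ _ w _] := sol; exact: (clean_mass n0 mN muN mN0 muN0 mrho mvel good ir0.1 w). Qed.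

Let W2 : weak_balance (mom_a r u) (mom_b p r u) (mom_c alpha r u) m0.
Proof.
have [_ _ _ w] := sol.
exact: (clean_momentum rho0 mN muN mN0 muN0 mrho mvel good in0.1 p_cont w).
Qed.

(** Common outcome for both kinds of reference state. Measurability is stated for the original [e]
    and [k], with which the final integrals are formed; the estimate itself concerns representatives
    equal to them off [N]. *)
Definition has_energy_estimate : Prop := exists (eta K : R * R -> R),
  [/\ measurable_fun (ohp : set R2) e, measurable_fun (ohp : set R2) k,
      (forall x, ohp x -> ~ N x -> e x = eta x) /\
      (forall x, ohp x -> ~ N x -> k x = K x),
      energy_estimate alpha eta K X eta0 &
      ((\int[leb R]_y eta0 y)%:E = total_rel_entropy h 0%R rho0 n0
                    (fun y => rhobar (0%R, y)) (fun y => nbar (0%R, y)))%E].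

Let br : bounded_mfun r := bounded_mfun_dens mN mrho good.
Let bu : bounded_mfun u := bounded_mfun_vel mN mvel good.
Let r_ge0 : forall x, ohp x -> 0 <= r x := fun x ox => dens_ge0 good ox.
Let sb := dens_vel_bound good.
Let r0_ge0 := dens0_ge0 good0.
Let m0_vac (y : R) : r0 y = 0 -> m0 y = 0 := @mom0_vacuum R rho0 n0 N0 good0 y.
Let ir := L1seg_dens0 mN0 ir0.1.
Let im := L1seg_mom0 mN0 in0.1.
Let W3 (ie : L1seg (fun y => entropy h 0 (r0 y) (m0 y))) f f1 f2 (T Y : R) (T0 : 0 < T) (Y0 : 0 < Y)
  (tf : C1_test f f1 f2 T Y) (f0 : forall x : R * R, 0 <= x.1 -> 0 <= f x) :
  \int[leb2 R]_(x in ohp) balance_integrand (ent_a h r u) (ent_b p h r u) (ent_c alpha h r u)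
      f f1 f2 x <=
    \int[leb R]_y (f (0, y) * entropy h 0 (r0 y) (m0 y)).
Proof.
have [_ _ _ ineq] := entropic.
exact: (clean_entropy mN muN mN0 muN0 mrho mvel good p_cont h_cont h_potential ie ineq T0 Y0 tf f0).
Qed.

Let X_strip T : (leb2 R).-integrable (strip T) (EFin \o X).
Proof. exact: xi_L1. Qed.

Lemma regular_has_energy_estimate : regular_positive_state rhobar nbar -> has_energy_estimate.
Proof.
move=> [[Crb Cnb] [crb cnb] [[M1 [_ H1]] [M2 [_ H2]]] inf0].
pose rb := extend rhobar; pose nb := extend nbar.
pose Mb := Num.max (M1 + 1) (M2 + 1).
have HMb x : half_plane x -> `|rhobar x| <= Mb /\ `|nbar x| <= Mb.
  have lt1 (z : R) : z < z + 1 by rewrite ltrDl.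
  move=> hx; split.
    by apply: (le_trans (H1 _ (lt1 M1) x hx)); rewrite /Mb le_max lexx.
  by apply: (le_trans (H2 _ (lt1 M2) x hx)); rewrite /Mb le_max lexx orbT.
have rb_lb x : half_plane x -> inf [set rhobar x | x in @half_plane R] <= rhobar x.
  move=> hx; apply: ge_inf; last by exists x.
  exists (- Mb) => _ [z hz <-]; have [+ _] := HMb z hz.
  by rewrite ler_norml => /andP[].
pose mb := inf [set rhobar x | x in @half_plane R].
have hp_ext (x : R * R) : half_plane ((ramp x.1, x.2) : R * R) by exact: ramp_ge0.
have rb_itv x : mb <= rb x <= Mb.
  rewrite rb_lb; last exact: hp_ext.
  have [+ _] := HMb _ (hp_ext x); exact: le_trans (ler_norm _).
have nb_bound x : `|nb x| <= Mb by have [] := HMb _ (hp_ext x).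
have crb' := continuous_extend crb; have cnb' := continuous_extend cnb.
have Crb' x (ox : ohp x) := (C1_at_extend Crb crb ox).2.
have Cnb' x (ox : ohp x) := (C1_at_extend Cnb cnb ox).2.
have rb0 x : 0 < rb x by case/andP: (rb_itv x) => /(lt_le_trans inf0).
have rbE x : ohp x -> rb x = rhobar x by move=> /ohp_half_plane; exact: extend_half_plane.
have nbE x : ohp x -> nb x = nbar x by move=> /ohp_half_plane; exact: extend_half_plane.
have rb0E y : rb (0, y) = rhobar (0, y) by apply: extend_half_plane; rewrite /half_plane/=.
have nb0E y : nb (0, y) = nbar (0, y) by apply: extend_half_plane; rewrite /half_plane/=.
have X_off x : ohp x -> ~ N x ->
    X x = rel_xi alpha p h r u rb nb (d_tau rhobar) (d_y rhobar) (d_tau nbar) (d_y nbar) x.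
  (* The positive infimum rules out the branch of [xi] for the zero state. *)
  move=> ox Nx; rewrite /X /xi; case: asboolP => [/(_ x (ohp_half_plane ox))[Z _]|_].
    by have := rb0 x; rewrite rbE// Z ltxx.
  have b0 : rhobar x != 0 by rewrite -rbE// gt_eqF.
  have [Crx _] := C1_at_extend Crb crb ox; have [Cnx _] := C1_at_extend Cnb cnb ox.
  have Civ := C1_at_inv b0 Crx.
  have [_ D1 _ _ _] := C1_at_mul Cnx Civ.
  have [_ D2 _ _ _] := C1_at_mul (C1_at_mul Cnx Cnx) Civ.
  have bp : 0 < rhobar x by rewrite -rbE.
  have [_ D3 _ _ _] := C1_at_comp Crx (is_derive_pressure p_C1 bp)
    (continuous_pressure_derivative p_C1 bp).
  have E1 : d_y (fun z => nbar z / rhobar z) x = ref_vel_y rb nb (d_y rhobar) (d_y nbar) x.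
    by rewrite /d_y (@derive_val _ _ _ _ _ _ _ D1) /ref_vel_y rbE// nbE// /d_y; field.
  have E2 : d_y (fun z => nbar z ^+ 2 / rhobar z) x =
      2 * nbar x * d_y nbar x / rhobar x - nbar x ^+ 2 * d_y rhobar x / rhobar x ^+ 2.
    rewrite (_ : (fun z => nbar z ^+ 2 / rhobar z) = fun z => nbar z * nbar z * (rhobar z)^-1).
      by rewrite /d_y (@derive_val _ _ _ _ _ _ _ D2) /d_y; field.
    by apply/funext => z; rewrite expr2.
  have E3 : d_y (fun z => p (rhobar z)) x = derive1 p (rhobar x) * d_y rhobar x.
    by rewrite /d_y (@derive_val _ _ _ _ _ _ _ D3).
  have [Er Eu] := dens_off rho n Nx.
  rewrite /xi1 /xi2 /xi3 /res /res1 /res2 E1 E2 E3 /rel_xi /ref_res1 /ref_res2 /rel_kinetic.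
  by rewrite Er Eu /ref_vel (rbE x)// (nbE x)// real_normK ?num_real.
have eta0E y : eta0 y = rel_entropy h 0 (r0 y) (m0 y) (rb (0, y)) (nb (0, y)).
  by rewrite rb0E nb0E.
have eta0_ge0 y : 0 <= eta0 y.
  rewrite eta0E /rel_entropy /rel_kinetic addr_ge0//.
    apply: mulr_ge0; first by rewrite mulr_ge0 ?expR_ge0.
    by apply: mulr_ge0; [exact: r0_ge0|exact: exprn_ge0].
  exact: (relative_potential_ge0 p_incr h_cont h_C2 h_potential (r0_ge0 y) (rb0 _)).
have cub (x : R * R) : {for x, continuous (fun x => nb x / rb x)}.
  by apply: cvgM; [exact: cnb'|apply: cvgV; [rewrite gt_eqF|exact: crb']].
have ch (x : R * R) : {for x, continuous (fun x => h (rb x))}.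
  apply: (@continuous_comp _ _ _ rb h); first exact: crb'.
  apply: differentiable_continuous; apply/derivable1_diffP.
  by case: (is_derive_potential h_C2 (rb0 x)).
have ch1 (x : R * R) : {for x, continuous (fun x => derive1 h (rb x))}.
  by apply: (@continuous_comp _ _ _ rb); [exact: crb'|exact: (continuous_potential1 h_C2 (rb0 x))].
have mt (f : R * R -> R) : (forall x : R * R, {for x, continuous f}) ->
    measurable_fun (setT : set R1) (fun y => f (0, y)).
  by move=> cf; apply: continuous_measurable_fun => y; exact: continuous_section2.
have meta0 : measurable_fun (setT : set R1) eta0.
  rewrite (_ : eta0 = fun y => rel_entropy h 0 (r0 y) (m0 y) (rb (0, y)) (nb (0, y))).
    apply: measurable_rel_entropy0 => //; [exact: (mt _ cub)|exact: (mt _ ch)| |exact: mt].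
    rewrite (_ : (fun y => _) = fun y => derive1 h (rb (0, y))); first exact: (mt _ ch1).
    by apply/funext => y; rewrite deriv_ge0_gt0.
  by apply/funext => y; rewrite eta0E.
have [ieta0 E0E] := eta0_int eta0_ge0 meta0.
have mo (f g : R * R -> R) : (forall x : R * R, {for x, continuous f}) ->
    (forall x, ohp x -> f x = g x) -> measurable_fun (ohp : set R2) g.
  move=> cf fg; apply: (@eq_measurable_fun _ _ _ _ _ f) => [x|]; first by rewrite inE; exact: fg.
  by apply: measurable_funTS; apply: continuous_at_measurable => //; exact: openT.
have [me mk] : measurable_fun (ohp : set R2) e /\ measurable_fun (ohp : set R2) k.
  apply: (@measurable_rel_density (fun x => nb x / rb x)).
  - by move=> x ox; rewrite rbE// nbE.
  - exact: mo cub _.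
  - exact: mo crb' rbE.
  - by apply: mo ch _ => x ox; rewrite rbE.
  - by apply: mo ch1 _ => x ox; rewrite -rbE// deriv_ge0_gt0.
exists (rel_eta h r u rb nb), (rel_K r u rb nb); split=> //.
  split=> x ox Nx; have [Er Eu] := dens_off rho n Nx.
    by rewrite /e /rel_entropy /rel_kinetic /rel_eta /ref_vel Er Eu rbE// nbE// real_normK ?num_real.
  by rewrite /k /rel_kinetic /rel_K /ref_vel Er Eu rbE// nbE// real_normK ?num_real.
exact: (regular_energy_estimate alpha_ge0 p_cont p_C1 p_incr h_cont h_C2 h_potential br bu r_ge0
  sb r0_ge0 m0_vac ir im W1 W2 W3 inf0 rb_itv nb_bound crb' cnb' Crb' Cnb' mN muN X_off X_strip
  eta0E ieta0).
Qed.

Lemma vacuum_has_energy_estimate : zero_state rhobar nbar -> vacuum_pressure_condition p -> has_energy_estimate.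
Proof.
move=> zero vacuum.
have z0 y : rhobar (0, y) = 0 /\ nbar (0, y) = 0 by apply: zero; rewrite /half_plane/=.
have zo x : ohp x -> rhobar x = 0 /\ nbar x = 0 by move=> /ohp_half_plane/zero.
have X0 : X = fun=> 0 by apply/funext => x; rewrite /X /xi asboolT.
have eta0E y : eta0 y = rel_entropy h 0 (r0 y) (m0 y) 0 0.
  by rewrite /eta0; have [-> ->] := z0 y.
have eta0_ge0 y : 0 <= eta0 y.
  rewrite eta0E /rel_entropy /rel_kinetic addr_ge0//.
    apply: mulr_ge0; first by rewrite mulr_ge0 ?expR_ge0.
    by apply: mulr_ge0; [exact: r0_ge0|exact: exprn_ge0].
  exact: (vacuum_relative_ge0 p_C1 p_incr h_cont h_C2 h_potential vacuum (r0_ge0 y)).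
have meta0 : measurable_fun (setT : set R1) eta0.
  rewrite (_ : eta0 = fun y => rel_entropy h 0 (r0 y) (m0 y) 0 0); first exact: measurable_rel_entropy0.
  by apply/funext => y; rewrite eta0E.
have [ieta0 E0E] := eta0_int eta0_ge0 meta0.
have mo (c : R) (g : R * R -> R) : (forall x, ohp x -> c = g x) -> measurable_fun (ohp : set R2) g.
  by move=> fg; apply: (@eq_measurable_fun _ _ _ _ _ (fun=> c)) => [x|//]; rewrite inE; exact: fg.
have [me mk] : measurable_fun (ohp : set R2) e /\ measurable_fun (ohp : set R2) k.
  apply: (@measurable_rel_density (fun=> 0)) => //.
  - by move=> x /zo[-> ->]; rewrite mul0r.
  - by apply: (mo 0) => x /zo[->].
  - by apply: (mo (h 0)) => x /zo[->].
  - by apply: (mo (deriv_ge0 h 0)) => x /zo[->].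
exists (vac_eta h r u), (vac_K r u); split=> //.
  split=> x ox Nx; have [Er Eu] := dens_off rho n Nx; have [rb nb] := zo x ox.
    by rewrite /e /rel_entropy /rel_kinetic /vac_eta Er Eu rb nb mul0r subr0 real_normK ?num_real.
  by rewrite /k /rel_kinetic /vac_K Er Eu rb nb mul0r subr0 real_normK ?num_real.
rewrite X0; exact: (vacuum_energy_estimate alpha_ge0 p_cont p_C1 p_incr h_cont h_C2 h_potential
  vacuum br bu r_ge0 (@vel_vacuum R rho n N) sb r0_ge0 m0_vac ir W1 W3 eta0E ieta0).
Qed.

End Clean.
End MainEstimate.

Unset Implicit Arguments.
Set Strict Implicit.
Set Printing Implicit Defensive.

Theorem theorem3p9 (R : realType) (alpha : R) (p h : R -> R)
    (rho n : R * R -> R) (rho0 n0 : R -> R) (rhobar nbar : R * R -> R)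
    (alpha_ge0 : 0 <= alpha)
    (p_cont : {within `[0, +oo[, continuous p})
    (p_C1 : C1_pos p)
    (p_incr : forall z : R, 0 < z -> 0 < derive1 p z)
    (h_cont : {within `[0, +oo[, continuous h})
    (h_C2 : C2_pos h)
    (h_potential : forall z : R, 0 < z -> p z = z * derive1 h z - h z)
    (data0 : initial_data rho0 n0)
    (sol : weak_solution alpha p rho n rho0 n0)
    (entropic : local_entropy_condition alpha h rho n rho0 n0)
    (reference : regular_positive_state rhobar nbar \/
                 (zero_state rhobar nbar /\ vacuum_pressure_condition p))
    (E0_finite : (total_rel_entropy h 0%R rho0 n0
                    (fun y => rhobar (0%R, y)) (fun y => nbar (0%R, y)) < +oo)%E)
    (xi_L1 : L1_loc_L1 (xi alpha p h rho n rhobar nbar)) :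
  forall phi : R -> R, C1_test_fun phi -> (forall t : R, 0 <= t -> 0 <= phi t) ->
    let E0 : \bar R := total_rel_entropy h 0%R rho0 n0
      (fun y => rhobar (0%R, y)) (fun y => nbar (0%R, y)) in
    let E (t : R) : \bar R := total_rel_entropy h t
      (fun y => rho (t, y)) (fun y => n (t, y))
      (fun y => rhobar (t, y)) (fun y => nbar (t, y)) in
    let D (t : R) : \bar R := (\int[leb R]_y
      (rel_kinetic (rho (t, y)) (n (t, y)) (rhobar (t, y)) (nbar (t, y)))%:E)%E in
    let lhs (t : R) : \bar R :=
      (- (derive1 phi t)%:E * E t
       + (phi t)%:E * ((2^-1)%:E * E t + alpha%:E * D t))%E in
    (* the left-hand side is a well-defined Lebesgue integral *)
    (leb R).-integrable `]0, +oo[ lhs /\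
    (\int[leb R]_(t in `]0%R, +oo[) lhs t
     <= (phi 0)%:E * E0
        + \int[leb R]_(t in `]0%R, +oo[)
            ((phi t)%:E * \int[leb R]_y (xi alpha p h rho n rhobar nbar (t, y))%:E))%E.
Proof.
move=> phi tphi phi_ge0 E0 E D lhs.
have [N [N0 [M [mN muN mN0 muN0 [good good0]]]]] := clean_null_sets data0 sol entropic.
have [eta [K [me mk [e_off k_off] est E0E]]] :
    has_energy_estimate alpha p h rho n rho0 n0 rhobar nbar N N0.
  case: reference => [regular|[zero vacuum]].
    exact: (regular_has_energy_estimate alpha_ge0 p_cont p_C1 p_incr h_cont h_C2 h_potential
      data0 sol entropic E0_finite xi_L1 mN muN mN0 muN0 good good0 regular).
  exact: (vacuum_has_energy_estimate alpha_ge0 p_cont p_C1 p_incr h_cont h_C2 h_potential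
    data0 sol entropic E0_finite mN muN mN0 muN0 good good0 zero vacuum).
have [T T0 Tend] := C1_test_fun_end tphi.
have [dphi cphi' _] := tphi.
have Dphi (t : R) : is_derive t 1 phi (derive1 phi t) by rewrite derive1E; exact/derivableP.
have [I L] := iterated_energy_ineq mN muN me mk e_off k_off est xi_L1 T0 Dphi cphi' Tend phi_ge0.
split; first exact: I.
by apply: le_trans L _; rewrite EFinM E0E.
Qed.
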